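(* Let $\ell \ge 2$ and $k \ge 0$ be integers, and let $q$ be the largest prime power with $q \le \ell$. Then there exists an integer $r_0$ (depending on $\ell$ and $k$) such that for every integer $r \ge r_0$ and every matroid $M$ of rank $r$ having no minor isomorphic to $U_{2,\ell+2}$, we have $W_k(M) \le \binom{r}{k}_q$.
   Context: For a matroid $M$ and integer $k\ge 0$, $W_k(M)$ denotes the number of flats of $M$ of rank $k$. $U_{2,n}$ is the rank-2 uniform matroid on $n$ elements. The $q$-binomial coefficient is $\binom{r}{k}_q = \frac{(q^r-1)(q^{r-1}-1)\cdots(q^{r-k+1}-1)}{(q^k-1)(q^{k-1}-1)\cdots(q-1)}$ for $0 \le k \le r$ (equal to $1$ when $k=0$); it equals the number of rank-$k$ flats of the projective geometry $\mathrm{PG}(r-1,q)$. *)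

(* Defs.v *)
From HB Require Import structures.
From mathcomp Require Import all_boot all_order all_algebra.

Set Implicit Arguments.
Unset Strict Implicit.
Unset Printing Implicit Defensive.

Import GRing.Theory.

(* A finite matroid, given by its independent sets. The ground set is a subset
   of T rather than all of T, so that the minors of M are matroids over the
   same type. *)
Record matroid (T : finType) := Matroid {
  ground : {set T};
  indep : pred {set T};
  indep_ground : forall I : {set T}, indep I -> I \subset ground;
  indep0 : indep set0;
  indep_sub : forall I J : {set T}, J \subset I -> indep I -> indep J;
  indep_aug : forall I J : {set T}, indep I -> indep J -> #|I| < #|J| ->
    exists2 x, x \in J :\: I & indep (x |: I)
}.

Section MatroidTheory.
Variables (T : finType) (M : matroid T).
Implicit Types (A B C D F I J X : {set T}).

Definition rk X : nat := \max_(I : {set T} | indep M I && (I \subset X)) #|I|.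

Definition mrank : nat := rk (ground M).

Definition mclosure X : {set T} := [set x in ground M | rk (x |: X) == rk X].

(* The condition forces F \subset ground M. *)
Definition flat F : bool := mclosure F == F.

Definition num_flats (k : nat) : nat := #|[set F | flat F & rk F == k]|.

Section Delete.
Variable D : {set T}.

Definition delete_indep : pred {set T} :=
  fun I => indep M I && (I \subset ground M :\: D).

Lemma delete_indep_ground I : delete_indep I -> I \subset ground M :\: D.
Proof. by case/andP. Qed.

Lemma delete_indep0 : delete_indep set0.
Proof. by rewrite /delete_indep indep0 sub0set. Qed.

Lemma delete_indep_sub I J :
  J \subset I -> delete_indep I -> delete_indep J.
Proof.
by move=> sJI /andP[iI sI]; rewrite /delete_indep (indep_sub sJI) ?(subset_trans sJI).
Qed.

Lemma delete_indep_aug I J :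
  delete_indep I -> delete_indep J -> #|I| < #|J| ->
  exists2 x, x \in J :\: I & delete_indep (x |: I).
Proof.
move=> /andP[iI sI] /andP[iJ sJ] /(indep_aug iI iJ)[x xJI ixI].
exists x => //; rewrite /delete_indep ixI subUset sI sub1set andbT.
by apply: (subsetP sJ); case/setDP: xJI.
Qed.

Definition delete : matroid T :=
  Matroid delete_indep_ground delete_indep0 delete_indep_sub delete_indep_aug.

End Delete.

Definition mbasis (C B : {set T}) : bool :=
  maxset (fun X => indep M X && (X \subset C)) B.

Lemma mbasisP C B : reflect
  [/\ indep M B, B \subset C & forall x, x \in C -> indep M (x |: B) -> x \in B]
  (mbasis C B).
Proof.
apply: (iffP maxsetP) => [[/andP[iB sBC] maxB]|[iB sBC maxB]]; split=> //.
- move=> x xC ixB; rewrite -(maxB (x |: B)) ?setU11 ?subsetUr //.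
  by rewrite ixB subUset sub1set xC.
- by rewrite iB.
- move=> X /andP[iX sXC] sBX; apply/eqP; rewrite eqEsubset sBX andbT.
  apply/subsetP=> x xX; apply: maxB; first exact: (subsetP sXC).
  by apply: indep_sub iX; rewrite subUset sub1set xX.
Qed.

Lemma mbasis_exists C : exists B, mbasis C B.
Proof.
have [|B maxB _] := @maxset_exists T (fun X => indep M X && (X \subset C)) set0.
  by rewrite indep0 sub0set.
by exists B.
Qed.

Lemma mbasis_card C B B' : mbasis C B -> mbasis C B' -> #|B| = #|B'|.
Proof.
suff le D D' : mbasis C D -> mbasis C D' -> #|D'| <= #|D|.
  by move=> b b'; apply/eqP; rewrite eqn_leq !le.
move=> /mbasisP[iD sD maxD] /mbasisP[iD' sD' _].
rewrite leqNgt; apply/negP=> /(indep_aug iD iD')[x /setDP[xD' xD] ixD].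
by move: xD; rewrite (maxD x) // (subsetP sD').
Qed.

Section Contract.
Variable C : {set T}.

Definition contract_indep : pred {set T} :=
  fun I => (I \subset ground M :\: C) &&
           [exists B : {set T}, mbasis C B && indep M (I :|: B)].

Lemma contract_indep_ground I : contract_indep I -> I \subset ground M :\: C.
Proof. by case/andP. Qed.

Lemma contract_indep0 : contract_indep set0.
Proof.
rewrite /contract_indep sub0set; have [B bB] := mbasis_exists C.
by apply/existsP; exists B; rewrite bB set0U; case/mbasisP: bB.
Qed.

Lemma contract_indep_sub I J :
  J \subset I -> contract_indep I -> contract_indep J.
Proof.
move=> sJI /andP[sI /existsP[B /andP[bB iIB]]].
rewrite /contract_indep (subset_trans sJI sI); apply/existsP; exists B.
by rewrite bB (indep_sub _ iIB) // setSU.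
Qed.

Lemma contract_indep_aug I J :
  contract_indep I -> contract_indep J -> #|I| < #|J| ->
  exists2 x, x \in J :\: I & contract_indep (x |: I).
Proof.
move=> /andP[sI /existsP[B /andP[bB iIB]]].
move=> /andP[sJ /existsP[B' /andP[bB' iJB']]] ltIJ.
have [_ sB maxB] := mbasisP _ _ bB; have [_ sB' _] := mbasisP _ _ bB'.
have card_disj (K L : {set T}) : K \subset ground M :\: C -> L \subset C ->
    #|K :|: L| = #|K| + #|L|.
  move=> sK sL; apply/eqP; rewrite (leq_card_setU K L).
  rewrite disjoint_subset; apply/subsetP=> x /(subsetP sK)/setDP[_].
  by apply: contra => /(subsetP sL).
have [|x /setDP[xJB' xIB] ix] := indep_aug iIB iJB'.
  by rewrite !card_disj // (mbasis_card bB bB') ltn_add2r.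
move: xIB; rewrite inE negb_or => /andP[xI xB].
have xJ: x \in J.
  case/setUP: xJB' => // /(subsetP sB') xC; case/negP: xB; apply: maxB => //.
  by apply: indep_sub ix; rewrite setUS ?subsetUr.
exists x; first by rewrite inE xI.
rewrite /contract_indep subUset sub1set (subsetP sJ) // sI.
by apply/existsP; exists B; rewrite bB -setUA.
Qed.

Definition contract : matroid T :=
  Matroid contract_indep_ground contract_indep0 contract_indep_sub
          contract_indep_aug.

End Contract.
End MatroidTheory.

(* The bijection is between the ground sets, not between the ambient types. *)
Definition matroid_iso (T U : finType) (M : matroid T) (N : matroid U) : Prop :=
  exists2 f : {x : T | x \in ground M} -> {y : U | y \in ground N},
    bijective f &
    forall X : {set {x : T | x \in ground M}},
      indep M (val @: X) = indep N (val @: (f @: X)).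

Definition has_minor (T U : finType) (M : matroid T) (N : matroid U) : Prop :=
  exists C D : {set T},
    [/\ C \subset ground M, D \subset ground M, [disjoint C & D] &
        matroid_iso (delete (contract M C) D) N].

Section Uniform.
Variables r n : nat.

Definition unif_indep : pred {set 'I_n} := fun I => #|I| <= r.

Lemma unif_indep_ground I : unif_indep I -> I \subset [set: 'I_n].
Proof. by rewrite subsetT. Qed.

Lemma unif_indep0 : unif_indep set0.
Proof. by rewrite /unif_indep cards0. Qed.

Lemma unif_indep_sub (I J : {set 'I_n}) :
  J \subset I -> unif_indep I -> unif_indep J.
Proof. by move/subset_leq_card; apply: leq_trans. Qed.

Lemma unif_indep_aug (I J : {set 'I_n}) :
  unif_indep I -> unif_indep J -> #|I| < #|J| ->
  exists2 x, x \in J :\: I & unif_indep (x |: I).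
Proof.
move=> _ iJ ltIJ; have /subsetPn[x xJ xI] : ~~ (J \subset I).
  by apply: contraL ltIJ => /subset_leq_card; rewrite -leqNgt.
exists x; first by rewrite inE xI.
by rewrite /unif_indep cardsU1 xI (leq_trans ltIJ).
Qed.

Definition uniform : matroid 'I_n :=
  Matroid unif_indep_ground unif_indep0 unif_indep_sub unif_indep_aug.

End Uniform.

Definition prime_power (q : nat) : Prop :=
  exists p e : nat, [/\ prime p, 0 < e & q = p ^ e].

(* Meaningful for 1 < q and k <= r; for r < k the factor i = r of the numerator
   vanishes and the value is 0. *)
Definition qbinom (q r k : nat) : rat :=
  ((\prod_(i < k) (q%:R ^+ (r - i) - 1)) /
   (\prod_(i < k) (q%:R ^+ (k - i) - 1)))%R.

(* Main.v *)
(** Throughout, a matroid is a rank function [r] and the contraction by [C] is handled by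
    working over the base set [C].

    A counting argument over iterated contractions shows that outside a set of density
    [O((q - 1/2)^r)] every line through a fixed point has at most [q + 1] points: otherwise one
    finds a configuration in which all relevant line sizes are forced, so that the flats avoiding
    the apex [e0] form a projective geometry of some order [Y], where [Y] is a prime power (by a
    group of elations) and hence equals [q], while the lines through [e0] are longer; projecting a
    plane from a suitable line then yields a line with more than [l + 1] points.  Consequently the
    normalised number of points of a contraction is, up to an exponentially small error,
    nondecreasing and bounded, and a dense matroid has a contraction containing a projective
    geometry over [GF(q)] of any given rank, linked to any given small flat.

    For the flats of rank [k], compare [W_k] with the [q]-binomial coefficient.  Linking a rank
    [k + 1] flat [G] into such a geometry shows that [G] has at most [q^k] hyperplanes avoiding a
    given point [e], which makes the ratio nondecreasing under contraction of [e]; a lack of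
    connectivity would instead let a restriction have ratio larger by a constant factor, which can
    happen only boundedly often.  Contracting down to a projective geometry, where the ratio is
    [1], bounds the ratio of the original matroid by [1]. *)

Require Import Defs.
From Stdlib Require Import Classical.
From mathcomp Require all_fingroup all_solvable.
From mathcomp Require Import all_boot all_order all_algebra.
From mathcomp Require Import zify ring.

Set Implicit Arguments.
Unset Strict Implicit.
Unset Printing Implicit Defensive.

(** * Closure, points and lines of contractions *)

Module Closure.

(** A [rankfun] is a matroid on all of [T]; elements outside the ground set become loops, so minors
    never change the type. Every bound must hold with one constant for all such matroids at once;
    hence the classes of configurations below, where the failure of unboundedness is what produces a
    constant. The rate q - 1/2 lies strictly between q - 1 and q: above q - 1, so that line counts
    capped at q - 1 gain at each contraction, and below q, so that errors vanish against q^r. Powers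
    of two already give l < q^2. This is used when a projective plane is contracted to rank two: it
    then shows more than q^2 >= l + 1 points, too many for a line, so a contraction adds no new
    points to a projective geometry. The difficulty for W_k is that the bound is exact while density
    arguments lose constants. A crude bound loses a constant, absorbed in a factor (3/2)^s; then s
    is lowered step by step, the bound for s + 1 supplying the connectivity needed for s. *)

Record rankfun (T : finType) := RankFun {
  rf :> {set T} -> nat;
  rf0 : rf set0 = 0;
  rfS : forall A B : {set T}, A \subset B -> rf A <= rf B;
  rfU1 : forall x (A : {set T}), rf (x |: A) <= (rf A).+1;
  rfUI : forall A B : {set T}, rf (A :|: B) + rf (A :&: B) <= rf A + rf B }.

Arguments rf0 {T} r : rename.
Arguments rfS {T} r {A B} _ : rename.
Arguments rfU1 {T} r x A : rename.
Arguments rfUI {T} r A B : rename.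

Section Closure.
Variables (T : finType) (r : rankfun T).
Implicit Types (A B C D F X Y Z : {set T}) (e f g p u x y : T).

Definition cl A := locked [set x | r (x |: A) == r A].

Lemma clE x A : (x \in cl A) = (r (x |: A) == r A).
Proof. by rewrite /cl -lock inE. Qed.

Lemma sub_cl A : A \subset cl A.
Proof. by apply/subsetP=> x xA; rewrite clE (setUidPr _) // sub1set. Qed.

Lemma mem_cl x A : x \in A -> x \in cl A.
Proof. exact: (subsetP (sub_cl A)). Qed.

Lemma rf_notin_cl x A : x \notin cl A -> r (x |: A) = (r A).+1.
Proof.
rewrite clE => h; apply/eqP; rewrite eqn_leq rfU1 ltn_neqAle eq_sym h.
exact/rfS/subsetUr.
Qed.

Lemma rf_in_cl x A : x \in cl A -> r (x |: A) = r A.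
Proof. by rewrite clE => /eqP. Qed.

Lemma clS A B : A \subset B -> cl A \subset cl B.
Proof.
move=> sAB; apply/subsetP=> x; rewrite !clE => /eqP h.
have [xB|xB] := boolP (x \in B); first by rewrite (setUidPr _) // sub1set.
have := rfUI r (x |: A) B; rewrite -setUA (setUidPr sAB) h.
have h1 := rfS r (subsetUr [set x] B).
have /(rfS r) : A \subset (x |: A) :&: B by rewrite subsetI sAB subsetUr.
lia.
Qed.

Lemma rf_subcl A B : B \subset cl A -> r (A :|: B) = r A.
Proof.
have [n] := ubnP #|B|; elim: n B => // n IH B.
have [->|[x xB]] := set_0Vmem B; first by rewrite setU0.
rewrite (cardsD1 x) xB ltnS => ltn sB.
have sB' : B :\ x \subset cl A by apply: subset_trans sB; apply: subD1set.
rewrite -{1}(setD1K xB) setUCA rf_in_cl ?IH //.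
by apply: (subsetP (clS (subsetUl A _))); apply: (subsetP sB).
Qed.

Lemma rf_cl A : r (cl A) = r A.
Proof. by rewrite -(rf_subcl (subxx (cl A))) (setUidPr (sub_cl A)). Qed.

Lemma cl_idem A : cl (cl A) = cl A.
Proof.
apply/eqP; rewrite eqEsubset sub_cl andbT; apply/subsetP=> x.
rewrite !clE rf_cl => /eqP h; rewrite eqn_leq.
by rewrite -{1}h !rfS ?subsetUr // setUS // sub_cl.
Qed.

Lemma cl_sub A B : (cl A \subset cl B) = (A \subset cl B).
Proof.
apply/idP/idP=> [|h]; first exact/subset_trans/sub_cl.
by rewrite -(cl_idem B) clS.
Qed.

Lemma eq_cl A B : A \subset cl B -> B \subset cl A -> cl A = cl B.
Proof. by move=> h1 h2; apply/eqP; rewrite eqEsubset !cl_sub h1. Qed.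

Lemma cl_eq_rank A B : A \subset cl B -> r B <= r A -> cl A = cl B.
Proof.
move=> sAB lB; apply: eq_cl => //; apply/subsetP=> x xB; rewrite clE eqn_leq.
rewrite (rfS r (subsetUr _ _)) andbT (leq_trans _ lB) // -(rf_cl B).
by apply: rfS; rewrite subUset sub1set mem_cl.
Qed.

Lemma clU_cl A B : cl (cl A :|: B) = cl (A :|: B).
Proof.
apply: eq_cl.
  rewrite subUset (subset_trans (subsetUr _ _) (sub_cl _)) clS ?subsetUl //.
by rewrite (subset_trans _ (sub_cl _)) // setSU // sub_cl.
Qed.

Lemma clU1_cl x A : cl (x |: cl A) = cl (x |: A).
Proof. by rewrite setUC clU_cl setUC. Qed.

Lemma rfU_cl A B : r (cl A :|: B) = r (A :|: B).
Proof. by rewrite -rf_cl clU_cl rf_cl. Qed.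

Lemma exchange x y A : y \in cl (x |: A) -> y \notin cl A -> x \in cl (y |: A).
Proof.
move=> h1 h2; rewrite clE setUCA (rf_in_cl h1) (rf_notin_cl h2) eqn_leq rfU1 /=.
rewrite -(rf_notin_cl h2) -(rf_in_cl h1).
by apply: rfS; rewrite setUCA subsetUr.
Qed.

Lemma cl_exchange x y A :
  y \in cl (x |: A) -> y \notin cl A -> cl (y |: A) = cl (x |: A).
Proof.
move=> h1 h2; have h3 := exchange h1 h2.
have hs z : A \subset cl (z |: A) by rewrite (subset_trans (subsetUr _ _) (sub_cl _)).
by apply: eq_cl; rewrite subUset sub1set hs andbT.
Qed.

Lemma mem_clU1 x A : x \in cl (x |: A).
Proof. by apply: mem_cl; rewrite setU11. Qed.

Lemma sub_clU1 x A : cl A \subset cl (x |: A).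
Proof. exact/clS/subsetUr. Qed.

Lemma notin_cl2 x y A : x \notin cl A -> y \notin cl (x |: A) ->
  r (y |: (x |: A)) = (r A).+2.
Proof. by move=> h1 h2; rewrite !rf_notin_cl. Qed.

Lemma rf_mod A B C : A \subset B -> r (B :|: C) + r A <= r B + r (A :|: C).
Proof.
move=> sAB; have := rfUI r B (A :|: C); rewrite setUA (setUidPl sAB).
have /(rfS r) : A \subset B :&: (A :|: C) by rewrite subsetI sAB subsetUl.
lia.
Qed.

Definition is_flat F := cl F == F.

Lemma flat_cl A : is_flat (cl A).
Proof. by rewrite /is_flat cl_idem. Qed.
Hint Resolve flat_cl : core.

Lemma flatE F : is_flat F -> cl F = F. Proof. by move/eqP. Qed.

Lemma flat_sub A F : is_flat F -> (cl A \subset F) = (A \subset F).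
Proof. by move/flatE=> h; rewrite -{1}h cl_sub h. Qed.

Lemma flat_eq F G : is_flat F -> is_flat G -> F \subset G -> r G <= r F -> F = G.
Proof.
move=> /flatE hF /flatE hG sFG le; rewrite -hF -hG; apply: cl_eq_rank => //.
by rewrite hG.
Qed.

Lemma flatI F G : is_flat F -> is_flat G -> is_flat (F :&: G).
Proof.
move=> hF hG; rewrite /is_flat eqEsubset sub_cl andbT.
by rewrite subsetI !flat_sub // subsetIl subsetIr.
Qed.

(* [pts C X] is the set of points of M/C met by X, each represented by a rank-one flat over C;
   [cos D f] is the point of M/D containing f, without the loops of M/D. *)
Definition pts C X := (fun f => cl (f |: C)) @: (X :\: cl C).
Definition nP C X := #|pts C X|.
Definition cos D f := cl (f |: D) :\: cl D.

Lemma ptsP C X F :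
  reflect (exists2 f, f \in X /\ f \notin cl C & F = cl (f |: C)) (F \in pts C X).
Proof.
apply: (iffP imsetP) => [[f]|[f [fX fC] ->]].
  by rewrite inE => /andP[? ?] ->; exists f.
by exists f => //; rewrite inE fX fC.
Qed.

Lemma mem_pts C X f : f \in X -> f \notin cl C -> cl (f |: C) \in pts C X.
Proof. by move=> h1 h2; apply/ptsP; exists f. Qed.

Lemma pts_cl C X : pts (cl C) X = pts C X.
Proof. by rewrite /pts cl_idem; apply: eq_imset => f; rewrite clU1_cl. Qed.

Lemma nP_cl C X : nP (cl C) X = nP C X. Proof. by rewrite /nP pts_cl. Qed.

Lemma ptsS C X Y : X \subset Y -> pts C X \subset pts C Y.
Proof. by move=> s; apply/imsetS/setSD. Qed.

Lemma nPS C X Y : X \subset Y -> nP C X <= nP C Y.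
Proof. by move=> s; apply/subset_leq_card/ptsS. Qed.

Lemma nPU C X Y : nP C (X :|: Y) <= nP C X + nP C Y.
Proof. by rewrite /nP /pts setDUl imsetU leq_card_setU. Qed.

Lemma nPD C X : nP C (X :\: cl C) = nP C X.
Proof. by rewrite /nP /pts setDDl setUid. Qed.

Lemma nP0 C X : X \subset cl C -> nP C X = 0.
Proof.
by move=> s; rewrite /nP /pts (_ : _ :\: _ = set0) ?imset0 ?cards0 //; apply/eqP; rewrite setD_eq0.
Qed.

Lemma nP_gt0 C X f : f \in X -> f \notin cl C -> 0 < nP C X.
Proof. by move=> h1 h2; apply/card_gt0P; exists (cl (f |: C)); apply: mem_pts. Qed.

Lemma nP_contract C D X : C \subset cl D -> nP D X <= nP C X.
Proof.
move=> sCD; have /subset_leq_card : pts D X \subset (fun F => cl (F :|: D)) @: pts C X.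
  apply/subsetP=> F /ptsP[f [fX fD] ->]; apply/imsetP; exists (cl (f |: C)).
    by apply: mem_pts => //; apply: contra fD; apply/subsetP; rewrite cl_sub.
  rewrite clU_cl -setUA; apply: eq_cl; first exact/(subset_trans _ (sub_cl _))/setUS/subsetUr.
  rewrite !subUset sub1set mem_clU1 (subset_trans sCD (sub_clU1 _ _)).
  by rewrite (subset_trans (subsetUr _ _) (sub_cl _)).
by move=> h; apply: leq_trans h (leq_imset_card _ _).
Qed.

(** A point of M/C outside cl D spans exactly one point of M/D; grouping by it turns line sizes into
    global counts. *)
Lemma nP_partition C D X : C \subset cl D ->
  nP C (X :\: cl D) = \sum_(F in pts D X) nP C (X :&: (F :\: cl D)).
Proof.
move=> sCD; set A := pts C (X :\: cl D).
have hcl f : f \notin cl D -> cl (cl (f |: C) :|: D) = cl (f |: D).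
  move=> fD; rewrite clU_cl -setUA; apply: eq_cl; last exact/(subset_trans _ (sub_cl _))/setUS/subsetUr.
  rewrite !subUset sub1set mem_clU1 (subset_trans sCD (sub_clU1 _ _)).
  by rewrite (subset_trans (subsetUr _ _) (sub_cl _)).
have notC f : f \notin cl D -> f \notin cl C.
  by apply: contra; apply/subsetP; rewrite cl_sub.
have -> : pts D X = (fun G => cl (G :|: D)) @: A.
  apply/setP=> F; apply/ptsP/imsetP=> [[f [fX fD] ->]|[G /ptsP[f [+ _] ->] ->]].
    exists (cl (f |: C)); last by rewrite hcl.
    by apply: mem_pts; [rewrite in_setD fD | apply: notC].
  by rewrite in_setD => /andP[fD fX]; exists f => //; rewrite hcl.
rewrite /nP -/A -sum1_card (partition_big_imset (fun G => cl (G :|: D))) /=.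
apply: eq_bigr => F /imsetP[G0 /ptsP[f0 [+ _] ->] eF]; rewrite in_setD => /andP[f0D f0X].
rewrite sum1dep_card /nP; apply: eq_card => G; rewrite inE.
apply/andP/ptsP=> [[/ptsP[f [+ fC] ->]]|[f [+ fC] ->]].
  rewrite in_setD => /andP[fD fX] /eqP; rewrite hcl // => eG; exists f => //; split=> //.
  by rewrite in_setI in_setD fD fX -eG mem_clU1.
rewrite in_setI in_setD => /and3P[fX fD fF]; split.
  by apply: mem_pts => //; rewrite in_setD fD fX.
move: fF; rewrite eF !hcl // => fF; apply/eqP; exact: cl_exchange.
Qed.

Lemma nP_le_mul C D X (y : nat) : C \subset cl D ->
  (forall f, f \in X -> f \notin cl D -> nP C (X :&: cos D f) <= y) ->
  nP C (X :\: cl D) <= y * nP D X.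
Proof.
move=> sCD h; rewrite nP_partition // mulnC -sum_nat_const leq_sum //.
by move=> F /ptsP[f [fX fD] ->]; apply: h.
Qed.

Lemma nP_ge_mul C D X (y : nat) : C \subset cl D ->
  (forall f, f \in X -> f \notin cl D -> y <= nP C (X :&: cos D f)) ->
  y * nP D X <= nP C (X :\: cl D).
Proof.
move=> sCD h; rewrite nP_partition // mulnC -sum_nat_const leq_sum //.
by move=> F /ptsP[f [fX fD] ->]; apply: h.
Qed.

Lemma nP_sub1 C e X : X \subset cl (e |: C) -> nP C X <= 1.
Proof.
move=> sX; rewrite /nP -(cards1 (cl (e |: C))); apply: subset_leq_card.
apply/subsetP=> F /ptsP[f [fX fC] ->]; rewrite inE; apply/eqP/cl_exchange => //.
exact: (subsetP sX).
Qed.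

Lemma nP_splitD C X Y : nP C X <= nP C (X :\: Y) + nP C (X :&: Y).
Proof. by rewrite -{1}(setID X Y) setUC nPU. Qed.

Lemma nP_step C e X : nP C X <= (nP C (X :\: cl (e |: C))).+1.
Proof.
apply: leq_trans (nP_splitD C X (cl (e |: C))) _; rewrite -addn1 leq_add2l.
exact: nP_sub1 (subsetIr _ _).
Qed.

Lemma cos_sub D f g : g \in cos D f -> cos D g = cos D f.
Proof. by rewrite inE => /andP[h1 h2]; rewrite /cos (cl_exchange h2 h1). Qed.

(** Two points g1, g2 of the line, other than e, cannot merge in M/D: e lies on the line they span
    and would become parallel to g1, whereas f, hence g1, is not spanned by e over D. So lines
    through e only grow. *)
Lemma nP_line_mono S C D e f : C \subset cl D -> e \notin cl D -> f \notin cl (e |: D) ->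
  nP C (S :&: cos (e |: C) f) <= nP D (S :&: cos (e |: D) f).
Proof.
move=> sCD eD fD; set h := fun F => cl (F :|: D).
have sC2 : e |: C \subset cl (e |: D).
  by rewrite subUset sub1set mem_clU1 (subset_trans sCD) // sub_clU1.
have fC : f \notin cl (e |: C) by apply: contra fD; apply/subsetP; rewrite cl_sub.
have hcl g : h (cl (g |: C)) = cl (g |: D).
  rewrite /h clU_cl -setUA; apply: eq_cl; last exact/(subset_trans _ (sub_cl _))/setUS/subsetUr.
  rewrite !subUset sub1set mem_clU1 (subset_trans sCD (sub_clU1 _ _)).
  by rewrite (subset_trans (subsetUr _ _) (sub_cl _)).
have gD g : g \in cos (e |: C) f -> g \notin cl (e |: D).
  rewrite inE => /andP[gC gf]; apply: contra fD => gD.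
  have : f \in cl (g |: (e |: C)) by apply: exchange gf gC.
  by apply/subsetP; rewrite cl_sub subUset sub1set gD.
have hinj : {in pts C (S :&: cos (e |: C) f) &, injective h}.
  move=> F1 F2 /ptsP[g1 [+ g1C] ->] /ptsP[g2 [+ g2C] ->].
  move=> /setIP[_ hg1] /setIP[_ hg2]; rewrite !hcl => e12.
  apply: contraTeq (gD _ hg1) => ne12; rewrite negbK.
  have n12 : g2 \notin cl (g1 |: C).
    by apply: contra ne12 => g21; rewrite (cl_exchange g21 g2C).
  have h3 : e \in cl (g2 |: (g1 |: C)).
    have : g2 \in cl (e |: (g1 |: C)).
      rewrite setUCA; have := hg2; rewrite -(cos_sub hg1) inE => /andP[_].
      by [].
    by move/exchange; apply.
  have {}h3 : e \in cl (g1 |: D).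
    apply: subsetP h3; rewrite cl_sub !subUset !sub1set mem_clU1 e12 mem_clU1.
    by rewrite (subset_trans sCD) // sub_clU1.
  exact: exchange h3 eD.
rewrite /nP -(card_in_imset hinj); apply: subset_leq_card.
apply/subsetP=> _ /imsetP[_ /ptsP[g [/setIP[gS hg] gC] ->] ->]; rewrite hcl.
have gD' := gD _ hg; apply: mem_pts; last by apply: contra gD'; apply/subsetP/sub_clU1.
rewrite inE gS inE gD' /=; move: hg; rewrite inE => /andP[_].
apply/subsetP; rewrite cl_sub subUset sub1set mem_clU1 (subset_trans sC2) //.
exact: sub_clU1.
Qed.

(** Excludes U_{2,l+2} as a minor, in rank terms: [S] is a simple restriction of M/C of rank at most
    two. *)
Definition no_long_line l := forall C (S : {set T}), r (S :|: C) <= (r C).+2 ->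
  {in S &, forall x y, x != y -> r (x |: (y |: C)) = (r C).+2} -> #|S| <= l.+1.

Lemma imset_transversal (rT : finType) (h : T -> rT) A :
  exists2 S : {set T}, S \subset A & {in S &, injective h} /\ h @: S = h @: A.
Proof.
have [n] := ubnP #|A|; elim: n A => // n IH A ltA.
have [/forall_inP hi|/forall_inPn[x xA /forall_inPn[y yA]]] :=
  boolP [forall x in A, forall y in A, (h x == h y) ==> (x == y)].
  exists A => //; split=> // x y xA yA /eqP hxy.
  by have /forall_inP/(_ y yA)/implyP/(_ hxy)/eqP := hi x xA.
rewrite negb_imply => /andP[/eqP hxy nxy].
have [|S sS [iS eS]] := IH (A :\ x); first by rewrite (cardsD1 x) xA in ltA.
exists S; first by rewrite (subset_trans sS) // subD1set.
split=> //; rewrite eS; apply/setP=> z; apply/imsetP/imsetP=> [[t]|[t tA ->]].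
  by rewrite !inE => /andP[_ tA] ->; exists t.
have [->|ntx] := eqVneq t x; last by exists t => //; rewrite !inE ntx.
by exists y => //; rewrite !inE eq_sym nxy.
Qed.

Lemma pts_transversal C X : exists2 S : {set T}, S \subset X :\: cl C &
  [/\ #|S| = nP C X, pts C S = pts C X &
      {in S &, forall x y, x != y -> x \notin cl (y |: C)}].
Proof.
have [S sS [iS eS]] := imset_transversal (fun f => cl (f |: C)) (X :\: cl C).
have SC x : x \in S -> x \notin cl C by move/(subsetP sS); rewrite inE => /andP[].
exists S => //; split; first by rewrite /nP /pts -eS card_in_imset.
  rewrite /pts -eS (_ : S :\: cl C = S) //; apply/setP=> x; rewrite inE.
  by case xS: (x \in S); rewrite ?andbF // (SC _ xS).
move=> x y xS yS; apply: contra => hx; apply/eqP/iS => //.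
by apply: cl_exchange => //; apply: SC.
Qed.

Lemma nP_line l C X : no_long_line l -> r (X :|: C) <= (r C).+2 -> nP C X <= l.+1.
Proof.
move=> U hX; have [S sS [<- _ iS]] := pts_transversal C X; apply: (U C).
  apply: leq_trans hX; apply/rfS/setSU/(subset_trans sS)/subsetDl.
move=> x y xS yS nxy; apply: notin_cl2; last exact: iS.
by have := subsetP sS _ yS; rewrite inE => /andP[].
Qed.

(** The line through e and f has at most l + 1 points, one of them e itself; if e is a loop of M/C,
    the coset is at most one point. *)
Lemma nP_cos l S C e f : 0 < l -> no_long_line l -> nP C (S :&: cos (e |: C) f) <= l.
Proof.
move=> l0 U; apply: leq_trans (nPS _ (subsetIr _ _)) _.
have [eC|eC] := boolP (e \in cl C).
  have hc : cl (e |: C) = cl C by apply: eq_cl; rewrite ?subUset ?sub1set ?eC ?sub_cl // (subset_trans (subsetUr _ _) (sub_cl _)).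
  apply: leq_trans l0; apply: (@nP_sub1 _ f); apply: subset_trans (subsetDl _ _) _.
  by rewrite -clU1_cl hc clU1_cl.
have h1 : nP C (cl (f |: (e |: C))) <= l.+1.
  apply: nP_line => //; rewrite (setUidPl _) ?rf_cl; first by rewrite (leq_trans (rfU1 r _ _)) // ltnS rfU1.
  by rewrite (subset_trans _ (sub_cl _)) // setUA subsetUr.
suff : nP C (cos (e |: C) f) < nP C (cl (f |: (e |: C))) by lia.
apply/proper_card/properP; split; first exact/ptsS/subsetDl.
exists (cl (e |: C)); first by apply: mem_pts => //; apply: mem_cl; rewrite setUA setUC !inE eqxx ?orbT.
apply/negP=> /ptsP[g [+ gC] eg]; rewrite inE => /andP[+ _].
by rewrite eg mem_clU1.
Qed.

Lemma nP_le_step l C e X : 0 < l -> no_long_line l -> nP C X <= (l * nP (e |: C) X).+1.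
Proof.
move=> l0 U; apply: leq_trans (nP_step C e X) _; rewrite ltnS.
by apply: nP_le_mul; [rewrite (subset_trans (subsetUr _ _) (sub_cl _)) | move=> *; apply: nP_cos].
Qed.

Lemma nP_bound l a C X : 0 < l -> no_long_line l -> r (X :|: C) <= r C + a -> nP C X <= l.+1 ^ a.
Proof.
move=> l0 U; elim: a C => [|a IH] C hX.
  rewrite nP0 //; apply/subsetP=> x xX; rewrite clE eqn_leq (rfS r (subsetUr _ _)) andbT.
  by rewrite addn0 in hX; apply: leq_trans hX; apply/rfS/setSU; rewrite sub1set.
have [s|/subsetPn[e eX eC]] := boolP (X \subset cl C); first by rewrite nP0.
apply: leq_trans (nP_le_step C e X l0 U) _.
have {}IH : nP (e |: C) X <= l.+1 ^ a.
  apply: IH; rewrite setUCA (setUidPr _) ?sub1set ?inE ?eX // (rf_notin_cl eC).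
  by rewrite addSnnS.
rewrite expnS mulSn -addn1 addnC leq_add ?expn_gt0 // leq_mul2l IH orbT //.
Qed.

End Closure.
End Closure.
Import Closure.

(** * Flats with exactly determined line sizes *)

Lemma card_bigcup_le (I T : finType) (P : {set I}) (B : I -> {set T}) :
  #|\bigcup_(i in P) B i| <= \sum_(i in P) #|B i|.
Proof.
elim/big_rec2: _ => [|i n A _ h]; first by rewrite cards0.
by apply: leq_trans (leq_card_setU _ _) _; rewrite leq_add2l.
Qed.

Section Flats.
Variables (T : finType) (r : rankfun T).
Implicit Types (A B C D F G H K L X Z : {set T}) (e f g p u x y : T).
Notation cl := (cl r).
Notation nP := (nP r).
Notation pts := (pts r).
Notation is_flat := (is_flat r).
Notation cos := (cos r).

Lemma notin_flat F x : is_flat F -> (x \notin cl F) = (x \notin F).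
Proof. by move/flatE->. Qed.

Lemma flat_U1 F G x : is_flat G -> F \subset G -> x \in G -> cl (x |: F) \subset G.
Proof. by move=> h1 h2 h3; rewrite flat_sub // subUset sub1set h3. Qed.

Lemma subset_clU1 x A : A \subset cl (x |: A).
Proof. exact: subset_trans (subsetUr _ _) (sub_cl _ _). Qed.

Lemma ltn_rank_ex A B : r A < r B -> exists2 x, x \in B & x \notin cl A.
Proof.
move=> lt; apply/subsetPn; apply: contraL lt => s; rewrite -leqNgt -(rf_cl r A).
exact: rfS.
Qed.

Lemma flat_lt F G : is_flat F -> F \subset G -> ~~ (G \subset F) -> r F < r G.
Proof.
move=> hF sFG; rewrite ltnNge; apply: contra => le.
by rewrite -(flatE hF) (cl_eq_rank _ le) ?sub_cl // (subset_trans sFG) // sub_cl.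
Qed.

(** Adding to Z, one at a time, elements of H not yet spanned together with L keeps K skew to L over
    Z, until K and L span H. *)
Lemma rel_basis Z L H : Z \subset L ->
  exists K, [/\ Z \subset K, K \subset Z :|: H, r (K :|: L) = r (H :|: L) &
                r K + r L = r Z + r (K :|: L)].
Proof.
move=> sZL.
suff: forall n K, Z \subset K -> K \subset Z :|: H -> r K + r L = r Z + r (K :|: L) ->
   r (H :|: L) - r (K :|: L) <= n -> exists K, [/\ Z \subset K, K \subset Z :|: H,
   r (K :|: L) = r (H :|: L) & r K + r L = r Z + r (K :|: L)].
  by move=> /(_ _ Z); apply=> //; rewrite ?subsetUl // (setUidPr sZL).
elim=> [|n IH] K sZK sKH eK.
  move=> le; exists K; split=> //.
  have : r (K :|: L) <= r (H :|: L).
    apply: rfS; rewrite subUset subsetUr andbT (subset_trans sKH) //.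
    by rewrite setUC setUS.
  lia.
move=> le; have [h|] := leqP (r (H :|: L)) (r (K :|: L)).
  by apply: (IH K) => //; lia.
move=> /ltn_rank_ex[x xHL xKL].
have xH : x \in H.
  by case/setUP: xHL => // xL; case/negP: xKL; apply: mem_cl; rewrite inE xL orbT.
have xK : x \notin cl K by apply: contra xKL; apply/subsetP/clS/subsetUl.
apply: (IH (x |: K)); rewrite -?setUA ?rf_notin_cl //; try lia.
- by rewrite (subset_trans sZK) // subsetUr.
- by rewrite subUset sub1set sKH inE xH orbT.
Qed.

(** Projection from a point p off A is injective on the flats of A: joining p to Z adds nothing
    inside A. *)
Lemma cl_meet A Z p x : is_flat A -> is_flat Z -> Z \subset A -> p \notin A ->
  x \in A -> x \in cl (p |: Z) -> x \in Z.
Proof.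
move=> hA hZ sZA pA xA xpZ; apply: contraNT pA => xZ.
have : p \in cl (x |: Z) by apply: exchange => //; rewrite notin_flat.
by apply/subsetP/flat_U1.
Qed.

(** * Affine counting: P as an affine space with A as its hyperplane at infinity *)

Section Exact.
Variables (C A P : {set T}) (e0 : T) (y0 Y : nat).
Hypotheses (Cf : is_flat C) (Af : is_flat A) (sCA : C \subset A) (e0C : e0 \notin C).
Hypothesis (PA : forall p, p \in P -> p \notin A).
Hypothesis (Pl : forall p p', p \in P -> p' \in P -> p' \in cl (p |: A)).
(* [wt Z] is the number of points that P must have in the coset of Z spanned by any of its
   elements, when every line through the apex e0 has y0 other points and every other line Y. *)
Definition mult Z G := if (e0 \notin Z) && (e0 \in G) then y0 else Y.
Definition wt Z := if e0 \in Z then y0 * Y ^ (r Z - r C).-1 else Y ^ (r Z - r C).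
Hypothesis h1 : forall Z u p, is_flat Z -> C \subset Z -> Z \subset A -> u \in A -> u \notin Z ->
  p \in P -> nP Z (P :&: cl (p |: (u |: Z))) <= mult Z (cl (u |: Z)).
Hypothesis h2 : wt A <= nP C P.
Hypothesis h3 : forall p p', p \in P -> p' \in P -> p' \notin cl (p |: C) ->
  exists2 u, u \in A /\ u \notin C & u \in cl (p' |: (p |: C)).
Hypotheses (y0_gt0 : 0 < y0) (Y_gt1 : 1 < Y).

Lemma wt_gt0 Z : 0 < wt Z.
Proof. by rewrite /wt; case: ifP; rewrite ?muln_gt0 ?y0_gt0 ?expn_gt0 ?(ltnW Y_gt1). Qed.

Lemma wtC : wt C = 1. Proof. by rewrite /wt (negPf e0C) subnn. Qed.

Lemma wt_step Z u : is_flat Z -> C \subset Z -> u \notin Z ->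
  wt (cl (u |: Z)) = mult Z (cl (u |: Z)) * wt Z.
Proof.
move=> Zf sCZ uZ; rewrite /wt /mult rf_cl rf_notin_cl ?notin_flat //.
have le : r C <= r Z by apply: rfS.
case e0Z: (e0 \in Z) => /=.
  rewrite (subsetP (subset_clU1 u Z) _ e0Z).
  have : r C < r Z by apply: flat_lt => //; apply: contra e0C => /subsetP; apply.
  by move=> lt; rewrite mulnCA -expnS; congr (_ * _ ^ _); lia.
by case: ifP => _; rewrite subSn // expnS.
Qed.

(** The set P :&: cl (p |: Z) is the affine subspace through p of direction Z. Raising the direction
    by one element at a time from Z to Z2, [h1] caps each factor, and by [wt_step] the caps multiply
    to wt Z2 / wt Z. *)
Lemma chain_bound Z Z2 p : is_flat Z -> is_flat Z2 -> C \subset Z -> Z \subset Z2 -> Z2 \subset A ->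
  p \in P -> nP Z (P :&: cl (p |: Z2)) * wt Z <= wt Z2.
Proof.
have [n] := ubnP (r Z2 - r Z); elim: n Z p => // n IH Z p lt Zf Z2f sCZ sZ2 sZA pP.
have [s|/subsetPn[u uZ2 uZ]] := boolP (Z2 \subset Z).
  have -> : Z2 = Z by apply/eqP; rewrite eqEsubset s.
  by rewrite -{2}(mul1n (wt Z)) leq_mul2r (@nP_sub1 _ _ _ p) ?orbT // subsetIr.
have uA := subsetP sZA _ uZ2.
have sZ1 : cl (u |: Z) \subset Z2 by apply: flat_U1.
have sZ1A := subset_trans sZ1 sZA.
set X := P :&: _; have XD : X :\: cl (u |: Z) = X.
  apply/setP=> x; rewrite !inE; case xP: (x \in P); rewrite ?andbF //=.
  by case xu: (x \in _) => //=; have := PA xP; rewrite (subsetP sZ1A).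
have hX : nP Z X <= mult Z (cl (u |: Z)) * nP (u |: Z) X.
  rewrite -{1}XD; apply: nP_le_mul => [|f fX fu]; first exact: subset_clU1.
  have fP : f \in P by case/setIP: fX.
  apply: leq_trans (h1 Zf sCZ (subset_trans sZ2 sZA) uA uZ fP).
  by apply: nPS; apply: setISS; rewrite ?subsetIl ?subsetDl.
have rlt : r (cl (u |: Z)) = (r Z).+1 by rewrite rf_cl rf_notin_cl ?notin_flat.
have := IH (cl (u |: Z)) p; rewrite nP_cl -/X wt_step //.
have : r (cl (u |: Z)) <= r Z2 by apply: rfS.
move=> le /(_ _ (flat_cl _ _) Z2f _ sZ1 sZA pP) IH'.
apply: leq_trans (_ : mult Z (cl (u |: Z)) * nP (u |: Z) X * wt Z <= _).
  by rewrite leq_mul2r hX orbT.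
have -> : mult Z (cl (u |: Z)) * nP (u |: Z) X * wt Z
   = nP (u |: Z) X * (mult Z (cl (u |: Z)) * wt Z) by rewrite mulnCA mulnA.
apply: IH'; first by move: lt le; rewrite rlt; clear; lia.
by rewrite (subset_trans sCZ) // subset_clU1.
Qed.

Lemma PclA p : p \in P -> P :&: cl (p |: A) = P.
Proof. by move=> pP; apply/setIidPl/subsetP=> p' p'P; apply: Pl. Qed.

Lemma PDZ X Z : Z \subset A -> X \subset P -> X :\: Z = X.
Proof.
move=> sZA sXP; apply/setP=> x; rewrite inE; case xX: (x \in X); rewrite ?andbF // andbT.
by apply: contra (PA (subsetP sXP _ xX)); apply: (subsetP sZA).
Qed.

(** The caps from C to Z and from Z to A multiply to wt A, which [h2] attains from below. There is
    no slack, so a single deviating coset would break the total. *)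
Lemma coset_card Z p : is_flat Z -> C \subset Z -> Z \subset A -> p \in P ->
  nP C (P :&: cl (p |: Z)) = wt Z.
Proof.
move=> Zf sCZ sZA pP; apply/eqP; rewrite eqn_leq.
have up p' : p' \in P -> nP C (P :&: cl (p' |: Z)) <= wt Z.
  by move=> p'P; have := chain_bound Cf Zf (subxx _) sCZ sZA p'P; rewrite wtC muln1.
rewrite up //= leqNgt; apply/negP=> lt.
have pZ : p \notin cl Z by rewrite notin_flat //; apply: contra (PA pP); apply: (subsetP sZA).
have hA := chain_bound Zf Af sCZ sZA (subxx _) pP; rewrite PclA // in hA.
have : nP C (P :\: cl Z) < nP Z P * wt Z.
  have -> : nP Z P * wt Z = \sum_(F in pts Z P) wt Z by rewrite sum_nat_const.
  have pin : cl (p |: Z) \in pts Z P by apply: mem_pts.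
  rewrite nP_partition ?(subset_trans sCZ) ?sub_cl // !(bigD1 (cl (p |: Z)) pin) /=.
  rewrite -addSn leq_add //.
    by apply: leq_ltn_trans lt; apply: nPS; rewrite setIS // subsetDl.
  apply: leq_sum => F /andP[/ptsP[f [fP fZ] ->] _]; apply: leq_trans (up f fP).
  by apply: nPS; rewrite setIS // subsetDl.
by rewrite flatE // PDZ // => h4; have := leq_trans h4 (leq_trans hA h2); rewrite ltnn.
Qed.

Lemma interval_card Z Z2 p : is_flat Z -> is_flat Z2 -> C \subset Z -> Z \subset Z2 -> Z2 \subset A ->
  p \in P -> nP Z (P :&: cl (p |: Z2)) * wt Z = wt Z2.
Proof.
move=> Zf Z2f sCZ sZ sZA pP; rewrite -(coset_card Z2f (subset_trans sCZ sZ) sZA pP).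
set X := P :&: _; have -> : nP C X = nP C (X :\: cl Z).
  by rewrite flatE // PDZ ?subsetIl // (subset_trans sZ).
rewrite nP_partition ?(subset_trans sCZ) ?sub_cl //.
have -> : nP Z X * wt Z = \sum_(F in pts Z X) wt Z by rewrite sum_nat_const.
apply: eq_bigr => F /ptsP[f [/setIP[fP fp] fZ] ->].
rewrite -(coset_card Zf sCZ (subset_trans sZ sZA) fP); congr (Closure.nP _ _ _).
rewrite -setIA; apply/setP=> x; rewrite !inE; case xP: (x \in P) => //=.
case xf: (x \in cl (f |: Z)); rewrite ?andbF // andbT notin_flat //.
rewrite (contra _ (PA xP)) ?andbT; last exact: (subsetP (subset_trans sZ sZA)).
symmetry; apply: subsetP xf; rewrite cl_sub subUset sub1set fp.
by rewrite (subset_trans sZ) // subset_clU1.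
Qed.

(** As in an affine plane: p and any other point of its coset span a line whose direction is, by
    [h3], a point of Z2 over Z. The coset has k = wt Z2 / wt Z points, and counting it along the
    lines through p gives the sum. *)
Lemma line_count Z Z2 : is_flat Z -> is_flat Z2 -> C \subset Z -> Z \subset Z2 -> Z2 \subset A ->
  r Z2 = (r Z).+2 ->
  exists2 k, k * wt Z = wt Z2 & (\sum_(G in pts Z Z2) (mult Z G).-1).+1 = k.
Proof.
move=> Zf Z2f sCZ sZ sZA rZ2.
have [p pP] : exists p, p \in P.
  have /card_gt0P[F /ptsP[p [pP _] _]] := leq_trans (wt_gt0 A) h2; by exists p.
exists (nP Z (P :&: cl (p |: Z2))); first exact: interval_card.
have sZA' := subset_trans sZ sZA.
have pZ : p \notin cl Z by rewrite notin_flat //; apply: contra (PA pP); apply: (subsetP sZA').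
have pX : p \in P :&: cl (p |: Z2) by rewrite inE pP mem_clU1.
set X := P :&: _ in pX *.
rewrite /Closure.nP (cardD1 (cl (p |: Z))) mem_pts // add1n; congr _.+1.
pose phi F := cl (p |: F) :&: A.
have phiE u : u \in A -> u \notin Z -> phi (cl (u |: Z)) = cl (u |: Z).
  move=> uA uZ; have sG : cl (u |: Z) \subset A by apply: flat_U1.
  apply/eqP; rewrite eqEsubset subsetI sG subset_clU1 !andbT.
  by apply/subsetP=> x /setIP[xp xA]; apply: (cl_meet Af _ sG (PA pP)) => //; apply: flat_cl.
have key p' : p' \in X -> p' \notin cl (p |: Z) -> exists u,
    [/\ u \in Z2, u \notin Z, p' \in cl (p |: (u |: Z)) & phi (cl (p' |: Z)) = cl (u |: Z)].
  move=> /setIP[p'P p'p] p'Z.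
  have p'C : p' \notin cl (p |: C) by apply: contra p'Z; apply/subsetP/clS/setUS.
  have [u [uA uC] upp] := h3 pP p'P p'C.
  have uZ2 : u \in Z2.
    apply: (cl_meet Af Z2f sZA (PA pP)) => //; apply: subsetP upp; rewrite cl_sub !subUset !sub1set.
    by rewrite p'p mem_clU1 (subset_trans _ (subset_clU1 _ _)) // (subset_trans sCZ).
  have up : u \notin cl (p |: C).
    by apply: contra uC => h; apply: (cl_meet Af Cf sCA (PA pP)).
  have p'u : p' \in cl (p |: (u |: C)) by rewrite setUCA; apply: exchange.
  have uZ : u \notin Z.
    apply: contra p'Z => uZ; apply: subsetP p'u; apply: clS; apply: setUS.
    by rewrite subUset sub1set uZ.
  have p'uZ : p' \in cl (p |: (u |: Z)).
    by apply: subsetP p'u; apply/clS/setUS/setUS.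
  exists u; split=> //; rewrite -(phiE u) //; congr (_ :&: _).
  rewrite clU1_cl clU1_cl setUCA; rewrite [p |: (u |: Z)]setUCA.
  have -> : cl (p' |: (p |: Z)) = cl (u |: (p |: Z)) by apply: cl_exchange; rewrite // setUCA.
  by [].
rewrite -sum1_card; symmetry.
rewrite (partition_big phi (mem (pts Z Z2))) /=; last first.
  move=> F; rewrite inE => /andP[neF /ptsP[p' [p'X p'Z] eF]]; rewrite eF in neF *.
  have [|u [uZ2 uZ p'u ->]] := key p' p'X; last by apply: mem_pts; rewrite ?notin_flat.
  by apply: contra neF => h; rewrite (cl_exchange h).
apply: eq_bigr => G /ptsP[u [uZ2]]; rewrite notin_flat // => uZ eG; symmetry.
have uA := subsetP sZA _ uZ2.
have Gm : nP Z (P :&: cl (p |: G)) = mult Z G.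
  have sG : G \subset A by rewrite eG; apply: flat_U1.
  have sZG : Z \subset G by rewrite eG subset_clU1.
  have := @interval_card Z G p Zf _ sCZ sZG sG pP; rewrite eG wt_step // => /(_ (flat_cl _ _))/eqP.
  by rewrite eqn_pmul2r ?wt_gt0 // => /eqP.
rewrite -Gm /Closure.nP (cardD1 (cl (p |: Z))) mem_pts ?inE ?pP ?mem_clU1 // add1n /=.
rewrite sum1dep_card; apply: eq_card => F; rewrite !inE -andbA; case neF: (F == _) => //=.
apply/ptsP/andP=> [[p' [/setIP[p'P p'G] p'Z] eF]|[/ptsP[p' [p'X p'Z] eF] /eqP phF]].
  have p'X : p' \in X.
    rewrite inE p'P; apply: subsetP p'G; apply: clS; rewrite eG; apply: setUS.
    exact: flat_U1.
  split; first by rewrite eF; apply: mem_pts.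
  have [|v [vZ2 vZ p'v ev]] := key p' p'X.
    by apply: contraFN neF => h; rewrite eF (cl_exchange h).
  rewrite eF ev; apply/eqP; symmetry; rewrite eG; apply: cl_exchange; last by rewrite notin_flat.
  have uphi : v \in phi (cl (p' |: Z)) by rewrite ev mem_clU1.
  have [vp vA] := setIP uphi.
  have : v \in cl (p |: G).
    apply: subsetP vp; rewrite cl_sub subUset sub1set mem_clU1 cl_sub subUset sub1set p'G.
    by rewrite (subset_trans _ (subset_clU1 _ _)) // eG subset_clU1.
  rewrite eG => vG; have vuZ : v \in cl (u |: Z).
    by apply: (cl_meet Af _ _ (PA pP) vA vG); [apply: flat_cl | apply: flat_U1].
  by apply: exchange => //; rewrite notin_flat.
exists p' => //; split=> //; rewrite inE; have [p'P _] := setIP p'X; rewrite p'P /=.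
have [|v [vZ2 vZ p'v ev]] := key p' p'X.
  by apply: contraFN neF => h; rewrite eF (cl_exchange h).
by rewrite -phF eF ev clU1_cl.
Qed.

(** Here k = Y^2 and each of the N directions has multiplicity Y, so 1 + N (Y - 1) = Y^2. *)
Lemma line_card Z Z2 : is_flat Z -> is_flat Z2 -> C \subset Z -> Z \subset Z2 -> Z2 \subset A ->
  r Z2 = (r Z).+2 -> e0 \notin Z2 -> nP Z Z2 = Y.+1.
Proof.
move=> Zf Z2f sCZ sZ sZA rZ2 e0Z2; have [k hk hs] := line_count Zf Z2f sCZ sZ sZA rZ2.
have e0Z : e0 \notin Z by apply: contra e0Z2; apply: (subsetP sZ).
have le : r C <= r Z by apply: rfS.
move: hk; rewrite /wt (negPf e0Z) (negPf e0Z2) rZ2 !subSn ?leqW // !expnS mulnA => /eqP.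
rewrite eqn_pmul2r ?expn_gt0 ?(ltnW Y_gt1) // => /eqP kE.
move: hs; rewrite (eq_bigr (fun=> Y.-1)) => [|G /ptsP[u [uZ2 _] ->]]; last first.
  rewrite /mult; case: (boolP (e0 \in cl (u |: Z))) => [h|]; rewrite ?andbF //.
  by case/negP: e0Z2; apply: subsetP h; apply: flat_U1.
rewrite sum_nat_const -/(nP Z Z2) kE => h.
have {h} : nP Z Z2 * Y.-1 = Y.+1 * Y.-1.
  by move: (nP Z Z2) Y_gt1 h => n; case: (Y) => [|[|y]] //= _; clear; nia.
by move/eqP; rewrite eqn_pmul2r => [/eqP //|]; move: Y_gt1; clear; lia.
Qed.

(** Here k = y0 Y; the direction of e0 has multiplicity y0 and the N - 1 others Y, so y0 + (N - 1)(Y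
    - 1) = y0 Y. *)
Lemma line_card_apex Z Z2 : is_flat Z -> is_flat Z2 -> C \subset Z -> Z \subset Z2 -> Z2 \subset A ->
  r Z2 = (r Z).+2 -> e0 \notin Z -> e0 \in Z2 -> nP Z Z2 = y0.+1.
Proof.
move=> Zf Z2f sCZ sZ sZA rZ2 e0Z e0Z2; have [k hk hs] := line_count Zf Z2f sCZ sZ sZA rZ2.
have le : r C <= r Z by apply: rfS.
move: hk; rewrite /wt (negPf e0Z) e0Z2 rZ2 !subSn ?leqW //= expnS mulnA => /eqP.
rewrite eqn_pmul2r ?expn_gt0 ?(ltnW Y_gt1) // => /eqP kE.
have e0p : cl (e0 |: Z) \in pts Z Z2 by apply: mem_pts; rewrite ?notin_flat.
move: hs; rewrite (bigD1 (cl (e0 |: Z))) //= {1}/mult e0Z mem_clU1 /=.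
rewrite (eq_bigr (fun=> Y.-1)) => [|G /andP[/ptsP[u [uZ2 uZ] ->] neu]]; last first.
  rewrite /mult e0Z; case: ifP => // h; case/negP: neu.
  by rewrite (cl_exchange h) // notin_flat.
rewrite sum_nat_const kE.
have -> : #|[pred i | (i \in pts Z Z2) & i != cl (e0 |: Z)]| = (nP Z Z2).-1.
  rewrite [in RHS]/Closure.nP (cardD1 (cl (e0 |: Z))) e0p add1n /=.
  by apply: eq_card => F; rewrite !inE andbC.
have : 0 < nP Z Z2 by apply: (@nP_gt0 _ _ _ _ e0); rewrite ?notin_flat.
move: (nP Z Z2) => n n0 h.
have {h} : n.-1 * Y.-1 = y0 * Y.-1.
  by move: Y_gt1 y0_gt0 n0 h; case: (Y) => [|[|y]]; case: (y0) => [|z]; case: n => [|n] //= _ _ _; clear; nia.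
move/eqP; rewrite eqn_pmul2r => [/eqP|]; move: Y_gt1 n0; clear; lia.
Qed.

End Exact.
End Flats.

(** * Projective intervals of the lattice of flats *)

Section Proj.
Variables (T : finType) (r : rankfun T).
Implicit Types (A B C D F G H K L X Z : {set T}) (e f g p u x : T).
Notation cl := (cl r).
Notation nP := (nP r).
Notation pts := (pts r).
Notation is_flat := (is_flat r).
Notation cos := (cos r).

Lemma nP_D1 C X e : e \in X -> e \notin cl C -> nP C X = (nP C (X :\: cl (e |: C))).+1.
Proof.
move=> eX eC; rewrite /Closure.nP (cardsD1 (cl (e |: C))) mem_pts // add1n; congr _.+1.
apply: eq_card => F; rewrite in_setD1; apply/andP/ptsP=> [[neF /ptsP[f [fX fC] eF]]|].
  exists f => //; split=> //; rewrite inE fX andbT; apply: contra neF => h.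
  by rewrite eF (cl_exchange h).
move=> [f [+ fC] ->]; rewrite inE => /andP[fe fX]; split; last exact: mem_pts.
by apply: contra fe => /eqP <-; apply: mem_clU1.
Qed.

Lemma nP_le1 Z X : r (Z :|: X) <= (r Z).+1 -> nP Z X <= 1.
Proof.
move=> le; have [s|/subsetPn[t tX tZ]] := boolP (X \subset cl Z); first by rewrite nP0.
apply: (@nP_sub1 _ _ _ t); have -> : cl (t |: Z) = cl (Z :|: X).
  apply: cl_eq_rank; last by rewrite rf_notin_cl.
  by rewrite (subset_trans _ (sub_cl _ _)) // subUset sub1set inE tX orbT subsetUl.
by rewrite (subset_trans (subsetUr _ _) (sub_cl _ _)).
Qed.

(** The equality says that D and A are skew over Z: contracting D leaves the rank of A above Z
    unchanged. *)
Lemma skew_sub Z A B D : Z \subset D -> Z \subset B -> B \subset A ->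
  r (D :|: A) + r Z = r D + r A -> r (D :|: B) + r Z = r D + r B.
Proof.
move=> sZD sZB sBA h; have h1 := rf_mod r D sBA; have h2 := rfUI r D B.
have /(rfS r) h3 : Z \subset D :&: B by rewrite subsetI sZD.
by move: h h1 h2 h3; rewrite [A :|: D]setUC [B :|: D]setUC; clear; lia.
Qed.

Lemma skew_meet Z A B D x : Z \subset D -> Z \subset B -> B \subset A -> is_flat B ->
  r (D :|: A) + r Z = r D + r A -> x \in A -> x \in cl (D :|: B) -> x \in B.
Proof.
move=> sZD sZB sBA Bf h xA xB; rewrite -(flatE Bf) clE.
have sB' : x |: B \subset A by rewrite subUset sub1set xA.
have h1 := skew_sub sZD sZB sBA h.
have := skew_sub sZD (subset_trans sZB (subsetUr [set x] B)) sB' h.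
rewrite setUCA (rf_in_cl xB) => h2; apply/eqP; move: h1 h2; clear; lia.
Qed.

(* The interval [Z, A] of the lattice of flats is a projective geometry of order y. *)
Definition proj Z A y := [/\ is_flat Z, is_flat A, Z \subset A &
  forall Z1 Z2, is_flat Z1 -> is_flat Z2 -> Z \subset Z1 -> Z1 \subset Z2 -> Z2 \subset A ->
    r Z2 = (r Z1).+2 -> nP Z1 Z2 = y.+1].

Lemma proj_sub Z A Z' A' y : proj Z A y -> is_flat Z' -> is_flat A' -> Z \subset Z' ->
  Z' \subset A' -> A' \subset A -> proj Z' A' y.
Proof.
move=> [Zf Af sZA h] Z'f A'f s1 s2 s3; split=> // Z1 Z2 f1 f2 sZ1 s12 sZ2.
by apply: h => //; [apply: subset_trans sZ1 | apply: subset_trans s3].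
Qed.

(* The q+1 points of a line project injectively from a complement, hence onto. *)
Lemma proj_meet Z A H L y : proj Z A y -> is_flat H -> Z \subset H -> H \subset A ->
  r A = (r H).+1 -> is_flat L -> Z \subset L -> L \subset A -> r L = (r Z).+2 ->
  exists2 v, v \in L /\ v \in H & v \notin Z.
Proof.
move=> [Zf Af sZA hP] Hf sZH sHA rA Lf sZL sLA rL.
have [sLH|nLH] := boolP (L \subset H).
  have [|v vL vZ] := @ltn_rank_ex T r Z L; first by rewrite rL.
  by exists v; [split=> //; apply: (subsetP sLH) | rewrite -(notin_flat v Zf)].
have rHL : r (H :|: L) = r A.
  apply/eqP; rewrite eqn_leq rfS ?subUset ?sHA //= rA.
  apply: flat_lt => //; first exact: subsetUl.
  by apply: contra nLH => s; apply: subset_trans s; apply: subsetUr.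
(* K is a part of H skew to L and of corank 2 in A, so [cl K, A] is again a line, and H is one of
   its points. *)
have [K [sZK sKH]] := rel_basis r H sZL; rewrite rHL (setUidPr sZH) in sKH * => rKL.
rewrite rKL rL => rK; have {}rK : r A = (r K).+2 by move: rK; clear; lia.
have sKA := subset_trans sKH sHA.
have nonp g1 g2 : g1 \in L -> g2 \in L -> g1 \notin Z -> g2 \notin cl (g1 |: Z) ->
    g1 \notin cl K /\ g2 \notin cl (g1 |: K).
  move=> h1 h2 g1Z g2Z.
  have eL : cl (g2 |: (g1 |: Z)) = L.
    rewrite -(flatE Lf); apply: cl_eq_rank; last by rewrite rL notin_cl2 // notin_flat.
    by rewrite flatE // !subUset !sub1set h1 h2.
  have sL : L \subset cl (g2 |: (g1 |: K)).
    by rewrite -eL; apply/clS/setUS/setUS.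
  have : r A <= r (g2 |: (g1 |: K)).
    rewrite -rKL -(rf_cl r (g2 |: _)); apply: rfS; rewrite subUset sL andbT.
    by rewrite (subset_trans _ (sub_cl _ _)) // setUA subsetUr.
  rewrite rK => le; split; apply/negP=> h.
    have := rfU1 r g2 (g1 |: K); rewrite (rf_in_cl h); move: le; clear; lia.
  have := rfU1 r g1 K; rewrite -(rf_in_cl h); move: le; clear; lia.
have LK g : g \in L -> g \notin Z -> g \notin cl K.
  move=> gL gZ; have [|g' g'L g'Z] := @ltn_rank_ex T r (g |: Z) L.
    by rewrite rL rf_notin_cl ?notin_flat.
  by case: (nonp g g').
pose h F := cl (F :|: K).
have hE g : g \in L -> h (cl (g |: Z)) = cl (g |: K).
  move=> gL; rewrite /h clU_cl -setUA (setUidPr sZK) //.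
have hinj : {in pts Z L &, injective h}.
  move=> F1 F2 /ptsP[g1 [g1L]]; rewrite notin_flat // => g1Z -> /ptsP[g2 [g2L g2Z] ->].
  rewrite !hE // => e12; apply/eqP; apply: contraT => ne.
  have [|_] := nonp g1 g2 g1L g2L g1Z; last by rewrite e12 mem_clU1.
  by apply: contra ne => g21; rewrite (cl_exchange g21 g2Z).
have himg : h @: pts Z L = pts K A.
  apply/eqP; rewrite eqEcard card_in_imset // -/(nP K A) -/(nP Z L) -nP_cl.
  rewrite (hP _ _ Zf Lf) // (hP _ _ (flat_cl _ _) Af) ?rf_cl ?leqnn ?andbT //; first last.
  - by rewrite flat_sub.
  - by rewrite (subset_trans sZK) // sub_cl.
  apply/subsetP=> F' /imsetP[F /ptsP[g [gL]]]; rewrite notin_flat // => gZ -> ->.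
  by rewrite hE //; apply: mem_pts; [apply: (subsetP sLA) | apply: LK].
have [|w wH wK] := @ltn_rank_ex T r K H; first by move: rA rK; clear; lia.
have eH : cl (w |: K) = H.
  rewrite -(flatE Hf); apply: cl_eq_rank; last by rewrite rf_notin_cl //; move: rA rK; clear; lia.
  by rewrite flatE // subUset sub1set wH.
have /imsetP[F /ptsP[v [vL]]] : H \in h @: pts Z L.
  by rewrite himg -eH; apply: mem_pts => //; apply: (subsetP sHA).
rewrite notin_flat // => vZ ->; rewrite hE // => eHv.
by exists v => //; split=> //; rewrite eHv mem_clU1.
Qed.

Lemma plane_card Z P y : proj Z P y -> r P = (r Z).+3 -> y * y.+1 < nP Z P.
Proof.
move=> [Zf Pf sZP hP] rP; have [|e eP eZ] := @ltn_rank_ex T r Z P; first by rewrite rP ltnS leqW.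
rewrite (nP_D1 eP eZ) ltnS.
have re : r (cl (e |: Z)) = (r Z).+1 by rewrite rf_cl rf_notin_cl.
rewrite -(hP (cl (e |: Z)) P) ?re ?flat_cl ?subset_clU1 ?flat_U1 // nP_cl.
apply: nP_ge_mul => [|f fP fe]; first exact: subset_clU1.
have sL : cl (f |: (e |: Z)) \subset P by rewrite flat_sub // !subUset !sub1set fP eP.
have := hP Z (cl (f |: (e |: Z))); rewrite rf_cl notin_cl2 // => /(_ Zf (flat_cl _ _)) hL.
have eL : e \in cl (f |: (e |: Z)) by apply: mem_cl; rewrite !inE eqxx orbT.
rewrite (setIidPr _) ?(subset_trans (subsetDl _ _)) // -ltnS /Closure.cos -nP_D1 // hL //.
by rewrite (subset_trans _ (sub_cl _ _)) // setUA subsetUr.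
Qed.

(** Contracting D turns the plane P into a line. The fibre over a point of M/D lies on a line of P
    or is a single point, and two line fibres would meet in P by [proj_meet] and coincide. So at
    most one fibre has several points, at most y + 1, out of more than y (y + 1) in P. *)
Lemma plane_from_point Z P D y : proj Z P y -> r P = (r Z).+3 -> Z \subset D ->
  r (D :|: P) = (r D).+2 -> (forall t, t \in P -> t \in cl D -> t \in Z) ->
  y * y < nP D P.
Proof.
move=> pP rP sZD rDP tZ; have [Zf Pf sZP hP] := pP.
have eZ : P :\: cl D = P :\: cl Z.
  apply/setP=> t; rewrite !inE (flatE Zf); case tP: (t \in P); rewrite ?andbF // !andbT.
  apply/idP/idP; apply: contra => h; last exact: tZ.
  by apply: subsetP h; rewrite (subset_trans sZD) // sub_cl.
have := plane_card pP rP; rewrite -nPD -eZ nP_partition ?(subset_trans sZD) ?sub_cl //.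
pose m F := nP Z (P :&: (F :\: cl D)) => hcard.
have Ffl F : F \in pts D P -> is_flat F by case/ptsP=> t _ ->; apply: flat_cl.
have FD F : F \in pts D P -> r F = (r D).+1.
  by case/ptsP=> t [_ tD] ->; rewrite rf_cl rf_notin_cl.
have sDF F : F \in pts D P -> D \subset F by case/ptsP=> t _ ->; apply: subset_clU1.
have rPF F : F \in pts D P -> r (P :&: F) <= (r Z).+2.
  move=> hF; rewrite -ltnS -rP; apply: flat_lt; [by apply: flatI => //; apply: Ffl | exact: subsetIl |].
  rewrite subsetI subxx /=; apply/negP=> s.
  have : r (D :|: P) <= r F by apply: rfS; rewrite subUset sDF.
  by rewrite rDP (FD F hF) ltnn.
have sZPF F : F \in pts D P -> Z \subset P :&: F.
  by move=> hF; rewrite subsetI sZP (subset_trans sZD) // sDF.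
have mle F : m F <= nP Z (P :&: F) by apply: nPS; rewrite setIS // subsetDl.
have m1 F : F \in pts D P -> 1 < m F -> r (P :&: F) = (r Z).+2.
  move=> hF lt; apply/eqP; rewrite eqn_leq rPF //= ltnNge; apply/negP=> le.
  have := leq_trans lt (mle F); rewrite ltnNge => /negP; apply; apply: nP_le1.
  by rewrite (setUidPr (sZPF _ hF)).
have mY F : F \in pts D P -> m F <= y.+1.
  move=> hF; have [le|lt] := leqP (m F) 1; first exact: leq_trans le _.
  rewrite -(hP Z (P :&: F)) ?m1 ?subsetIl ?sZPF //.
  by apply: flatI => //; apply: Ffl.
suff : \sum_(F in pts D P) m F <= nP D P + y by move=> h; have := leq_trans hcard h; rewrite mulnS -addnS addnC leq_add2r.
have [/existsP[F0 /andP[hF0 lt0]]|/existsPn none] := boolP [exists F, (F \in pts D P) && (1 < m F)].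
  rewrite (bigD1 F0) //= [nP D P](cardD1 F0) hF0.
  suff le : \sum_(i in pts D P | i != F0) m i <= #|[predD1 pts D P & F0]|.
    by apply: leq_trans (leq_add (mY F0 hF0) le) _; rewrite add1n !addSn addnC.
  rewrite -sum1_card [X in _ <= X](eq_bigl (fun i => (i \in pts D P) && (i != F0))); last first.
    by move=> F; rewrite !inE andbC.
  apply: leq_sum => F /andP[hF neF]; rewrite leqNgt; apply: contra neF => lt.
  have pP' : proj Z P y by [].
  have [||||||||v [vF vF0] vZ] := @proj_meet Z P (P :&: F0) (P :&: F) y pP';
    rewrite ?m1 ?rP ?subsetIl ?sZPF //; try by apply: flatI => //; apply: Ffl.
  have [vP vF'] := setIP vF; have [_ vF0'] := setIP vF0.
  have vD : v \notin cl D by apply: contra vZ; apply: tZ.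
  have hpt G : G \in pts D P -> v \in G -> G = cl (v |: D).
    by case/ptsP=> t [_ tD] -> h; symmetry; apply: cl_exchange.
  by rewrite (hpt F) // (hpt F0).
apply: leq_trans (leq_addr _ _); rewrite /Closure.nP -sum1_card; apply: leq_sum => F hF.
by have := none F; rewrite hF /= -leqNgt.
Qed.

(** A point g off all points of P could be contracted along with D; this would turn P into a line
    with more than y^2 points, hence at least l + 2. *)
Lemma parallel_in_plane l Z P D y g : no_long_line r l -> l < y * y -> proj Z P y ->
  r P = (r Z).+3 -> Z \subset D -> r (D :|: P) + r Z = r D + r P ->
  g \in cl (D :|: P) -> g \notin cl D -> exists2 a, a \in P & g \in cl (a |: D).
Proof.
move=> U ly pP rP sZD sk gDP gD; have [Zf Pf sZP hP] := pP.
have [/exists_inP[a aP ga]|/exists_inPn none] := boolP [exists a in P, g \in cl (a |: D)].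
  by exists a.
have rDP : r ((g |: D) :|: P) = (r (g |: D)).+2.
  by rewrite -setUA (rf_in_cl gDP) rf_notin_cl //; move: sk; rewrite rP; clear; lia.
have hZ t : t \in P -> t \in cl (g |: D) -> t \in Z.
  move=> tP tg; have tD : t \in cl D.
    by apply: contraT => tD; case/negP: (none t tP); apply: exchange.
  apply: (skew_meet sZD (subxx Z) sZP Zf sk tP).
  by apply: subsetP tD; apply/clS/subsetUl.
have := plane_from_point pP rP (subset_trans sZD (subsetUr _ _)) rDP hZ.
have := @nP_line T r l (g |: D) P U; rewrite setUC rDP leqnn => /(_ isT); move: ly; clear; lia.
Qed.

(** Induction on the rank of A: after contracting some a in A, g is parallel to some b in A, so over
    D it lies in the span of a and b, and any plane of A through that line reduces the claim to
    [parallel_in_plane]. *)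
Lemma proj_parallel l Z A D y g : no_long_line r l -> l < y * y -> proj Z A y ->
  r Z + 3 <= r A -> Z \subset D -> r (D :|: A) + r Z = r D + r A ->
  g \in cl (D :|: A) -> g \notin cl D -> exists2 a, a \in A & g \in cl (a |: D).
Proof.
move=> U ly pA le; have [n hn] : exists n, r A = r Z + n + 3 by exists (r A - (r Z + 3)); lia.
elim: n Z D pA hn {le} => [|n IH] Z D pA rA sZD sk gA gD.
  by apply: (parallel_in_plane U ly pA _ sZD sk) => //; move: rA; clear; lia.
have [Zf Af sZA hP] := pA; have rlt k : k <= 3 -> r Z + k < r A by rewrite rA; clear; lia.
have [|a aA aZ] := @ltn_rank_ex T r Z A; first by have := rlt 0 isT; rewrite addn0.
have aD : a \notin cl D.
  apply: contra aZ => h; rewrite flatE //; apply: (skew_meet sZD (subxx Z) sZA Zf sk aA).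
  by apply: subsetP h; apply/clS/subsetUl.
have [ga|ga] := boolP (g \in cl (a |: D)); first by exists a.
have eU : a |: A = A by apply/setUidPr; rewrite sub1set.
have rU : r (cl (a |: D) :|: A) = r (D :|: A) by rewrite rfU_cl -setUA setUCA eU.
have clU : cl (cl (a |: D) :|: A) = cl (D :|: A) by rewrite clU_cl -setUA setUCA eU.
have [||||||b bA gb] := IH (cl (a |: Z)) (cl (a |: D)).
- by apply: (proj_sub pA); rewrite ?flat_cl ?subset_clU1 ?flat_U1.
- by rewrite rf_cl rf_notin_cl // rA; clear; lia.
- by apply/clS/setUS.
- by rewrite rU !rf_cl !rf_notin_cl //; move: sk; clear; lia.
- by rewrite clU.
- by rewrite cl_idem.
have {}gb : g \in cl (b |: (a |: D)) by rewrite clU1_cl in gb.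
have bZ : b \notin cl (a |: Z).
  apply: contra ga => h; apply: subsetP gb; rewrite cl_sub subUset sub1set sub_cl andbT.
  by apply: subsetP h; apply/clS/setUS.
have [|c cA cZ] := @ltn_rank_ex T r (b |: (a |: Z)) A.
  by rewrite notin_cl2 // -addn2 rlt.
have sP : cl (c |: (b |: (a |: Z))) \subset A by rewrite flat_sub // !subUset !sub1set cA bA aA.
have sZP : Z \subset cl (c |: (b |: (a |: Z))).
  by rewrite (subset_trans _ (sub_cl _ _)) // !setUA subsetUr.
have [||||||d dP gd] := @parallel_in_plane l Z (cl (c |: (b |: (a |: Z)))) D y g U ly.
- by apply: (proj_sub pA); rewrite ?flat_cl.
- by rewrite rf_cl (rf_notin_cl cZ) notin_cl2.
- by [].
- exact: (skew_sub sZD sZP sP sk).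
- apply: subsetP gb; apply: clS; rewrite !subUset !sub1set subsetUl !andbT !inE.
  by rewrite !(mem_cl r) ?orbT // !inE eqxx ?orbT.
- by [].
by exists d => //; apply: (subsetP sP).
Qed.

(** By [proj_parallel] no new point appears: each flat between cl D and cl (D :|: A) is spanned by D
    and its trace on A, so lines correspond to lines of A. *)
Lemma proj_contract l Z A D y : no_long_line r l -> l < y * y -> proj Z A y ->
  r Z + 3 <= r A -> Z \subset D -> r (D :|: A) + r Z = r D + r A ->
  proj (cl D) (cl (D :|: A)) y.
Proof.
move=> U ly pA le sZD sk; have [Zf Af sZA hP] := pA.
split; rewrite ?flat_cl //; first exact/clS/subsetUl.
move=> Z1 Z2 f1 f2 sD1 s12 s2A r2.
have par g : g \in Z2 -> g \notin cl D -> exists2 a, a \in A & g \in cl (a |: D).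
  by move=> gZ2; apply: (proj_parallel U ly pA le sZD sk); apply: (subsetP s2A).
have sD2 := subset_trans sD1 s12.
have sZi (Zi : {set T}) : cl D \subset Zi -> Z \subset Zi :&: A.
  by move=> s; rewrite subsetI sZA andbT (subset_trans sZD) // (subset_trans (sub_cl _ _) s).
have eZ Zi : is_flat Zi -> cl D \subset Zi -> Zi \subset Z2 -> cl (D :|: (Zi :&: A)) = Zi.
  move=> fi si si2; apply/eqP; rewrite eqEsubset flat_sub // subUset subsetIl andbT.
  rewrite (subset_trans (sub_cl _ _) si) /=; apply/subsetP=> g gi.
  have [gD|gD] := boolP (g \in cl D); first by apply: subsetP gD; apply/clS/subsetUl.
  have [a aA ga] := par g (subsetP si2 _ gi) gD.
  have ag : a \in cl (g |: D) by apply: exchange.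
  apply: subsetP ga; apply: clS; rewrite subUset sub1set subsetUl andbT !inE aA andbT.
  apply/orP; right; apply: subsetP ag.
  by rewrite flat_sub // subUset sub1set gi (subset_trans (sub_cl _ _) si).
have rZi Zi : is_flat Zi -> cl D \subset Zi -> Zi \subset Z2 -> r Zi + r Z = r D + r (Zi :&: A).
  by move=> fi si si2; rewrite -{1}(eZ Zi) // rf_cl (skew_sub sZD (sZi _ si) (subsetIr _ _) sk).
have rA2 : r (Z2 :&: A) = (r (Z1 :&: A)).+2.
  by have := rZi _ f1 sD1 s12; have := rZi _ f2 sD2 (subxx _); rewrite r2; clear; lia.
have fI Zi : is_flat Zi -> is_flat (Zi :&: A) by move=> fi; apply: flatI.
rewrite -(hP _ _ (fI _ f1) (fI _ f2) (sZi _ sD1) (setSI _ s12) (subsetIr _ _) rA2).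
pose h F := cl (F :|: Z1).
have hcl a : h (cl (a |: (Z1 :&: A))) = cl (a |: Z1).
  by rewrite /h clU_cl -setUA (setUidPr (subsetIl Z1 A)).
have hinj : {in pts (Z1 :&: A) (Z2 :&: A) &, injective h}.
  move=> F1 F2 /ptsP[a [/setIP[a2 aA] a1] ->] /ptsP[b [/setIP[b2 bA] b1] ->]; rewrite !hcl => eab.
  symmetry; apply: cl_exchange => //.
  apply: (@skew_meet Z A _ D b) => //; rewrite ?flat_cl //.
  - by rewrite (subset_trans (sZi _ sD1)) // subset_clU1.
  - by rewrite flat_sub // subUset sub1set aA subsetIr.
  have : b \in cl (a |: Z1) by rewrite eab mem_clU1.
  apply/subsetP; rewrite cl_sub subUset sub1set; apply/andP; split.
    by apply: mem_cl; rewrite inE mem_clU1 orbT.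
  by rewrite -{1}(eZ Z1) //; apply/clS/setUS/subset_clU1.
rewrite /Closure.nP -(card_in_imset hinj); apply: eq_card => F.
apply/ptsP/imsetP=> [[g [g2]]|[_ /ptsP[a [/setIP[a2 aA] a1] ->] ->]].
  rewrite notin_flat // => g1 ->.
  have gD : g \notin cl D by apply: contra g1; apply: (subsetP sD1).
  have [a aA ga] := par g g2 gD.
  have ag : a \in cl (g |: D) by apply: exchange.
  have a2 : a \in Z2.
    by apply: subsetP ag; rewrite flat_sub // subUset sub1set g2 (subset_trans (sub_cl _ _) sD2).
  have a1 : a \notin Z1.
    apply: contra g1 => a1; apply: subsetP ga.
    by rewrite flat_sub // subUset sub1set a1 (subset_trans (sub_cl _ _) sD1).
  exists (cl (a |: (Z1 :&: A))); first by apply: mem_pts; rewrite ?inE ?a2 // notin_flat ?fI // inE (negPf a1).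
  rewrite hcl; symmetry; apply: cl_exchange; last by rewrite notin_flat.
  by apply: subsetP ag; apply/clS/setUS/(subset_trans (sub_cl _ _) sD1).
exists a; rewrite ?hcl //; split=> //; rewrite notin_flat //; apply: contra a1 => h1.
by apply: mem_cl; rewrite inE h1.
Qed.

Definition hypers Z A e := [set H : {set T} | [&& is_flat H, Z \subset H, H \subset A,
  r A == (r H).+1 & e \notin H]].

(** A hyperplane avoiding e meets a fixed line L through e in one of its y other points, and the
    induction hypothesis counts the hyperplanes above that point. *)
Lemma hypers_card n Z A y e : proj Z A y -> e \in A -> e \notin Z -> r A = r Z + n.+1 ->
  #|hypers Z A e| <= y ^ n.
Proof.
elim: n Z => [|n IH] Z pA eA eZ rA; have [Zf Af sZA hP] := pA.
  rewrite expn0 -(cards1 Z); apply: subset_leq_card; apply/subsetP=> H.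
  rewrite !inE => /and5P[Hf sZH sHA /eqP rH _]; rewrite eq_sym; apply/eqP/(flat_eq (r := r)) => //.
  by move: rA; rewrite rH; clear; lia.
have [|u uA ue] := @ltn_rank_ex T r (e |: Z) A.
  by rewrite rf_notin_cl ?notin_flat // rA; clear; lia.
set L := cl (u |: (e |: Z)).
have sLA : L \subset A by rewrite flat_sub // !subUset !sub1set uA eA.
have sZL : Z \subset L by rewrite (subset_trans _ (sub_cl _ _)) // setUA subsetUr.
have rL : r L = (r Z).+2 by rewrite rf_cl notin_cl2 // notin_flat.
have eL : e \in L by apply: mem_cl; rewrite !inE eqxx orbT.
have eL' : cl (e |: Z) \in pts Z L by apply: mem_pts; rewrite ?notin_flat.
pose Q := pts Z L :\ cl (e |: Z).
have cQ : #|Q| = y.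
  have := hP Z L Zf (flat_cl _ _) (subxx _) sZL sLA rL.
  by rewrite /Closure.nP (cardsD1 (cl (e |: Z))) eL' => /eqP; rewrite add1n eqSS => /eqP.
have sub : hypers Z A e \subset \bigcup_(F in Q) hypers F A e.
  apply/subsetP=> H; rewrite inE => /and5P[Hf sZH sHA /eqP rH eH].
  have [v [vL vH] vZ] := proj_meet pA Hf sZH sHA rH (flat_cl _ _) sZL sLA rL.
  apply/bigcupP; exists (cl (v |: Z)); last first.
    by rewrite inE Hf sHA rH eqxx eH !andbT flat_U1.
  rewrite !inE mem_pts ?notin_flat // andbT; apply: contra eH => /eqP h.
  have : e \in cl (v |: Z) by rewrite h mem_clU1.
  by apply/subsetP/flat_U1.
apply: leq_trans (subset_leq_card sub) _; apply: leq_trans (card_bigcup_le _ _) _.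
have -> : y ^ n.+1 = \sum_(F in Q) y ^ n by rewrite sum_nat_const cQ expnS.
apply: leq_sum => F; rewrite !inE.
move=> /andP[neF /ptsP[v [vL vZ] eF]].
have rF : r F = (r Z).+1 by rewrite eF rf_cl rf_notin_cl.
have vA := subsetP sLA _ vL.
apply: IH => //; last by rewrite rF rA; clear; lia.
  by apply: (proj_sub pA); rewrite // eF ?flat_cl ?subset_clU1 ?flat_U1.
apply: contra neF; rewrite eF => h; rewrite eq_sym; apply/eqP/cl_exchange => //.
by rewrite notin_flat.
Qed.

Definition Wf Z A k := #|[set F : {set T} | [&& is_flat F, Z \subset F, F \subset A & r F == r Z + k]]|.

Lemma Wf0 Z A : is_flat Z -> Wf Z A 0 <= 1.
Proof.
move=> Zf; rewrite /Wf -(cards1 Z); apply: subset_leq_card; apply/subsetP=> F.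
rewrite !inE addn0 => /and4P[Ff sZF _ /eqP rF]; rewrite eq_sym.
by apply/eqP/(flat_eq (r := r)) => //; rewrite rF.
Qed.

(** Flats through e are flats of the contraction by e. A flat F avoiding e is a hyperplane of G = cl
    (e |: F) that avoids e, so at most N of them share the same G. *)
Lemma Wf_rec Z A e k N : is_flat Z -> is_flat A -> Z \subset A -> e \in A -> e \notin Z ->
  (forall G, is_flat G -> cl (e |: Z) \subset G -> G \subset A -> r G = r Z + k.+2 ->
    #|hypers Z G e| <= N) ->
  Wf Z A k.+1 <= Wf (cl (e |: Z)) A k + N * Wf (cl (e |: Z)) A k.+1.
Proof.
move=> Zf Af sZA eA eZ hN; rewrite /Wf.
have re : r (cl (e |: Z)) = (r Z).+1 by rewrite rf_cl rf_notin_cl ?notin_flat.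
set W := [set F | _]; rewrite -(cardsID [set F : {set T} | e \in F] W) leq_add //.
  apply: subset_leq_card; apply/subsetP=> F; rewrite !inE re addSnnS.
  by move=> /andP[/and4P[Ff sZF sFA rF] eF]; rewrite Ff sFA rF flat_U1.
set V := [set F : {set T} | [&& is_flat F, cl (e |: Z) \subset F, F \subset A & r F == r (cl (e |: Z)) + k.+1]].
have sub : W :\: [set F : {set T} | e \in F] \subset \bigcup_(G in V) hypers Z G e.
  apply/subsetP=> F; rewrite !inE => /andP[eF /and4P[Ff sZF sFA /eqP rF]].
  have reF : r (cl (e |: F)) = (r F).+1 by rewrite rf_cl rf_notin_cl ?notin_flat.
  have sZe : cl (e |: Z) \subset cl (e |: F) by apply/clS/setUS.
  have sFe : cl (e |: F) \subset A by apply: flat_U1.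
  apply/bigcupP; exists (cl (e |: F)).
    by rewrite inE flat_cl sZe sFe reF rF re addSn addnS eqxx.
  by rewrite inE Ff sZF eF subset_clU1 reF eqxx.
apply: leq_trans (subset_leq_card sub) _; apply: leq_trans (card_bigcup_le _ _) _.
rewrite mulnC -sum_nat_const; apply: leq_sum => G; rewrite inE re => /and4P[Gf seG sGA /eqP rG].
by apply: hN => //; rewrite rG; clear; lia.
Qed.

(** The q-binomial coefficient by the q-Pascal rule, which matches [Wf_rec] with N = q^k;
    [gbin_qbinom] identifies it with the quotient. *)
Fixpoint gbin q n k := match k, n with
  | 0, _ => 1
  | k'.+1, 0 => 0
  | k'.+1, n'.+1 => gbin q n' k' + q ^ k * gbin q n' k end.

Lemma gbinS q n k : gbin q n.+1 k.+1 = gbin q n k + q ^ k.+1 * gbin q n k.+1.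
Proof. by []. Qed.

Lemma Wf_proj n Z A y k : proj Z A y -> r A = r Z + n -> Wf Z A k <= gbin y n k.
Proof.
elim: n Z k => [|n IH] Z [|k] pA rA; have [Zf Af sZA hP] := pA.
- exact: Wf0.
- rewrite /Wf (_ : [set F | _] = set0) ?cards0 //; apply/setP=> F; rewrite !inE.
  apply/negP=> /and4P[_ _ /(rfS r) + /eqP rF]; rewrite rF rA; clear; lia.
- exact: Wf0.
have [|e eA] := @ltn_rank_ex T r Z A; first by rewrite rA; clear; lia.
rewrite notin_flat // => eZ.
have re : r (cl (e |: Z)) = (r Z).+1 by rewrite rf_cl rf_notin_cl ?notin_flat.
have pe : proj (cl (e |: Z)) A y by apply: (proj_sub pA); rewrite ?flat_cl ?subset_clU1 ?flat_U1.
have rA' : r A = r (cl (e |: Z)) + n by rewrite re rA addSnnS.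
apply: leq_trans (@Wf_rec Z A e k (y ^ k.+1) Zf Af sZA eA eZ _) _; last first.
  by rewrite gbinS; apply: leq_add; [apply: IH | rewrite leq_mul2l IH ?orbT].
move=> G Gf seG sGA rG; apply: (@hypers_card k.+1) => //.
- by apply: (proj_sub pA) => //; rewrite (subset_trans _ seG) // subset_clU1.
- exact: (subsetP seG _ (mem_clU1 _ _ _)).
Qed.

Lemma Wf_pow Z A k : is_flat Z -> is_flat A -> Wf Z A k <= nP Z A ^ k.
Proof.
elim: k Z => [|k IH] Z Zf Af; first exact: Wf0.
have sub : [set F : {set T} | [&& is_flat F, Z \subset F, F \subset A & r F == r Z + k.+1]] \subset
   \bigcup_(G in pts Z A) [set F : {set T} | [&& is_flat F, G \subset F, F \subset A & r F == r G + k]].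
  apply/subsetP=> F; rewrite inE => /and4P[Ff sZF sFA /eqP rF].
  have [|e eF eZ] := @ltn_rank_ex T r Z F; first by rewrite rF; clear; lia.
  apply/bigcupP; exists (cl (e |: Z)); first by apply: mem_pts => //; apply: (subsetP sFA).
  by rewrite inE Ff sFA flat_U1 // rf_cl rf_notin_cl // rF addSnnS eqxx.
apply: leq_trans (subset_leq_card sub) _; apply: leq_trans (card_bigcup_le _ _) _.
have -> : nP Z A ^ k.+1 = \sum_(G in pts Z A) nP Z A ^ k by rewrite sum_nat_const expnS.
apply: leq_sum => G /ptsP[e [eA eZ] ->].
apply: leq_trans (IH _ (flat_cl _ _) Af) _; rewrite nP_cl.
case: k {IH sub} => // k; rewrite leq_exp2r //; apply: nP_contract; exact: subset_clU1.
Qed.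

End Proj.

(** * The order of a projective space is a prime power *)

Module Elations.
Import all_fingroup all_solvable.
Import GroupScope.
Section PrimePower.
Variables (T : finType) (r : rankfun T) (Z A : {set T}) (y : nat).
Implicit Types (B C D F G H K L X : {set T}) (a b c d e p u v w x z : T) (g h : {perm T}).
Notation cl := (cl r).
Notation nP := (Closure.nP r).
Notation is_flat := (is_flat r).
Hypotheses (pA : proj r Z A y) (rA : r A = (r Z + 4)%N) (y_gt1 : 1 < y).

Let Zf : is_flat Z. Proof. by case: pA. Qed.
Let Af : is_flat A. Proof. by case: pA. Qed.
Let sZA : Z \subset A. Proof. by case: pA. Qed.

Definition ln x z := cl (x |: (z |: Z)).

Lemma ln_flat x z : is_flat (ln x z). Proof. exact: flat_cl. Qed.
Lemma lnC x z : ln x z = ln z x. Proof. by rewrite /ln setUCA. Qed.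
Lemma ln_l x z : x \in ln x z. Proof. exact: mem_clU1. Qed.
Lemma ln_r x z : z \in ln x z. Proof. by rewrite lnC ln_l. Qed.
Lemma sZln x z : Z \subset ln x z.
Proof. by rewrite (subset_trans _ (sub_cl _ _)) // setUA subsetUr. Qed.
Lemma ln_sub H x z : is_flat H -> Z \subset H -> x \in H -> z \in H -> ln x z \subset H.
Proof. by move=> Hf sZH xH zH; rewrite flat_sub // !subUset !sub1set xH zH. Qed.
Lemma ln_par x z : z \in cl (x |: Z) -> ln x z = cl (x |: Z).
Proof.
move=> h; apply: eq_cl; last by rewrite (subset_trans _ (sub_cl _ _)) // setUS // subsetUr.
by rewrite !subUset !sub1set h mem_clU1 subset_clU1.
Qed.
Lemma ln_exch x z w : w \in ln x z -> w \notin cl (z |: Z) -> ln w z = ln x z.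
Proof. by move=> h1 h2; apply: cl_exchange. Qed.
Lemma rln x z : x \notin Z -> z \notin cl (x |: Z) -> r (ln z x) = (r Z).+2.
Proof. by move=> h1 h2; rewrite rf_cl notin_cl2 // notin_flat. Qed.

Lemma par_sym x z : x \notin Z -> x \in cl (z |: Z) -> z \in cl (x |: Z).
Proof. by move=> h1 h2; apply: exchange => //; rewrite notin_flat. Qed.

Lemma ln_inter x z w u : w \notin ln z x -> u \in ln z x -> u \in ln w x -> u \in cl (x |: Z).
Proof.
move=> h1 h2 h3; apply: contraNT h1 => h4; rewrite -(ln_exch h2 h4).
by rewrite (ln_exch h3 h4) ln_l.
Qed.

Variable R : {set T}.
Hypothesis sRA : R \subset A :\: Z.
Hypothesis Rinj : {in R &, forall x z, x != z -> x \notin cl (z |: Z)}.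
Hypothesis Rsurj : forall x, x \in A -> x \notin Z -> exists2 z, z \in R & x \in cl (z |: Z).

Lemma RA x : x \in R -> x \in A. Proof. by move/(subsetP sRA); rewrite inE => /andP[]. Qed.
Lemma RZ x : x \in R -> x \notin Z. Proof. by move/(subsetP sRA); rewrite inE => /andP[]. Qed.
Lemma Req x z : x \in R -> z \in R -> x \in cl (z |: Z) -> x = z.
Proof. by move=> xR zR h; apply: contraTeq h; apply: Rinj. Qed.

Lemma rep_in H x : is_flat H -> Z \subset H -> x \in H -> x \in A -> x \notin Z ->
  exists2 z, z \in R & z \in H /\ x \in cl (z |: Z).
Proof.
move=> Hf sZH xH xA xZ; have [z zR xz] := Rsurj xA xZ; exists z => //; split=> //.
by have := par_sym xZ xz; apply/subsetP/flat_U1.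
Qed.

(** Projection of x from a onto H; the default x is never taken under the hypotheses of [prP]. *)
Definition pr a H x := odflt x [pick w in R | (w \in H) && (w \in ln x a)].

Definition plane H := [/\ is_flat H, Z \subset H, H \subset A & r H = (r Z + 3)%N].

Lemma ln_full x a v w : v \in ln x a -> w \in ln x a -> w \notin Z -> v \notin cl (w |: Z) ->
  ln v w = ln x a.
Proof.
move=> h1 h2 wZ vw; apply: (@flat_eq _ r); rewrite ?ln_flat //.
  by apply: ln_sub; rewrite ?ln_flat ?sZln.
by rewrite (rln wZ vw) /ln rf_cl (leq_trans (rfU1 r _ _)) // ltnS rfU1.
Qed.

Lemma ln_meet1 H x a v w : is_flat H -> Z \subset H -> a \notin H -> v \in H -> w \in H ->
  w \notin Z -> v \in ln x a -> w \in ln x a -> v \in cl (w |: Z).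
Proof.
move=> Hf sZH aH vH wH wZ vL wL; apply: contraNT aH => vw.
by have := ln_r x a; rewrite -(ln_full vL wL wZ vw); apply/subsetP/ln_sub.
Qed.

Lemma ln_meetR H x a v w : is_flat H -> Z \subset H -> a \notin H -> v \in H -> w \in H ->
  v \in R -> w \in R -> v \in ln x a -> w \in ln x a -> v = w.
Proof.
by move=> Hf sZH aH vH wH vR wR vL wL; apply: Req => //; apply: (ln_meet1 Hf sZH aH) vL wL => //; apply: RZ.
Qed.

Lemma meet_plane H x z : plane H -> x \in A -> z \in A -> x \notin Z -> z \notin cl (x |: Z) ->
  exists2 w, w \in R & w \in H /\ w \in ln z x.
Proof.
move=> [Hf sZH sHA rH] xA zA xZ zx.
have rH' : r A = (r H).+1 by rewrite rA rH addnS.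
have sL : ln z x \subset A by apply: ln_sub.
have [v [vL vH] vZ] := proj_meet pA Hf sZH sHA rH' (ln_flat z x) (sZln z x) sL (rln xZ zx).
have sI : Z \subset H :&: ln z x by rewrite subsetI sZH sZln.
have vI : v \in H :&: ln z x by rewrite inE vH.
have [w wR [wI vw]] := rep_in (flatI Hf (ln_flat z x)) sI vI (subsetP sHA _ vH) vZ.
by exists w => //; case/setIP: wI.
Qed.

Lemma prP a H x : plane H -> a \in A -> a \notin H -> x \in A -> x \notin cl (a |: Z) ->
  [/\ pr a H x \in R, pr a H x \in H & pr a H x \in ln x a].
Proof.
move=> pH aA aH xA xa; have [Hf sZH _ _] := pH.
have aZ : a \notin Z by apply: contra aH; apply: (subsetP sZH).
have [w wR [wH wL]] := meet_plane pH aA xA aZ xa.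
rewrite /pr; case: pickP => [v /and3P[]|/(_ w)] //=.
by rewrite wR wH wL.
Qed.

Lemma pr_uniq a H x w : plane H -> a \in A -> a \notin H -> x \in A -> x \notin cl (a |: Z) ->
  w \in R -> w \in H -> w \in ln x a -> pr a H x = w.
Proof.
move=> pH aA aH xA xa wR wH wL; have [vR vH vL] := prP pH aA aH xA xa.
by have [Hf sZH _ _] := pH; apply: (ln_meetR Hf sZH aH) vL wL.
Qed.

Lemma notpar H a x : is_flat H -> Z \subset H -> a \notin H -> x \in H -> x \notin Z -> x \notin cl (a |: Z).
Proof.
move=> Hf sZH aH xH xZ; apply: contra aH => h; have := par_sym xZ h.
by apply/subsetP/flat_U1.
Qed.

Lemma pr_inj a H1 H x1 x2 : plane H1 -> plane H -> a \in A -> a \notin H1 -> a \notin H ->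
  x1 \in R -> x2 \in R -> x1 \in H1 -> x2 \in H1 -> pr a H x1 = pr a H x2 -> x1 = x2.
Proof.
move=> p1 pH aA a1 aH x1R x2R x1H x2H e12; have [H1f sZ1 _ _] := p1; have [Hf sZH _ _] := pH.
have np x : x \in R -> x \in H1 -> x \notin cl (a |: Z) by move=> h h'; apply: (notpar H1f) => //; apply: RZ.
have [vR vH vL1] := prP pH aA aH (RA x1R) (np _ x1R x1H).
have [_ _] := prP pH aA aH (RA x2R) (np _ x2R x2H); rewrite -e12.
set v := pr a H x1 in vR vH vL1 * => vL2.
have va : v \notin cl (a |: Z) by apply: (notpar Hf) => //; apply: RZ.
apply: (ln_meetR H1f sZ1 a1 x1H x2H x1R x2R (ln_l x1 a)).
by rewrite -(ln_exch vL1 va) (ln_exch vL2 va) ln_l.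
Qed.

Lemma pr_coll a H1 H x z w : plane H1 -> plane H -> a \in A -> a \notin H1 -> a \notin H ->
  x \in R -> z \in R -> w \in R -> x \in H1 -> z \in H1 -> w \in H1 ->
  w \in ln x z -> pr a H w \in ln (pr a H x) (pr a H z).
Proof.
move=> p1 pH aA a1 aH xR zR wR xH zH wH wL; have [H1f sZ1 _ _] := p1; have [Hf sZH sHA _] := pH.
have np v : v \in R -> v \in H1 -> v \notin cl (a |: Z) by move=> h h'; apply: (notpar H1f) => //; apply: RZ.
have P v vR vH := prP pH aA aH (RA vR) (np v vR vH).
have [exz|nxz] := eqVneq x z.
  have -> : w = x by apply: Req => //; move: wL; rewrite -exz ln_par ?mem_clU1.
  exact: ln_l.
have [pxR pxH pxL] := P _ xR xH; have [pzR pzH pzL] := P _ zR zH; have [pwR pwH pwL] := P _ wR wH.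
have nxz' : pr a H x != pr a H z by apply: contra nxz => /eqP h; apply/eqP/(pr_inj p1 pH aA a1 aH).
set Q := cl (a |: ln x z).
have xQ v : v \in ln x z -> pr a H v \in ln v a -> pr a H v \in Q.
  move=> vL; apply/subsetP/ln_sub; rewrite ?flat_cl ?mem_clU1 //.
    by rewrite (subset_trans (sZln x z)) // subset_clU1.
  exact: (subsetP (subset_clU1 r a _)).
have rxz : r (ln x z) = (r Z).+2 by apply: rln; rewrite ?RZ // Rinj.
have axz : a \notin cl (ln x z).
  by rewrite flatE ?ln_flat //; apply: contra a1; apply/subsetP/ln_sub.
have rQ : r Q = (r Z).+3 by rewrite rf_cl rf_notin_cl // rxz.
have QHf : is_flat (Q :&: H) by apply: flatI => //; apply: flat_cl.
have rQH : r (Q :&: H) <= (r Z).+2.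
  rewrite -ltnS -rQ; apply: flat_lt => //; first exact: subsetIl.
  apply: contra aH => /subsetP/(_ a); rewrite inE mem_clU1 => /(_ isT) /andP[] //.
have -> : ln (pr a H x) (pr a H z) = Q :&: H.
  apply: (@flat_eq _ r) => //; first exact: ln_flat.
    apply: ln_sub => //; rewrite ?inE ?pxH ?pzH ?andbT ?xQ ?ln_l ?ln_r //.
    by rewrite subsetI sZH andbT (subset_trans (sZln x z)) // subset_clU1.
  by rewrite (rln (RZ pzR)) // Rinj.
by rewrite inE pwH xQ.
Qed.

Lemma card_line L : is_flat L -> Z \subset L -> L \subset A -> r L = (r Z).+2 -> #|R :&: L| = y.+1.
Proof.
move=> Lf sZL sLA rL; have [_ _ _ hP] := pA; rewrite -(hP Z L) // /Closure.nP.
have inj : {in R :&: L &, injective (fun x => cl (x |: Z))}.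
  move=> x z /setIP[xR _] /setIP[zR _] e; apply: Req => //; by rewrite -e mem_clU1.
rewrite -(card_in_imset inj); apply: eq_card => F; apply/imsetP/ptsP.
  by move=> [x /setIP[xR xL] ->]; exists x => //; rewrite notin_flat // RZ.
move=> [x [xL]]; rewrite notin_flat // => xZ ->.
have [z zR [zL xz]] := rep_in Lf sZL xL (subsetP sLA _ xL) xZ.
by exists z; rewrite ?inE ?zR //; apply: cl_exchange => //; rewrite notin_flat.
Qed.

Lemma third x z : x \in R -> z \in R -> x != z ->
  exists2 d, d \in R & [/\ d \in ln x z, d != x & d != z].
Proof.
move=> xR zR nxz.
have c : #|R :&: ln x z| = y.+1.
  by apply: card_line; rewrite ?ln_flat ?sZln ?ln_sub ?RA // rln ?RZ // Rinj.
have /subsetPn[d] : ~~ (R :&: ln x z \subset [set x; z]).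
  by apply/negP=> /subset_leq_card; rewrite c cards2 nxz ltnS leqNgt y_gt1.
by rewrite !inE negb_or => /andP[dR dL] /andP[h1 h2]; exists d.
Qed.

Variables (H0 l : {set T}).
Hypotheses (pH0 : plane H0) (lf : is_flat l) (sZl : Z \subset l) (sl : l \subset H0)
  (rl : r l = (r Z).+2).
Let S0 := R :&: H0.
Let H0f : is_flat H0. Proof. by case: pH0. Qed.
Let sZH0 : Z \subset H0. Proof. by case: pH0. Qed.
Let sH0A : H0 \subset A. Proof. by case: pH0. Qed.
Let rH0 : r H0 = (r Z + 3)%N. Proof. by case: pH0. Qed.

(** Collineations of H0 with axis l, encoded as permutations of [T] supported on chosen
    representatives of points, so that Cauchy's theorem for finite groups applies. *)
Definition coll (g : {perm T}) := [&& perm_on S0 g,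
  [forall x in S0, forall z in S0, forall w in S0, (w \in ln x z) ==> (g w \in ln (g x) (g z))] &
  [forall x in S0, (x \in l) ==> (g x == x)]].

Definition centered c (g : {perm T}) := [forall x in S0, g x \in ln x c].

Lemma collP g : reflect [/\ perm_on S0 g,
  forall x z w, x \in S0 -> z \in S0 -> w \in S0 -> w \in ln x z -> g w \in ln (g x) (g z) &
  forall x, x \in S0 -> x \in l -> g x = x] (coll g).
Proof.
apply: (iffP and3P) => [[h1 h2 h3]|[h1 h2 h3]]; split=> //.
- move=> x z w xS zS wS; move/forall_inP/(_ x xS)/forall_inP/(_ z zS)/forall_inP/(_ w wS)/implyP: h2.
  exact.
- by move=> x xS xl; move/forall_inP/(_ x xS)/implyP/(_ xl)/eqP: h3.
- apply/forall_inP=> x xS; apply/forall_inP=> z zS; apply/forall_inP=> w wS; apply/implyP.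
  exact: h2.
- by apply/forall_inP=> x xS; apply/implyP=> xl; rewrite h3.
Qed.

Definition Gam := [set g | coll g].

Lemma Gam_group_set : group_set Gam.
Proof.
apply/group_setP; split=> [|g h]; rewrite !inE.
  apply/collP; split=> [|x z w _ _ _|x _ _]; rewrite ?perm1 //; exact: perm_on1.
move=> /collP[g1 g2 g3] /collP[h1 h2 h3]; apply/collP; split.
- exact: perm_onM.
- move=> x z w xS zS wS wL; rewrite !permM; apply: h2; rewrite ?(perm_closed _ g1) //.
  exact: g2.
- by move=> x xS xl; rewrite permM g3 // h3.
Qed.

Canonical Gam_group := Group Gam_group_set.

(** Central collineations with axis l and centre c: elations when c is on l, homologies
    otherwise. *)
Definition El c := [set g in Gam | centered c g].

Lemma ElP c g : reflect (g \in Gam /\ forall x, x \in S0 -> g x \in ln x c) (g \in El c).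
Proof.
by rewrite [g \in El c]in_set; apply: (iffP andP) => [[h1 /forall_inP h2]|[h1 h2]]; split=> //; apply/forall_inP.
Qed.

Lemma El_group_set c : group_set (El c).
Proof.
apply/group_setP; split=> [|g h].
  by apply/ElP; split=> [|x _]; rewrite ?group1 // perm1 ln_l.
move=> /ElP[g1 g2] /ElP[h1 h2]; apply/ElP; split=> [|x xS]; first exact: groupM.
have gS : g x \in S0 by move: g1; rewrite inE => /collP[g1 _ _]; rewrite (perm_closed _ g1).
rewrite permM; apply: subsetP (h2 _ gS); apply: ln_sub; rewrite ?ln_flat ?sZln ?ln_r //.
exact: g2.
Qed.

Canonical El_group c := Group (El_group_set c).

Lemma S0R x : x \in S0 -> x \in R. Proof. by case/setIP. Qed.
Lemma S0H x : x \in S0 -> x \in H0. Proof. by case/setIP. Qed.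

(* Project H0 onto a second plane through l from a, and back from b: the composite is a
   collineation of H0 fixing l pointwise, with centre the trace of the line ab. *)
Lemma central c s s' : c \in S0 -> s \in S0 -> s' \in S0 -> s \notin l -> s' \notin l ->
  s != c -> s' != c -> s' \in ln s c ->
  exists2 g, g \in Gam & (forall x, x \in S0 -> g x \in ln x c) /\ g s = s'.
Proof.
move=> cS sS s'S nsl ns'l nsc ns'c s'sc.
have [a aR aH] : exists2 a, a \in R & a \notin H0.
  have [|a0 a0A] := @ltn_rank_ex T r H0 A; first by rewrite rA rH0 ltn_add2l.
  rewrite notin_flat // => a0H.
  have [|a aR h] := Rsurj a0A; first by apply: contra a0H; apply: (subsetP sZH0).
  exists a => //; apply: contra a0H => aH; apply: subsetP h; exact: flat_U1.
have aA := RA aR.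
have nsa : s != a by apply: contraNneq aH => <-; apply: S0H.
(* A third point of the line s a; with l it spans the auxiliary plane H', and it is the image of s
   under projection from a. *)
have [d dR [dL nds nda]] := third (S0R sS) aR nsa.
have dA := RA dR.
have dS : d \notin cl (s |: Z) by apply: Rinj => //; apply: S0R.
have da : d \notin cl (a |: Z) by apply: Rinj.
have dH : d \notin H0.
  apply: contra aH => dH; have : a \in ln d s by rewrite (@ln_exch a s d) ?ln_l // lnC.
  by apply/subsetP/ln_sub => //; apply: S0H.
set H' := cl (d |: l).
have dl : d \notin cl l by rewrite flatE //; apply: contra dH; apply: (subsetP sl).
have pH' : plane H'.
  split; rewrite ?flat_cl //; first by rewrite (subset_trans sZl) // subset_clU1.
    by apply: flat_U1 => //; apply: subset_trans sl sH0A.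
  by rewrite rf_cl rf_notin_cl // rl addn3.
have [H'f sZH' sH'A _] := pH'.
have H'H0 x : x \in H' -> x \in H0 -> x \in l by move=> h1 h2; apply: (cl_meet H0f lf sl dH h2 h1).
have dH' : d \in H' by apply: mem_clU1.
have aH' : a \notin H'.
  apply: contra nsl => aH'; apply: H'H0; last exact: S0H.
  have : s \in ln d a by rewrite (ln_exch dL da) ln_l.
  by apply/subsetP/ln_sub.
have ac : a != c by apply: contraNneq aH => ->; apply: S0H.
set Q := cl (a |: ln s c).
have rsc : r (ln s c) = (r Z).+2 by apply: rln; [apply/RZ/S0R | apply: Rinj => //; apply: S0R].
have ssc : ln s c \subset H0 by apply: ln_sub => //; apply: S0H.
have rQ : r Q = (r Z).+3.
  by rewrite rf_cl rf_notin_cl ?rsc // flatE ?ln_flat //; apply: contra aH; apply: (subsetP ssc).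
have sQ : ln s c \subset Q by apply: subset_clU1.
have aQ : a \in Q by apply: mem_clU1.
have QA : Q \subset A by apply: flat_U1 => //; apply: subset_trans sH0A.
have Qf : is_flat Q by apply: flat_cl.
have sZQ : Z \subset Q by rewrite (subset_trans (sZln s c)).
have sQ' x : x \in ln s c -> x \in Q by apply: (subsetP sQ).
have pQ : proj r Z Q y by apply: (proj_sub pA).
have racl : r (ln a c) = (r Z).+2 by apply: rln; [apply/RZ/S0R | apply: Rinj => //; apply: S0R].
have s'd : s' \notin cl (d |: Z) by apply: (notpar H0f) => //; [apply: S0H | apply/RZ/S0R].
have rsd : r (ln s' d) = (r Z).+2 by apply: rln => //; apply: RZ.
have dQ : d \in Q.
  by apply: subsetP dL; apply: ln_sub => //; apply: sQ'; apply: ln_l.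
(* On the line a c, so that c becomes the centre, and on the line s' d, so that projecting back from
   b sends d to s'. *)
have [b bR [bac bsd]] : exists2 b, b \in R & b \in ln a c /\ b \in ln s' d.
  have s1 : ln a c \subset Q by apply: ln_sub => //; apply/sQ'/ln_r.
  have s2 : ln s' d \subset Q by apply: ln_sub => //; apply: sQ'.
  have rr : r Q = (r (ln a c)).+1 by rewrite racl.
  have [v [v1 v2] vZ] := proj_meet pQ (ln_flat a c) (sZln a c) s1 rr (ln_flat s' d) (sZln s' d) s2 rsd.
  have sI : Z \subset ln a c :&: ln s' d by rewrite subsetI !sZln.
  have vI : v \in ln a c :&: ln s' d by rewrite inE v2.
  have [w wR [wI _]] := rep_in (flatI (ln_flat a c) (ln_flat s' d)) sI vI (subsetP QA _ (subsetP s1 _ v2)) vZ.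
  by exists w => //; apply/andP; move: wI; rewrite inE.
have bA := RA bR.
have bH : b \notin H0.
  apply/negP=> bH; have ebc : b = c.
    by apply: (ln_meetR H0f sZH0 aH bH (S0H cS) bR (S0R cS) (x := c)); rewrite ?ln_l // lnC.
  have : c = s'.
    apply: (ln_meetR H0f sZH0 dH (S0H cS) (S0H s'S) (S0R cS) (S0R s'S) (x := s')).
      by rewrite -ebc.
    exact: ln_l.
  by move=> h; rewrite h eqxx in ns'c.
have nbd : b != d.
  apply/negP=> /eqP ebd; have : s = c.
    apply: (ln_meetR H0f sZH0 aH (S0H sS) (S0H cS) (S0R sS) (S0R cS) (x := c)); last exact: ln_l.
    have <- : ln d a = ln c a by apply: ln_exch => //; rewrite -ebd lnC.
    by rewrite (ln_exch dL da) ln_l.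
  by move=> h; rewrite h eqxx in nsc.
have bd : b \notin cl (d |: Z) by apply: Rinj.
have s'bd : s' \in ln b d by rewrite (ln_exch bsd bd) ln_l.
have bH' : b \notin H'.
  apply: contra ns'l => bH'; apply: H'H0; last exact: S0H.
  by apply: subsetP s'bd; apply: ln_sub.
pose g0 x := pr b H0 (pr a H' x).
have npa x : x \in S0 -> x \notin cl (a |: Z).
  by move=> xS; apply: (notpar H0f) => //; [apply: S0H | apply/RZ/S0R].
have P1 x : x \in S0 -> [/\ pr a H' x \in R, pr a H' x \in H' & pr a H' x \in ln x a].
  by move=> xS; apply: prP => //; [apply/RA/S0R | apply: npa].
have npb x : x \in R -> x \in H' -> x \notin cl (b |: Z).
  by move=> xR xH; apply: (notpar H'f) => //; apply: RZ.
have P2 x : x \in S0 -> [/\ g0 x \in R, g0 x \in H0 & g0 x \in ln (pr a H' x) b].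
  by move=> xS; have [h1 h2 h3] := P1 x xS; apply: prP => //; [apply: RA | apply: npb].
have g0S x : x \in S0 -> g0 x \in S0 by move=> xS; have [h1 h2 _] := P2 x xS; rewrite inE h1.
pose f x := if x \in S0 then g0 x else x.
have f_inj : injective f.
  move=> x z; rewrite /f; case: ifP => xS; case: ifP => zS //; last first.
  - by move=> e; have := g0S _ zS; rewrite -e xS.
  - by move=> e; have := g0S _ xS; rewrite e zS.
  move=> e; have [x1 x2 _] := P1 x xS; have [z1 z2 _] := P1 z zS.
  apply: (pr_inj pH0 pH' aA aH aH') => //; try exact: S0R; try exact: S0H.
  exact: (pr_inj pH' pH0 bA bH' bH x1 z1 x2 z2 e).
exists (perm f_inj).
  rewrite inE; apply/collP; split.
  - apply/subsetP=> x; rewrite inE permE /f; case: ifP => //=; by rewrite eqxx.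
  - move=> x z w xS zS wS wL; rewrite !permE /f xS zS wS.
    have [x1 x2 _] := P1 x xS; have [z1 z2 _] := P1 z zS; have [w1 w2 _] := P1 w wS.
    apply: (pr_coll pH' pH0) => //.
    by apply: (pr_coll pH0 pH') => //; try exact: S0R; exact: S0H.
  - move=> x xS xl; rewrite permE /f xS /g0.
    have xH' : x \in H' by apply: (subsetP (subset_clU1 r d l)).
    have xR := S0R xS; have xA := RA xR; have xa := npa x xS; have xb := npb x xR xH'.
    have -> : pr a H' x = x by apply: pr_uniq => //; apply: ln_l.
    by apply: pr_uniq => //; [apply: S0H | apply: ln_l].
split=> [x xS|]; rewrite permE /f ?xS ?sS.
  have [u1 u2 u3] := P1 x xS; have [g1 g2 g3] := P2 x xS.
  have sxc : ln x c \subset H0 by apply: ln_sub => //; apply: S0H.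
  apply: (cl_meet H0f (ln_flat x c) sxc aH g2).
  have sZa : Z \subset cl (a |: ln x c) by rewrite (subset_trans (sZln x c)) // subset_clU1.
  have ma : a \in cl (a |: ln x c) by apply: mem_clU1.
  have mx v : v \in ln x c -> v \in cl (a |: ln x c) by apply: (subsetP (subset_clU1 _ _ _)).
  apply: subsetP g3; apply: ln_sub; rewrite ?flat_cl //.
    by apply: subsetP u3; apply: ln_sub; rewrite ?flat_cl // mx ?ln_l.
  by apply: subsetP bac; apply: ln_sub; rewrite ?flat_cl // mx ?ln_r.
have sR := S0R sS; have sA := RA sR; have sa := npa s sS; have db := npb d dR dH'.
rewrite /g0; have -> : pr a H' s = d by apply: pr_uniq.
by apply: pr_uniq => //; [apply: S0R | apply: S0H | rewrite lnC].
Qed.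

(** * The group of elations with a given centre P on the axis *)

Section ElationGroup.
Variables (o P : T).
Hypotheses (oS : o \in S0) (ol : o \notin l) (PS : P \in S0) (Pl : P \in l).

Lemma nPo : P != o. Proof. by apply: contraTneq Pl => ->. Qed.

(** If o' off the axis is fixed and x is off the line o' P, the line x o' meets the axis in a fixed
    point, so g x stays on it; g x also stays on x P, hence equals x. The points of the line o P are
    treated from a fixed w off that line. *)
Lemma El_fix g : g \in El P -> g o = o -> g = 1.
Proof.
move=> /ElP[+ g4] go; rewrite inE => /collP[g1 g2 g3].
have key o' x : o' \in S0 -> o' \notin l -> g o' = o' -> x \in S0 -> x \notin l ->
    x \notin ln o' P -> g x = x.
  move=> o'S o'l go' xS xl xo'.
  have nxo : x \notin cl (o' |: Z).
    by apply: contra xo' => h; rewrite (subsetP _ _ h) //; apply: flat_U1; rewrite ?ln_flat ?sZln ?ln_l.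
  have pH : proj r Z H0 y by apply: (proj_sub pA).
  have sL : ln x o' \subset H0 by apply: ln_sub => //; apply: S0H.
  have rr : r H0 = (r l).+1 by rewrite rH0 rl addn3.
  have [v [v1 v2] vZ] := proj_meet pH lf sZl sl rr (ln_flat x o') (sZln x o') sL (rln (RZ (S0R o'S)) nxo).
  have sI : Z \subset ln x o' :&: l by rewrite subsetI sZln.
  have vI : v \in ln x o' :&: l by rewrite inE v1.
  have [z zR [zI _]] := rep_in (flatI (ln_flat x o') lf) sI vI (subsetP sH0A _ (subsetP sl _ v2)) vZ.
  have [zL zl] := setIP zI; have zS : z \in S0 by rewrite inE zR (subsetP sl).
  have zo : z \notin cl (o' |: Z) by apply: (notpar lf) => //; apply: RZ.
  have ezo := ln_exch zL zo.
  have xoz : x \in ln o' z by rewrite lnC ezo ln_l.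
  have h := g2 _ _ _ o'S zS xS xoz; rewrite go' (g3 z) // lnC ezo lnC in h.
  have gS : g x \in S0 by rewrite (perm_closed _ g1).
  apply: (Req (S0R gS) (S0R xS)); apply: (@ln_inter x o' P) => //; last by rewrite lnC g4.
  apply: contra xo' => Po; rewrite lnC.
  have Poo : P \notin cl (o' |: Z) by apply: (notpar lf) => //; apply/RZ/S0R.
  by rewrite (@ln_exch x o' P) ?ln_l // lnC.
apply/permP=> x; rewrite perm1.
have [xS|xS] := boolP (x \in S0); last exact: (out_perm g1).
have [xl|xl] := boolP (x \in l); first exact: g3.
have [xoP|] := boolP (x \in ln o P); last exact: key.
have [z zR [zl nzP]] : exists2 z, z \in R & z \in l /\ z != P.
  have : #|R :&: l| = y.+1 by apply: card_line => //; apply: subset_trans sl sH0A.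
  rewrite (cardsD1 P) inE Pl (S0R PS) /= => /eqP; rewrite eqSS => /eqP c.
  have /card_gt0P[z] : 0 < #|(R :&: l) :\ P| by rewrite c ltnW.
  by rewrite !inE => /and3P[h1 h2 h3]; exists z.
have zS : z \in S0 by rewrite inE zR (subsetP sl).
have noz : o != z by apply: contraNneq ol => ->.
have [w wR [wL nwo nwz]] := third (S0R oS) zR noz.
have wo : w \notin cl (o |: Z) by apply: Rinj => //; apply: S0R.
have wz : w \notin cl (z |: Z) by apply: Rinj.
have wS : w \in S0.
  by rewrite inE wR; apply: subsetP wL; apply: ln_sub => //; apply: S0H.
have wl : w \notin l.
  apply: contra ol => wl; have : o \in ln w z by rewrite (ln_exch wL wz) ln_l.
  by apply/subsetP/ln_sub.
have woP : w \notin ln o P.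
  apply: contra nzP => woP; apply/eqP.
  apply: (ln_meetR lf sZl ol zl Pl zR (S0R PS) (x := P)); last exact: ln_l.
  have <- : ln w o = ln P o by apply: ln_exch => //; rewrite lnC.
  by rewrite (@ln_exch z o w) ?ln_l // lnC.
have gw := key o w oS ol go wS wl woP.
apply: (key w) => //; apply: contra xl => xwP.
have : x \in cl (P |: Z) by apply: (@ln_inter P o w).
by apply/subsetP/flat_U1.
Qed.

Lemma lnoP x : x \in R -> x \in ln o P -> x != P -> x \in S0 /\ x \notin l.
Proof.
move=> xR xL nxP; split.
  by rewrite inE xR; apply: subsetP xL; apply: ln_sub => //; apply: S0H.
apply: contra nxP => xl; apply/eqP.
by apply: (ln_meetR lf sZl ol xl Pl xR (S0R PS) (x := P)); rewrite ?ln_l // lnC.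
Qed.

Lemma El_inj : {in El P &, injective (fun g : {perm T} => g o)}.
Proof.
move=> g h gE hE /= e; have E1 : g * h^-1 \in El P by rewrite groupM ?groupV.
have := El_fix E1; rewrite permM e permK => /(_ erefl) h1.
by apply/eqP; rewrite eq_mulgV1 h1.
Qed.

(** The elations act regularly on the y points of the line o P other than P: [central] gives
    transitivity and [El_fix] freeness. *)
Lemma card_El : #|El P| = y.
Proof.
have c : #|R :&: ln o P| = y.+1.
  have oR := S0R oS; have PR := S0R PS.
  by apply: card_line; rewrite ?ln_flat ?sZln ?ln_sub ?RA // rln ?RZ // Rinj // eq_sym nPo.
rewrite (cardsD1 P) inE ln_r (S0R PS) /= in c; case: c => <-.
rewrite -(card_in_imset El_inj); apply: eq_card => s; rewrite !inE.
apply/imsetP/and3P=> [[g gE ->]|[nsP sR sL]].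
  have /ElP[+ g4] := gE; rewrite inE => /collP[g1 _ g3].
  have gS : g o \in S0 by rewrite (perm_closed _ g1).
  split; [|exact: S0R|exact: g4].
  by rewrite -(g3 P PS Pl) (inj_eq perm_inj) eq_sym nPo.
have [sS sl'] := lnoP sR sL nsP.
have [g gG [gc gs]] : exists2 g, g \in Gam & (forall x, x \in S0 -> g x \in ln x P) /\ g o = s.
  by apply: central => //; rewrite eq_sym nPo.
by exists g => //; apply/ElP.
Qed.

(** A homology t with centre o carrying g o to h o conjugates g to an elation that agrees with h at
    o and so equals h. *)
Lemma El_conj g h : g \in El P -> h \in El P -> g != 1 -> h != 1 -> #[g] = #[h].
Proof.
move=> gE hE g1 h1.
have mv k : k \in El P -> k != 1 -> [/\ k o \in S0, k o \notin l, k o != o & k o \in ln o P].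
  move=> kE k1; have /ElP[+ k4] := kE; rewrite inE => /collP[c1 _ c3].
  have kS : k o \in S0 by rewrite (perm_closed _ c1).
  have nP : k o != P by rewrite -(c3 P PS Pl) (inj_eq perm_inj) eq_sym nPo.
  have [_ kl] := lnoP (S0R kS) (k4 _ oS) nP; split=> //; last exact: k4.
  by apply: contra k1 => /eqP/(El_fix kE)->.
have [gS gl go gL] := mv g gE g1; have [hS hl ho hL] := mv h hE h1.
have goZ : g o \notin cl (o |: Z) by apply: Rinj => //; apply: S0R.
have [t tG [tc ts]] : exists2 t, t \in Gam & (forall x, x \in S0 -> t x \in ln x o) /\ t (g o) = h o.
  by apply: central => //; rewrite (@ln_exch P o (g o)) // lnC.
have tG' := tG; rewrite inE in tG'; have /collP[t1 t2 t3] := tG'.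
have to : t o = o.
  have tS : t o \in S0 by rewrite (perm_closed _ t1).
  by apply: (Req (S0R tS) (S0R oS)); have := tc o oS; rewrite ln_par ?mem_clU1.
have gtE : g ^ t \in El P.
  have /ElP[gG g4] := gE; apply/ElP; split=> [|x xS]; first by rewrite groupJ.
  have tV : t^-1 \in Gam by rewrite groupV.
  have vS : t^-1 x \in S0 by move: tV; rewrite inE => /collP[v1 _ _]; rewrite (perm_closed _ v1).
  have gvS : g (t^-1 x) \in S0 by move: gG; rewrite inE => /collP[v1 _ _]; rewrite (perm_closed _ v1).
  have := t2 _ _ _ vS PS gvS (g4 _ vS).
  by rewrite permKV (t3 P) // conjgE !permM.
suff -> : h = g ^ t by rewrite orderJ.
apply: El_inj => //=; rewrite conjgE !permM -ts; congr (t (g _)).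
by rewrite -{2}to permK.
Qed.

(** By Cauchy every prime divisor of y is the order of an elation, and all nontrivial elations have
    the same order. *)
Lemma El_prime_power : prime_power y.
Proof.
have pp : prime (pdiv y) by apply: pdiv_prime.
have [g gE og] : {g | g \in El P & #[g] = pdiv y}.
  by apply: Cauchy => //; rewrite card_El pdiv_dvd.
have ypow : (pdiv y).-nat y.
  apply/pnatP; first exact: ltnW.
  move=> p' p'p dv; have [h hE oh] : {h | h \in El P & #[h] = p'} by apply: Cauchy => //; rewrite card_El.
  rewrite inE /= -oh -og; apply/eqP/El_conj => //.
    by apply: contraTneq p'p => h1; rewrite -oh h1 order1.
  by apply: contraTneq pp => g1; rewrite -og g1 order1.
have [k hk] := p_natP ypow; exists (pdiv y), k; split=> //.
by case: k hk => // hk; move: y_gt1; rewrite hk.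
Qed.

End ElationGroup.
End PrimePower.

Lemma proj_prime_power (T : finType) (r : rankfun T) (Z A : {set T}) y :
  proj r Z A y -> r A = (r Z + 4)%N -> 1 < y -> prime_power y.
Proof.
move=> pA rA y1; have [Zf Af sZA hP] := pA.
have [R sR [_ eR iR]] := pts_transversal r Z A.
rewrite (flatE Zf) in sR.
have Rs x : x \in A -> x \notin Z -> exists2 z, z \in R & x \in cl r (z |: Z).
  move=> xA xZ; have : cl r (x |: Z) \in pts r Z A by apply: mem_pts; rewrite ?notin_flat.
  by rewrite -eR => /ptsP[z [zR _] e]; exists z => //; rewrite -e mem_clU1.
have RZ x : x \in R -> x \in A /\ x \notin Z by move/(subsetP sR); rewrite inE => /andP[].
have rlt k : (k < 4)%N -> (r Z + k < r A)%N by rewrite rA ltn_add2l.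
have [|P0 P0A] := @ltn_rank_ex T r Z A; first by rewrite -{1}(addn0 (r Z)) rlt.
rewrite notin_flat // => P0Z; have [P PR _] := Rs _ P0A P0Z.
have [PA PZ] := RZ _ PR; have PZ' : P \notin cl r Z by rewrite notin_flat.
have [|x xA xP] := @ltn_rank_ex T r (P |: Z) A; first by rewrite rf_notin_cl // -addn1 rlt.
set l := cl r (x |: (P |: Z)).
have sZl : Z \subset l by rewrite (subset_trans _ (sub_cl _ _)) // setUA subsetUr.
have sl : l \subset A by rewrite flat_sub // !subUset !sub1set xA PA.
have rl : r l = (r Z).+2 by rewrite rf_cl notin_cl2.
have [|o0 o0A] := @ltn_rank_ex T r l A; first by rewrite rl -addn2 rlt.
rewrite flatE ?flat_cl // => o0l.
have o0Z : o0 \notin Z by apply: contra o0l; apply: (subsetP sZl).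
have [o oR h] := Rs _ o0A o0Z; have [oA oZ] := RZ _ oR.
have ol : o \notin l.
  by apply: contra o0l => ol; apply: subsetP h; apply: flat_U1; rewrite ?flat_cl.
set H0 := cl r (o |: l).
have pH0 : plane r Z A H0.
  split; [exact: flat_cl | by rewrite (subset_trans sZl) // subset_clU1 | by apply: flat_U1 |].
  by rewrite rf_cl rf_notin_cl ?rl ?addn3 // flatE ?flat_cl.
have Pl : P \in l by apply: mem_cl; rewrite !inE eqxx orbT.
apply: (@El_prime_power T r Z A y pA rA y1 R sR iR Rs H0 l pH0 (flat_cl _ _) sZl (subset_clU1 _ _ _) rl o P) => //.
  by rewrite inE oR mem_clU1.
by rewrite inE PR; apply: (subsetP (subset_clU1 r o l)).
Qed.
End Elations.
Import Elations.

(** * Few lines through a point are longer than q+1 *)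

Section Sparse.
Variable q : nat.
(* K <= B (q - 1/2)^k. *)
Definition sp B k K := 2 ^ k * K <= B * q.*2.-1 ^ k.

Lemma sp_mono B B' k K K' : B <= B' -> K' <= K -> sp B k K -> sp B' k K'.
Proof.
move=> hB hK h; apply: leq_trans (leq_trans _ (leq_trans h _)) _; first by rewrite leq_mul2l hK orbT.
  exact: leqnn.
by rewrite leq_mul2r hB orbT.
Qed.

(** Of the new constant, 2 l B covers the term l K and 2 covers the added one, as 2^k <= (2q -
    1)^k. *)
Lemma sp_step l B k K : 1 < q -> sp B k K -> sp (2 + 2 * l * B) k.+1 (l * K).+1.
Proof.
rewrite /sp !expnS => q1 h.
have h2 : 2 ^ k <= q.*2.-1 ^ k by case: k {h} => // k; rewrite leq_exp2r //; lia.
have : q.*2.-1 > 0 by lia.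
move: (q.*2.-1) (2 ^ k) h h2 => x a h h2 x0.
apply: leq_trans (_ : (2 + 2 * l * B) * (x ^ k) <= _).
  rewrite mulnS mulnDl -!mulnA; apply: leq_add; first by rewrite leq_mul2l h2.
  by rewrite leq_mul2l /= mulnCA leq_mul2l h orbT.
by rewrite leq_mul2l leq_pmull ?orbT.
Qed.

Lemma sp_drop B k j m K : 1 < q -> j <= m -> sp B (k + j) K -> sp (B * q.*2.-1 ^ m) k K.
Proof.
rewrite /sp !expnD => q1 jm h; apply: leq_trans (leq_trans _ h) _.
  by rewrite -mulnA leq_mul2l leq_pmull ?expn_gt0 ?orbT.
rewrite -mulnA leq_mul2l mulnC leq_mul2r leq_pexp2l ?orbT //; lia.
Qed.

Lemma sp_sum (I : finType) (P : {set I}) (F : I -> nat) B k :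
  (forall i, i \in P -> sp B k (F i)) -> sp (#|P| * B) k (\sum_(i in P) F i).
Proof.
rewrite /sp => h; rewrite big_distrr /= -mulnA -sum_nat_const; exact: leq_sum.
Qed.

End Sparse.

Lemma least_nat (P : nat -> Prop) n : P n -> exists m, [/\ m <= n, P m & forall i, i < m -> ~ P i].
Proof.
have [k] := ubnP n; elim: k n => // k IH n nk Pn.
have [[i [ilt Pi]]|h] := classic (exists i, i < n /\ P i).
  have [|m [mi Pm hm]] := IH i _ Pi; first by lia.
  by exists m; split=> //; lia.
by exists n; split=> // i ilt Pi; apply: h; exists i.
Qed.

Section Star.
Variables l q : nat.
Hypotheses (q_gt1 : 1 < q) (q_le_l : q <= l) (l_lt_qq : l < q * q).
Hypothesis (hmax : forall q' : nat, prime_power q' -> q' <= l -> q' <= q).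

Let l_gt0 : 0 < l. Proof. by move: q_gt1 q_le_l; clear; lia. Qed.

(** * Pointed configurations and their submembers *)

Section Submembers.
Variables (T : finType) (r : rankfun T) (e0 : T).
Implicit Types (A C D F G H K L X Z S : {set T}) (e f g p u x : T) (B y : nat).
Notation cl := (cl r).
Notation nP := (nP r).
Notation cos := (cos r).

Definition cork C := r setT - r C.

(** The coset of f is the line of M/C through e0 and f without e0, so this prescribes lines through
    e0 rich in points of S. *)
Definition pointed y C S := [/\ no_long_line r l, e0 \notin cl C,
  forall f, f \in S -> f \notin cl (e0 |: C) &
  forall f, f \in S -> y <= nP C (S :&: cos (e0 |: C) f)].

(* Saturation of S2 over the old base e0 |: C (and not over e0 |: C2) is what makes this relation
   transitive. *)
Definition submember C S C2 S2 := [/\ C \subset cl C2, e0 \notin cl C2, S2 \subset S,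
  forall f, f \in S2 -> f \notin cl (e0 |: C2) &
  forall f g, f \in S2 -> g \in S -> g \in cos (e0 |: C) f -> g \in S2].

(** Points of the contraction by e0 are lines through e0; density counts how many of these lines S
    meets. *)
Definition dense B C S := ~~ sp q B (cork (e0 |: C)) (nP (e0 |: C) S).

(** Seen in M/C: each plane through e0, e and an element of S off the line e0 e contains at least y
    lines through e0, other than e0 e, that meet S. *)
Definition apex y C S e := e \notin cl (e0 |: C) /\
  forall f, f \in S -> f \notin cl (e |: (e0 |: C)) ->
    y <= nP (e0 |: C) (S :&: cos (e |: (e0 |: C)) f).

Lemma subU1cl e C D : C \subset cl D -> e |: C \subset cl (e |: D).
Proof. by move=> h; rewrite subUset sub1set mem_clU1 (subset_trans h) // sub_clU1. Qed.

Lemma notin_clU1 e f C : e \notin cl C -> f \notin cl (e |: C) -> e \notin cl (f |: C).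
Proof. by move=> h1; apply: contra => h; apply: exchange. Qed.

Lemma notin_sub e C D : C \subset cl D -> e \notin cl D -> e \notin cl C.
Proof. by move=> h; apply: contra; apply/subsetP; rewrite cl_sub. Qed.

Lemma cos_mono C D f g : C \subset cl D -> f \notin cl D -> g \in cos C f -> g \in cos D f.
Proof.
move=> s fD; rewrite !inE => /andP[gC gf]; apply/andP; split.
  apply: contra fD => gD; have := exchange gf gC; apply/subsetP.
  by rewrite cl_sub subUset sub1set gD.
by apply: subsetP gf; rewrite cl_sub subU1cl.
Qed.

Lemma submember_trans C1 S1 C2 S2 C3 S3 :
  submember C1 S1 C2 S2 -> submember C2 S2 C3 S3 -> submember C1 S1 C3 S3.
Proof.
move=> [h1 h2 h3 h4 h5] [k1 k2 k3 k4 k5]; split=> //.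
- by rewrite (subset_trans h1) // cl_sub.
- exact: subset_trans k3 h3.
move=> f g fS gS gf; have fS2 := subsetP k3 _ fS.
apply: (k5 f) => //; first exact: h5 gf.
by apply: cos_mono gf; [apply: subU1cl | apply: h4].
Qed.

(* A saturated subset inherits all points of a line, and contraction only adds points. *)
Lemma line_inherit y C D e f S S2 : C \subset cl D -> e \notin cl D -> f \notin cl (e |: D) ->
  S :&: cos (e |: C) f \subset S2 -> y <= nP C (S :&: cos (e |: C) f) ->
  y <= nP D (S2 :&: cos (e |: D) f).
Proof.
move=> s eD fD sS le; apply: leq_trans le _.
have -> : S :&: cos (e |: C) f = (S :&: cos (e |: C) f) :&: cos (e |: C) f.
  by rewrite -setIA setIid.
apply: leq_trans (nP_line_mono _ s eD fD) _; apply: nPS.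
by apply: setSI.
Qed.

Lemma pointed_submember y C S C2 S2 : pointed y C S -> submember C S C2 S2 -> pointed y C2 S2.
Proof.
move=> [U p1 p2 p3] [h1 h2 h3 h4 h5]; split=> // f fS2; have fS := subsetP h3 _ fS2.
apply: (line_inherit h1) (p3 f fS) => //; first exact: h4.
by apply/subsetP=> g /setIP[gS gf]; apply: h5 gf.
Qed.

Lemma cork_U1 e C : e \notin cl C -> cork C = (cork (e |: C)).+1.
Proof.
move=> eC; have : r (e |: C) <= r setT by apply: rfS; apply: subsetT.
by rewrite /cork rf_notin_cl //; clear; lia.
Qed.

Lemma cork_cl C : cork (cl C) = cork C. Proof. by rewrite /cork rf_cl. Qed.

Lemma dense_ex B C S : dense B C S -> exists2 f, f \in S & f \notin cl (e0 |: C).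
Proof.
rewrite /dense => d; have : 0 < nP (e0 |: C) S.
  by rewrite lt0n; apply: contra d => /eqP ->; rewrite /sp muln0.
by case/card_gt0P=> F /ptsP[f [fS fC] _]; exists f.
Qed.

Lemma dense_U1 B C S f : no_long_line r l -> f \notin cl (e0 |: C) ->
  dense (2 + 2 * l * B) C S -> dense B (f |: C) (S :\: cl (f |: (e0 |: C))).
Proof.
move=> U fC; rewrite /dense setUCA nPD (cork_U1 fC); apply: contra => h.
apply: sp_mono (leqnn _) _ (sp_step l q_gt1 h); exact: nP_le_step.
Qed.

Lemma submember_U1 C S f : e0 \notin cl C -> f \notin cl (e0 |: C) ->
  (forall g, g \in S -> g \notin cl (e0 |: C)) ->
  submember C S (f |: C) (S :\: cl (f |: (e0 |: C))).
Proof.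
move=> e0C fC h; split.
- exact: subset_clU1.
- exact: notin_clU1.
- exact: subsetDl.
- by move=> g; rewrite inE setUCA => /andP[].
move=> g g' /setDP[gS gf] g'S g'g; rewrite inE g'S andbT.
by have := cos_mono (subset_clU1 _ _ _) gf g'g; rewrite inE => /andP[].
Qed.

End Submembers.

(** Ranging over all [T] and [r] makes constants uniform: by [not_unbounded], a class that is not
    unbounded has one bound for all its members. *)
Definition class := forall (T : finType) (r : rankfun T), T -> {set T} -> {set T} -> Prop.

Definition unbounded (Q : class) := forall B, exists (T : finType) (r : rankfun T) e0 C S,
  Q T r e0 C S /\ dense r e0 B C S.

Definition closed_class y0 (Q : class) :=
  (forall T r e0 C S, Q T r e0 C S -> pointed r e0 y0 C S) /\
  (forall T r e0 C S C2 S2, Q T r e0 C S -> submember r e0 C S C2 S2 -> Q T r e0 C2 S2).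

Definition has_apex (Q : class) y := unbounded (fun T r e0 C S =>
  Q T r e0 C S /\ exists e, apex r e0 y C S e).

Lemma not_unbounded Q : ~ unbounded Q ->
  exists B, forall T r e0 C S, Q T r e0 C S -> ~~ dense r e0 B C S.
Proof.
move=> h; apply: NNPP => h2; apply: h => B; apply: NNPP => h3; apply: h2; exists B.
move=> T r e0 C S hQ; apply/negP=> hd; apply: h3; exists T, r, e0, C, S; by [].
Qed.

Lemma unbounded_sub (Q Q' : class) : (forall T r e0 C S, Q T r e0 C S -> Q' T r e0 C S) ->
  unbounded Q -> unbounded Q'.
Proof. by move=> s h B; have [T [r [e0 [C [S [/s h1 h2]]]]]] := h B; exists T, r, e0, C, S. Qed.

Lemma has_apex_le Q y y' : y' <= y -> has_apex Q y -> has_apex Q y'.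
Proof.
move=> le; apply: unbounded_sub => T r e0 C S [h1 [e [h2 h3]]]; split=> //; exists e; split=> // f fS fe.
exact: leq_trans le (h3 f fS fe).
Qed.

(* Without apexes of order q, contracting any e in S multiplies the density by (q - 1/2) / (q - 1)
   up to a bounded error, forever. *)
Lemma has_apex_q y0 Q : closed_class y0 Q -> unbounded Q -> has_apex Q q.
Proof.
move=> [hp hs] hu; apply: NNPP => /not_unbounded[B1 hB1].
suff h n : forall T r e0 C S, Q T r e0 C S -> cork r (e0 |: C) <= n ->
    sp q ((1 + B1) * q.*2.-1) (cork r (e0 |: C)) (nP r (e0 |: C) S).
  have [T [r [e0 [C [S [hQ]]]]]] := hu ((1 + B1) * q.*2.-1).
  by rewrite /dense (h _ _ _ _ _ _ hQ (leqnn _)).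
elim: n => [|n IH] T r e0 C S hQ le; have [U e0C Sc _] := hp _ _ _ _ _ hQ;
  (have [S0|[e eS]] := set_0Vmem S; first by rewrite S0 nP0 ?sub0set // /sp muln0).
  by move: le; rewrite (cork_U1 (Sc e eS)).
have eC := Sc e eS; rewrite (cork_U1 eC) in le *.
set D := e |: (e0 |: C).
(* The part of S on lines through e with at least q points. For it e is an apex of order q, so it is
   sparse by the choice of B1. *)
pose Sh := [set f in S :\: cl r D | q <= nP r (e0 |: C) (S :&: cos r D f)].
have memSh f : (f \in Sh) = [&& f \notin cl r D, f \in S & q <= nP r (e0 |: C) (S :&: cos r D f)].
  by rewrite inE in_setD -andbA.
have satD f g : f \notin cl r D -> g \in cos r (e0 |: C) f -> g \in cos r D f.
  by move=> fD gf; apply: cos_mono gf => //; apply: subset_clU1.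
have sub : submember r e0 C S C Sh.
  split; rewrite ?sub_cl //; first by apply/subsetP=> f; rewrite memSh => /and3P[].
    by move=> f; rewrite memSh => /and3P[_ fS _]; apply: Sc.
  move=> f g; rewrite !memSh => /and3P[fD fS hf] gS gf.
  have gf' := satD _ _ fD gf; rewrite (cos_sub gf') hf gS !andbT.
  by have /setDP[] := gf'.
have hSh : sp q B1 (cork r (e0 |: C)) (nP r (e0 |: C) Sh).
  have := hB1 T r e0 C Sh; rewrite /dense => h; apply: contraT => h'; case/negP: h' .
  rewrite -[sp _ _ _ _]negbK; apply: h; split; first exact: hs hQ sub.
  exists e; split=> // f; rewrite memSh => /and3P[fD fS hf] _.
  apply: leq_trans (hf) _; apply: nPS; rewrite subsetI subsetIr andbT.
  apply/subsetP=> g /setIP[gS gf]; rewrite memSh gS (cos_sub gf) -/D.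
  by have /setDP[_ ->] := gf.
have hS' : sp q ((1 + B1) * q.*2.-1) (cork r D) (nP r D S).
  have sm := submember_U1 e0C eC Sc.
  have := IH T r e0 (e |: C) (S :\: cl r D) (hs _ _ _ _ _ _ _ hQ sm).
  by rewrite setUCA -/D nPD; apply.
have hlo : nP r (e0 |: C) ((S :\: cl r D) :\: Sh) <= q.-1 * nP r D S.
  have eqD : (S :\: cl r D) :\: Sh = (S :\: Sh) :\: cl r D by rewrite !setDDl setUC.
  rewrite eqD; apply: leq_trans (nP_le_mul (y := q.-1) _ _) _; first exact: subset_clU1.
    move=> f /setDP[fS fSh] fD.
    have : nP r (e0 |: C) (S :&: cos r D f) < q.
      by rewrite ltnNge; apply: contra fSh => h; rewrite memSh h fS fD.
    suff : nP r (e0 |: C) ((S :\: Sh) :&: cos r D f) <= nP r (e0 |: C) (S :&: cos r D f).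
      by move: q_gt1; clear; lia.
    by apply: nPS; apply: setSI; apply: subsetDl.
  by rewrite leq_mul2l nPS ?subsetDl ?orbT.
have hK : nP r (e0 |: C) S <= 1 + q.-1 * nP r D S + nP r (e0 |: C) Sh.
  apply: leq_trans (nP_step r (e0 |: C) e S) _; rewrite -/D.
  apply: leq_trans (_ : (nP r (e0 |: C) ((S :\: cl r D) :\: Sh) + nP r (e0 |: C) Sh).+1 <= _).
    rewrite ltnS; apply: leq_trans (nP_splitD r _ _ Sh) _.
    by rewrite leq_add2l nPS // subsetIr.
  by move: hlo; clear; lia.
move: hSh hS' hK; rewrite (cork_U1 eC) -/D /sp !expnS.
move: (cork r D) (nP _ _ _) (nP _ _ _) (nP _ _ _) => k K1 K2 K3.
have h2 : 2 ^ k <= q.*2.-1 ^ k by case: k => // k; rewrite leq_exp2r //; move: q_gt1; clear; lia.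
have [x hx] : exists x, q = x.+2 by exists q.-2; move: q_gt1; clear; lia.
have -> : q.*2.-1 = x.*2.+3 by rewrite hx; clear; lia.
have -> : q.-1 = x.+1 by rewrite hx.
have {}h2 : 2 ^ k <= x.*2.+3 ^ k by move: h2; rewrite hx (_ : x.+2.*2.-1 = x.*2.+3) //; clear; lia.
move: (2 ^ k) (x.*2.+3 ^ k) h2 => a b hab h3 h4 h5.
apply: leq_trans (_ : 2 * a * (1 + x.+1 * K2 + K3) <= _); first by rewrite leq_mul2l h5 orbT.
(* With X = 2q - 1, one of the X copies of (1 + B1) X^(k+1) pays for the sparse part and the added
   one; the other X - 1 = 2 (q - 1) copies pay for the short lines. *)
have -> : (1 + B1) * x.*2.+3 * (x.*2.+3 * b) =
  B1 * (x.*2.+3 * b) + (x.*2.+2 * ((1 + B1) * x.*2.+3 * b) + x.*2.+3 * b) by clear; nia.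
have -> : 2 * a * (1 + x.+1 * K2 + K3) = 2 * a * K3 + (x.*2.+2 * (a * K2) + 2 * a) by clear; nia.
apply: leq_add => //; apply: leq_add; first by rewrite leq_mul2l h4 orbT.
by apply: leq_mul.
Qed.

Lemma submember_refl T r e0 y (C S : {set T}) : pointed r e0 y C S -> submember r e0 C S C S.
Proof. by move=> [U h1 h2 h3]; split; rewrite ?sub_cl. Qed.

(* The members violating the conclusion form a closed class, which would be unbounded. *)
Lemma apex_dense y0 Y Q : closed_class y0 Q ->
  (forall Q', closed_class y0 Q' -> unbounded Q' -> has_apex Q' Y) ->
  forall B, exists B', forall T r e0 C S, Q T r e0 C S -> dense r e0 B' C S ->
    exists C2 S2 e, [/\ submember r e0 C S C2 S2, apex r e0 Y C2 S2 e & dense r e0 B C2 S2].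
Proof.
move=> [hp hs] hY B.
pose Q1 : class := fun T r e0 C S => Q T r e0 C S /\
  ~ exists C2 S2 e, [/\ submember r e0 C S C2 S2, apex r e0 Y C2 S2 e & dense r e0 B C2 S2].
have [hu|/not_unbounded[B' hB']] := classic (unbounded Q1); last first.
  exists B' => T r e0 C S hQ hd; apply: NNPP => h; have : Q1 T r e0 C S by [].
  by move/hB'; rewrite hd.
have cQ1 : closed_class y0 Q1.
  split=> [T r e0 C S [h _]|T r e0 C S C2 S2 [h1 h2] sm]; first exact: hp.
  split; first exact: hs sm.
  move=> [C3 [S3 [e [k1 k2 k3]]]]; apply: h2; exists C3, S3, e; split=> //.
  exact: submember_trans k1.
have [T [r [e0 [C [S [[[hQ hn] [e he]] hd]]]]]] := hY Q1 cQ1 hu B.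
case: hn; exists C, S, e; split=> //; exact: submember_refl (hp _ _ _ _ _ hQ).
Qed.

(** * Towers of apexes *)

Section Chains.
Variables (T : finType) (r : rankfun T).
Implicit Types (A C D F G H K X Z S : {set T}) (e f g p u x : T) (B y : nat) (L : seq T).
Notation cl := (cl r).
Notation nP := (nP r).
Notation cos := (cos r).

Definition ext D L := foldr (fun e X => e |: X) D L.

Lemma ext_U1 e D L : ext (e |: D) L = e |: ext D L.
Proof. by elim: L => //= f L ->; rewrite setUCA. Qed.

Lemma sub_ext D L : D \subset ext D L.
Proof. by elim: L => //= e L h; rewrite (subset_trans h) // subsetUr. Qed.

Lemma rf_ext D L : r (ext D L) <= r D + size L.
Proof.
elim: L => /= [|e L h]; first by rewrite addn0.
by apply: leq_trans (rfU1 r _ _) _; rewrite addnS ltnS.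
Qed.

Lemma ext_subcl D D' L : D \subset cl D' -> ext D L \subset cl (ext D' L).
Proof. by move=> s; elim: L => //= e L; apply: subU1cl. Qed.

Fixpoint apexes Y D S L := if L is e :: L' then
  [/\ e \notin cl (ext D L'), forall f, f \in S -> f \notin cl (ext D L) ->
      Y <= nP (ext D L') (S :&: cos (ext D L) f) & apexes Y D S L'] else True.

Lemma apexes_rank Y D S L : apexes Y D S L -> r (ext D L) = r D + size L.
Proof. by elim: L => [_|e L IH [h1 h2 h3]] /=; rewrite ?addn0 // rf_notin_cl // IH // addnS. Qed.

Lemma apexes_mono Y D D' S S2 L : apexes Y D S L -> D \subset cl D' ->
  r (ext D' L) = r D' + size L -> S2 \subset S -> (forall f, f \in S2 -> f \notin cl (ext D' L)) ->
  (forall f g, f \in S2 -> g \in S -> g \in cos (ext D L) f -> g \in S2) ->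
  apexes Y D' S2 L.
Proof.
move=> + sD + sS; elim: L => //= e L IH [h1 h2 h3] rk av sat.
have le := rf_ext D' L; have le' := rfU1 r e (ext D' L).
have eL : e \notin cl (ext D' L).
  by rewrite clE; apply/eqP=> h; move: le; rewrite -h rk; clear; lia.
have sL : ext D L \subset cl (ext D' L) by apply: ext_subcl.
have sL' := subU1cl e sL.
split=> //.
  move=> f fS2 fL; apply: (line_inherit sL eL fL _ (h2 f _ _)).
  - by apply/subsetP=> g /setIP[gS gf]; apply: sat gf.
  - exact: (subsetP sS).
  - exact: notin_sub sL' fL.
apply: IH => //.
- by rewrite rf_notin_cl // addnS in rk; case: rk.
- by move=> f fS2; apply: contra (av f fS2); apply/subsetP/sub_clU1.
move=> f g fS2 gS gf; apply: (sat f) => //; apply: cos_mono gf; first exact: subset_clU1.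
exact: notin_sub sL' (av f fS2).
Qed.

Definition chain (Q : class) Y e0 C S L := [/\ Q T r e0 C S, apexes Y (e0 |: C) S L &
  forall f, f \in S -> f \notin cl (ext (e0 |: C) L)].

Lemma chain_submember Q y0 Y e0 C S L C2 S2 : closed_class y0 Q -> chain Q Y e0 C S L ->
  C \subset cl C2 -> r (ext (e0 |: C2) L) = r C2 + (size L).+1 -> S2 \subset S ->
  (forall f, f \in S2 -> f \notin cl (ext (e0 |: C2) L)) ->
  (forall f g, f \in S2 -> g \in S -> g \in cos (ext (e0 |: C) L) f -> g \in S2) ->
  chain Q Y e0 C2 S2 L.
Proof.
move=> [hp hs] [hQ ha hd] sC rk sS av sat.
have le := rf_ext (e0 |: C2) L.
have e0C : e0 \notin cl C2.
  by rewrite clE; apply/eqP=> h; move: le; rewrite h rk; clear; lia.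
have sD := subU1cl e0 sC.
have av' f : f \in S2 -> f \notin cl (e0 |: C2).
  by move=> fS2; apply: notin_sub (av f fS2); rewrite (subset_trans (sub_ext _ L)) // sub_cl.
split=> //.
- apply: hs hQ _; split=> // f g fS2 gS gf; apply: (sat f) => //; apply: cos_mono gf.
    by rewrite (subset_trans (sub_ext _ L)) // sub_cl.
  by apply: hd; apply: (subsetP sS).
apply: apexes_mono ha sD _ sS av sat.
by rewrite rk rf_notin_cl // addnS.
Qed.

Lemma chain_rank Q y0 Y e0 C S L : closed_class y0 Q -> chain Q Y e0 C S L ->
  [/\ no_long_line r l, e0 \notin cl C, r (ext (e0 |: C) L) = r C + (size L).+1 &
   e0 \notin cl (ext C L) /\ r (ext C L) = r C + size L].
Proof.
move=> [hp hs] [hQ ha _]; have [U e0C _ _] := hp _ _ _ _ _ hQ.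
have rk : r (ext (e0 |: C) L) = r C + (size L).+1.
  by rewrite (apexes_rank ha) rf_notin_cl // addnS.
have le := rf_ext C L; have le' := rfU1 r e0 (ext C L); rewrite ext_U1 in rk.
split=> //; first by rewrite ext_U1.
split; first by rewrite clE; apply/eqP=> h; move: le rk; rewrite h; clear; lia.
by move: le le' rk; clear; lia.
Qed.

End Chains.

(* The new base must not span the old apexes L, hence the relative basis K of C2 over C. *)
Lemma chain_grow y0 Y Q : closed_class y0 Q ->
  (forall Q', closed_class y0 Q' -> unbounded Q' -> has_apex Q' Y) ->
  forall B, exists B', forall T (r : rankfun T) e0 C S L, chain r Q Y e0 C S L ->
    dense r e0 B' (ext C L) S ->
    exists C2 S2 e, chain r Q Y e0 C2 S2 (e :: L) /\ dense r e0 B (ext C2 (e :: L)) S2.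
Proof.
move=> cQ hY B; have [B' hB'] := apex_dense cQ hY (2 + 2 * l * B).
exists B' => T r e0 C S L hch hd; have [U e0C rk [e0L rk']] := chain_rank cQ hch.
have [hQ ha av] := hch; have [hp hs] := cQ.
have sm : submember r e0 C S (ext C L) S.
  by split=> //; [rewrite (subset_trans (sub_ext C L)) ?sub_cl | move=> f; rewrite -ext_U1; apply: av].
have hQL := hs _ _ _ _ _ _ _ hQ sm.
have [C2 [S2 [e [sm2 [eC2 ap] hd2]]]] := hB' _ _ _ _ _ hQL hd.
have [sL2 e0C2 sS2 av2 sat2] := sm2.
have [K [sCK sKC rKL rK]] := rel_basis r (cl r C2) (sub_ext C L).
have sKC2 : K \subset cl r C2.
  rewrite (subset_trans sKC) // subUset subxx andbT.
  by rewrite (subset_trans (sub_ext C L)).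
have eKL : ext K L = K :|: ext C L.
  apply/eqP; rewrite eqEsubset; apply/andP; split.
    elim: (L) => [|f L' IH] /=; first exact: subsetUl.
    by rewrite setUCA setUS.
  by rewrite subUset sub_ext; elim: (L) => [|f L' IH] //=; apply: setUS.
have clKL : cl r (ext K L) = cl r C2.
  apply: cl_eq_rank; rewrite eKL; first by rewrite subUset sKC2.
  by rewrite rKL -(rf_cl r C2); apply/rfS/subsetUl.
have sKL : ext K L \subset cl r C2 by rewrite -clKL sub_cl.
have sKL' : C2 \subset cl r (ext K L) by rewrite clKL sub_cl.
have cle0 : cl r (ext (e0 |: K) L) = cl r (e0 |: C2).
  by rewrite ext_U1; apply: eq_cl; apply: subU1cl.
have rKL2 : r (ext (e0 |: K) L) = r K + (size L).+1.
  rewrite -rf_cl cle0 rf_cl rf_notin_cl // -(rf_cl r C2) -clKL rf_cl eKL.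
  by move: rK; rewrite rk'; clear; lia.
set S3 := S2 :\: cl r (e |: (e0 |: C2)).
have h3 f : f \in S3 -> [/\ f \in S2, f \in S & f \notin cl r (e |: (e0 |: C2))].
  by case/setDP=> fS2 h; split=> //; apply: (subsetP sS2).
have cle : cl r (ext (e0 |: K) (e :: L)) = cl r (e |: (e0 |: C2)).
  by rewrite /= -clU1_cl cle0 clU1_cl.
have sat3 f g : f \in S3 -> g \in S -> g \in cos r (ext (e0 |: C) L) f -> g \in S3.
  move=> fS3 gS gf; have [fS2 fS fe] := h3 _ fS3; rewrite inE; rewrite ext_U1 in gf.
  rewrite (sat2 _ _ fS2 gS gf) andbT.
  have gf2 : g \in cos r (e |: (e0 |: C2)) f.
    apply: cos_mono gf => //; rewrite (subset_trans _ (sub_clU1 _ _ _)) //.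
    exact: subU1cl.
  by have /setDP[] := gf2.
exists K, S3, e; split; last first.
  rewrite /dense /= setUCA -ext_U1.
  have := dense_U1 U eC2 hd2; rewrite /dense setUCA -/S3.
  rewrite -(nP_cl r (e |: ext (e0 |: K) L)) -[cl _ (e |: ext _ _)]/(cl r (ext (e0 |: K) (e :: L))) cle nP_cl.
  by rewrite -(cork_cl r (e |: ext (e0 |: K) L)) -[cl _ (e |: ext _ _)]/(cl r (ext (e0 |: K) (e :: L))) cle cork_cl.
have [] : chain r Q Y e0 K S3 L.
  apply: chain_submember cQ hch _ _ _ _ _ => //.
  - by rewrite (subset_trans sCK) // sub_cl.
  - by rewrite (subset_trans _ sS2) // subsetDl.
  - by move=> f /h3[fS2 _ _]; rewrite cle0; apply: av2.
move=> k1 k2 k3; split=> //; last by move=> f /h3[_ _ fe]; rewrite cle.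
split=> //; first by rewrite cle0.
move=> f fS3; have [fS2 fS fe] := h3 _ fS3; rewrite cle => _.
have := ap f fS2 fe.
rewrite -nP_cl -cle0 nP_cl => /leq_trans; apply; apply: nPS.
have ecos g : cos r (ext (e0 |: K) (e :: L)) g = cos r (e |: (e0 |: C2)) g.
  by rewrite /Closure.cos cle -clU1_cl cle clU1_cl.
rewrite ecos subsetI subsetIr andbT; apply/subsetP=> g /setIP[gS2 /setDP[_ ge]].
by rewrite inE ge gS2.
Qed.

Lemma dense_le T (r : rankfun T) e0 B B' C S : B <= B' -> dense r e0 B' C S -> dense r e0 B C S.
Proof. by move=> le; apply: contra; apply: sp_mono. Qed.

Lemma chain_exists y0 Y Q m B : closed_class y0 Q -> unbounded Q ->
  (forall Q', closed_class y0 Q' -> unbounded Q' -> has_apex Q' Y) ->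
  exists T (r : rankfun T) e0 C S L,
    [/\ chain r Q Y e0 C S L, size L = m & dense r e0 B (ext C L) S].
Proof.
move=> cQ hu hY; elim: m B => [|m IH] B.
  have [T [r [e0 [C [S [hQ hd]]]]]] := hu B; exists T, r, e0, C, S, [::]; split=> //.
  by split=> //; have [] := (cQ.1 _ _ _ _ _ hQ).
have [B' hB'] := chain_grow cQ hY B; have [T [r [e0 [C [S [L [hch sL hd]]]]]]] := IH B'.
have [C2 [S2 [e [h1 h2]]]] := hB' _ _ _ _ _ _ hch hd.
by exists T, r, e0, C2, S2, (e :: L); split=> //=; rewrite sL.
Qed.

(** For f off the flat spanned by e0 and L, contracting f keeps its points distinct. Stability says
    that no point is added, which through [stable_meet] supplies hypothesis [h3] of the affine
    count. *)
Definition stable T (r : rankfun T) e0 C (S : {set T}) L := forall f, f \in S ->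
  nP r (f |: C) (cl r (ext (e0 |: (f |: C)) L)) <= nP r C (cl r (ext (e0 |: C) L)).

(** An f violating stability is contracted, which raises a number of points that never exceeds (l +
    1)^(size L + 1); n bounds the rises left. *)
Lemma chain_stable_step y0 Y Q n B : closed_class y0 Q -> exists B', forall T (r : rankfun T) e0 C S L,
  chain r Q Y e0 C S L -> l.+1 ^ (size L).+1 - nP r C (cl r (ext (e0 |: C) L)) <= n ->
  dense r e0 B' (ext C L) S -> exists C2 S2,
  [/\ chain r Q Y e0 C2 S2 L, dense r e0 B (ext C2 L) S2 & stable r e0 C2 S2 L].
Proof.
move=> cQ; elim: n => [|n [B2 IH]].
  exists B => T r e0 C S L hch hN hd; exists C, S; split=> // f fS.
  have [U e0C rk [e0L rk']] := chain_rank cQ hch; have [_ _ av] := hch.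
  apply: leq_trans (_ : l.+1 ^ (size L).+1 <= _); last by move: hN; clear; lia.
  have fL := av f fS; have fC : f \notin cl r C.
    by apply: notin_sub fL; rewrite (subset_trans _ (sub_cl _ _)) // ext_U1 (subset_trans (sub_ext C L)) // subsetUr.
  apply: nP_bound => //; rewrite (setUidPl _); last first.
    by rewrite (subset_trans _ (sub_cl _ _)) // (subset_trans _ (sub_ext _ _)) // subsetUr.
  by rewrite rf_cl (setUCA [set e0]) ext_U1 (rf_notin_cl fL) (rf_notin_cl fC) rk addSn.
exists (maxn B (2 + 2 * l * B2)) => T r e0 C S L hch hN hd.
have [/forall_inP hst|/forall_inPn[f fS]] := boolP [forall f in S,
  nP r (f |: C) (cl r (ext (e0 |: (f |: C)) L)) <= nP r C (cl r (ext (e0 |: C) L))].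
  by exists C, S; split=> //; apply: dense_le hd; rewrite leq_maxl.
rewrite -ltnNge => lt.
have [U e0C rk [e0L rk']] := chain_rank cQ hch; have [_ _ av] := hch.
have fL := av f fS; have fC : f \notin cl r C.
  by apply: notin_sub fL; rewrite (subset_trans _ (sub_cl _ _)) // ext_U1 (subset_trans (sub_ext C L)) // subsetUr.
have [|||C2 [S2 h]] := IH T r e0 (f |: C) (S :\: cl r (f |: (e0 |: ext C L))) L; last by exists C2, S2.
- apply: chain_submember cQ hch _ _ _ _ _.
  + exact: subset_clU1.
  + by rewrite (setUCA [set e0]) ext_U1 (rf_notin_cl fL) (rf_notin_cl fC) rk addSn.
  + exact: subsetDl.
  + by move=> g /setDP[_]; rewrite setUCA !ext_U1.
  move=> g g' /setDP[gS gf] g'S g'g; rewrite in_setD g'S andbT.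
  rewrite ext_U1 in g'g; have /setDP[] := cos_mono (subset_clU1 _ _ _) gf g'g.
  by [].
- by move: hN lt; clear; lia.
rewrite ext_U1; apply: dense_U1 => //; first by rewrite -ext_U1.
by apply: dense_le hd; rewrite leq_maxr.
Qed.

Lemma chain_stable y0 Y Q m B : closed_class y0 Q -> unbounded Q ->
  (forall Q', closed_class y0 Q' -> unbounded Q' -> has_apex Q' Y) ->
  exists T (r : rankfun T) e0 C S L, [/\ chain r Q Y e0 C S L, size L = m,
    dense r e0 B (ext C L) S & stable r e0 C S L].
Proof.
move=> cQ hu hY; have [B' hB'] := chain_stable_step Y (l.+1 ^ m.+1) B cQ.
have [T [r [e0 [C [S [L [h1 h2 h3]]]]]]] := chain_exists m B' cQ hu hY.
have [|C2 [S2 [k1 k2 k3]]] := hB' _ _ _ _ _ _ h1 _ h3; first by rewrite h2 leq_subr.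
by exists T, r, e0, C2, S2, L.
Qed.

(** Projection from p embeds the points of A over C, and the assumed inequality makes it onto, so
    the line p p' is the image of a point u of A. *)
Lemma stable_meet T (r : rankfun T) (C A : {set T}) p p' : is_flat r A -> C \subset A -> p \notin A ->
  nP r (p |: C) (cl r (p |: A)) <= nP r C A -> p' \in cl r (p |: A) -> p' \notin cl r (p |: C) ->
  exists2 u, u \in A /\ u \notin cl r C & u \in cl r (p' |: (p |: C)).
Proof.
move=> Af sCA pA hst p'A p'C.
have meet a b : a \in A -> b \in A -> b \in cl r (a |: (p |: C)) -> b \in cl r (a |: C).
  move=> aA bA hb; apply: (cl_meet Af (flat_cl _ _) _ pA bA); last by rewrite clU1_cl setUCA.
  by apply: flat_U1.
pose h G := cl r (G :|: (p |: C)).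
have hE a : h (cl r (a |: C)) = cl r (a |: (p |: C)).
  by rewrite /h clU_cl -setUA (setUidPr (subsetUr _ _)).
have inj : {in pts r C A &, injective h}.
  move=> F1 F2 /ptsP[a [aA aC] ->] /ptsP[b [bA bC] ->]; rewrite !hE => eab.
  by symmetry; apply: cl_exchange => //; apply: meet; rewrite // eab mem_clU1.
have img : h @: pts r C A = pts r (p |: C) (cl r (p |: A)).
  apply/eqP; rewrite eqEcard card_in_imset // -/(nP r _ _) -/(nP r C A) hst andbT.
  apply/subsetP=> _ /imsetP[_ /ptsP[a [aA aC] ->] ->]; rewrite hE.
  apply: mem_pts; first by apply: (subsetP (subset_clU1 _ _ _)).
  apply: contra aC => hp; have := @cl_meet T r A (cl r C) p a Af (flat_cl _ _).
  by rewrite flat_sub // clU1_cl; apply.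
have : cl r (p' |: (p |: C)) \in h @: pts r C A by rewrite img; apply: mem_pts.
case/imsetP=> _ /ptsP[u [uA uC] ->]; rewrite hE => e; exists u => //.
by rewrite e mem_clU1.
Qed.

(* The elements p on a line that is longer than Lemma [line_card] allows. *)
Definition bad T (r : rankfun T) e0 y0 Y (S Z G : {set T}) := [set p in S |
  mult e0 y0 Y Z G < nP r Z (S :&: (cl r (p |: G) :\: G))].

(** Bad elements form a configuration that is too good to be dense: with an apex of order Y + 1 when
    e0 is in Z, and pointed of order y0 + 1 when e0 is in G only. When e0 is not in G, contracting
    it only lengthens lines and leads back to the first case. *)
Lemma bad_sparse y0 Y Q B0 B1 T (r : rankfun T) e0 C S L Z G :
  closed_class y0 Q -> chain r Q Y e0 C S L ->
  (forall T r e0 C S, pointed (T := T) r e0 y0.+1 C S -> ~~ dense r e0 B0 C S) ->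
  (forall T r e0 C S, Q T r e0 C S /\ (exists e, apex r e0 Y.+1 C S e) -> ~~ dense r e0 B1 C S) ->
  let A := cl r (ext (e0 |: C) L) in
  is_flat r Z -> is_flat r G -> C \subset Z -> Z \subset G -> G \subset A -> r G = (r Z).+1 ->
  sp q (maxn B0 B1 * q.*2.-1 ^ (size L).+1) (cork r A) (nP r A (bad r e0 y0 Y S Z G)).
Proof.
move=> cQ hch hB0 hB1 A.
have [U e0C rk [e0L rk']] := chain_rank cQ hch; have [hQ _ av] := hch.
have [hp hs] := cQ.
have Af : is_flat r A by apply: flat_cl.
have rA : r A = r C + (size L).+1 by rewrite rf_cl.
have fin Z1 X : is_flat r Z1 -> C \subset Z1 -> Z1 \subset A ->
    sp q (maxn B0 B1) (cork r Z1) (nP r Z1 X) ->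
    sp q (maxn B0 B1 * q.*2.-1 ^ (size L).+1) (cork r A) (nP r A X).
  move=> f1 sC1 s1A h1.
  apply: (sp_mono (leqnn _) (K := nP r Z1 X)); first by apply: nP_contract; rewrite (subset_trans s1A) // sub_cl.
  apply: (@sp_drop _ _ _ (r A - r Z1)) => //.
    by have := rfS r sC1; rewrite rA; clear; lia.
  rewrite (_ : cork r A + _ = cork r Z1) //.
  have := rfS r s1A; have : r A <= r setT by apply/rfS/subsetT.
  by rewrite /cork; clear; lia.
have badP Z1 G1 p : reflect (p \in S /\ mult e0 y0 Y Z1 G1 < nP r Z1 (S :&: (cl r (p |: G1) :\: G1)))
   (p \in bad r e0 y0 Y S Z1 G1) by rewrite inE; apply: andP.
have badsat Z1 G1 f g : is_flat r G1 -> G1 \subset A -> f \in bad r e0 y0 Y S Z1 G1 -> g \in S ->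
    g \in cl r (f |: G1) -> g \in bad r e0 y0 Y S Z1 G1.
  move=> f1 sG1 /badP[fS hf] gS gf; apply/badP; split=> //.
  have gG : g \notin cl r G1 by rewrite notin_flat //; apply: contra (av g gS); apply/subsetP.
  by rewrite (cl_exchange gf gG).
have badA Z1 G1 f : f \in bad r e0 y0 Y S Z1 G1 -> f \notin A by case/badP=> /av.
have main Z1 G1 : is_flat r Z1 -> is_flat r G1 -> C \subset Z1 -> Z1 \subset G1 -> G1 \subset A ->
   r G1 = (r Z1).+1 -> e0 \in Z1 ->
   sp q (maxn B0 B1 * q.*2.-1 ^ (size L).+1) (cork r A) (nP r A (bad r e0 y0 Y S Z1 G1)).
  move=> f1 fG sC1 s1G sGA rG e01; have s1A := subset_trans s1G sGA.
  apply: (fin Z1) => //.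
  have [|u uG uZ] := @ltn_rank_ex T r Z1 G1; first by rewrite rG.
  have uG' : cl r (u |: Z1) = G1.
    apply: (flat_eq (r := r)); rewrite ?flat_cl //; first exact: flat_U1.
    by rewrite rf_cl rf_notin_cl // rG.
  (* A configuration keeps e0 outside the span of its base, so Z1 is written as the closure of e0
     and a base K not spanning e0. *)
  have [K [sCK sK1 rK1 rK]] := rel_basis r Z1 (subsetUr [set e0] C).
  have sK1' : K \subset Z1 by rewrite (subset_trans sK1) // subUset sC1 subxx.
  have eZ : cl r (e0 |: K) = Z1.
    apply: (flat_eq (r := r)); rewrite ?flat_cl //; first exact: flat_U1.
    rewrite rf_cl (_ : e0 |: K = K :|: (e0 |: C)); last by rewrite setUCA (setUidPl sCK).
    by rewrite rK1; apply/rfS/subsetUl.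
  have e0K : e0 \notin cl r K.
    rewrite clE; apply/eqP=> h; move: rK; rewrite (_ : K :|: (e0 |: C) = e0 |: K); last by rewrite setUCA (setUidPl sCK).
    by rewrite h rf_notin_cl //; clear; lia.
  have := hB1 T r e0 K (bad r e0 y0 Y S Z1 G1).
  rewrite /dense negbK -(nP_cl r (e0 |: K)) -(cork_cl r (e0 |: K)) eZ => h.
  apply: sp_mono (leq_maxr _ _) (leqnn _) (h _); split.
    apply: hs hQ _; split=> //.
    - by rewrite (subset_trans sCK) // sub_cl.
    - by apply/subsetP=> f /badP[].
    - by move=> f /badA; rewrite eZ; apply: contra; apply/subsetP.
    move=> f g fb gS gf; apply: (badsat _ _ f) => //; have /setDP[gf' _] := gf.
    apply: subsetP gf'; apply/clS/setUS; rewrite (subset_trans _ s1G) //.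
    by rewrite subUset sub1set e01.
  exists u; split; first by rewrite eZ -(flatE f1).
  move=> f fb _; have [fS] := badP _ _ _ fb; rewrite /mult e01 /= => hlt.
  rewrite -nP_cl eZ; apply: leq_trans hlt _; apply: nPS.
  have -> : cos r (u |: (e0 |: K)) f = cl r (f |: G1) :\: G1.
    have -> : G1 = cl r (u |: (e0 |: K)) by rewrite -uG' -[in LHS]eZ clU1_cl.
    by rewrite /Closure.cos clU1_cl.
  rewrite subsetI subsetIr andbT; apply/subsetP=> g /setIP[gS /setDP[gf _]].
  exact: badsat gf.
move=> fZ fG sCZ sZG sGA rG; have sZA := subset_trans sZG sGA.
have e0A : e0 \in A.
  by apply: mem_cl; apply: (subsetP (sub_ext _ L)); rewrite setU11.
have [e0Z|e0Z] := boolP (e0 \in Z); first exact: main.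
have e0Z' : e0 \notin cl r Z by rewrite notin_flat.
have [e0G|e0G] := boolP (e0 \in G).
  have eG : cl r (e0 |: Z) = G.
    apply: (flat_eq (r := r)); rewrite ?flat_cl //; first exact: flat_U1.
    by rewrite rf_cl rf_notin_cl // rG.
  apply: (fin G) => //; first exact: subset_trans sZG.
  rewrite -eG nP_cl cork_cl.
  apply: (sp_mono (leq_maxl _ _) (leqnn _)); rewrite -[sp _ _ _ _]negbK; apply: hB0; split=> //.
    by move=> f /badA; rewrite eG; apply: contra; apply/subsetP.
  move=> f; rewrite eG => fb; have [fS] := badP _ _ _ fb; rewrite /mult e0Z e0G /= => hlt.
  apply: leq_trans hlt _; apply: nPS.
  have -> : cos r (e0 |: Z) f = cl r (f |: G) :\: G by rewrite /Closure.cos -eG clU1_cl.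
  rewrite subsetI subsetIr andbT; apply/subsetP=> g /setIP[gS /setDP[gf _]].
  exact: badsat gf.
have e0G' : e0 \notin cl r G by rewrite notin_flat.
have [|u uG uZ] := @ltn_rank_ex T r Z G; first by rewrite rG.
have uG' : cl r (u |: Z) = G.
  apply: (flat_eq (r := r)); rewrite ?flat_cl //; first exact: flat_U1.
  by rewrite rf_cl rf_notin_cl // rG.
apply: sp_mono (leqnn _) _ (main (cl r (e0 |: Z)) (cl r (e0 |: G)) _ _ _ _ _ _ _).
- apply: nPS; apply/subsetP=> f fb; have fA := badA _ _ _ fb; have [fS hf] := badP _ _ _ fb; apply/badP; split=> //.
  have hm : mult e0 y0 Y (cl r (e0 |: Z)) (cl r (e0 |: G)) = mult e0 y0 Y Z G.
    by rewrite /mult mem_clU1 /= e0Z (negPf e0G).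
  rewrite hm; apply: leq_trans hf _.
  have eGu : cl r (u |: (e0 |: Z)) = cl r (e0 |: G) by rewrite setUCA -clU1_cl uG'.
  have ue : u \notin cl r (e0 |: Z).
    by apply: contra e0G => h; rewrite -uG'; apply: exchange.
  have fu : f \notin cl r (u |: (e0 |: Z)).
    by rewrite eGu; apply: contra fA; apply/subsetP/flat_U1.
  have := nP_line_mono S (subset_clU1 r e0 Z) ue fu.
  rewrite nP_cl /Closure.cos uG' eGu -[cl r (f |: (u |: Z))]clU1_cl uG'.
  by rewrite -[cl r (f |: (u |: _))]clU1_cl eGu.
- exact: flat_cl.
- exact: flat_cl.
- by rewrite (subset_trans sCZ) // subset_clU1.
- by apply/clS/setUS.
- exact: flat_U1.
- by rewrite !rf_cl !rf_notin_cl // rG.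
- exact: mem_clU1.
Qed.

Lemma flats_card T (r : rankfun T) (C A : {set T}) :
  #|[set F : {set T} | [&& is_flat r F, C \subset F & F \subset A]]| <= 2 ^ nP r C A.
Proof.
rewrite -card_powerset -(card_in_imset (f := fun F : {set T} => pts r C F)).
  apply: subset_leq_card; apply/subsetP=> _ /imsetP[F + ->].
  by rewrite !inE => /and3P[_ _ sFA]; apply: ptsS.
have half (F G : {set T}) : is_flat r F -> C \subset F -> is_flat r G -> C \subset G ->
    pts r C F = pts r C G -> F \subset G.
  move=> Ff sF Gf sG e; apply/subsetP=> x xF.
  have [xC|xC] := boolP (x \in cl r C); first by move: x xC {xF}; apply/subsetP; rewrite flat_sub.
  have : cl r (x |: C) \in pts r C G by rewrite -e; apply: mem_pts.
  case/ptsP=> y [yG yC] exy; have : x \in cl r (y |: C) by rewrite -exy mem_clU1.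
  by apply/subsetP/flat_U1.
move=> F G; rewrite !inE => /and3P[Ff sF _] /and3P[Gf sG _] e; apply/eqP.
by rewrite eqEsubset (half F G) // (half G F).
Qed.

Lemma nP_bigcup (I : finType) T (r : rankfun T) (A : {set T}) (P : {set I}) (F : I -> {set T}) :
  nP r A (\bigcup_(i in P) F i) <= \sum_(i in P) nP r A (F i).
Proof.
elim/big_rec2: _ => [|i n X _ h]; first by rewrite nP0 ?sub0set.
by apply: leq_trans (nPU _ _ _ _) _; rewrite leq_add2l.
Qed.

(** The lower bounds Y of the apexes multiply along the tower; with the bound y0 at e0 this yields
    hypothesis [h2] of the affine count. *)
Lemma chain_lower T (r : rankfun T) Y (D S P : {set T}) L : apexes r Y D S L -> P \subset S ->
  (forall p, p \in P -> p \notin cl r (ext D L)) ->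
  (forall p, p \in P -> S :&: cos r (ext D L) p \subset P) ->
  Y ^ size L * nP r (ext D L) P <= nP r D P.
Proof.
move=> + sPS; elim: L => [|e L IH] /=; first by rewrite mul1n.
move=> [eL hL ha] av sat; rewrite expnSr -mulnA.
have sub : ext D L \subset cl r (e |: ext D L) by apply: subset_clU1.
apply: leq_trans (IH ha _ _).
- rewrite leq_mul2l; apply/orP; right; rewrite -[X in _ <= X]nPD.
  apply: leq_trans (nP_ge_mul (y := Y) sub _) _.
    move=> f fP fe; apply: leq_trans (hL f (subsetP sPS _ fP) fe) _.
    by apply: nPS; rewrite subsetI sat // subsetIr.
  rewrite nPD; exact: nPS (subsetDl _ _).
- by move=> p pP; apply: contra (av p pP); apply/subsetP/sub_clU1.
move=> p pP; apply: subset_trans (sat p pP); apply: setIS.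
by apply/subsetP=> g; apply: cos_mono => //; apply: av.
Qed.

(** There are boundedly many pairs (Z, G) between C and A, and the bad elements of each are sparse,
    so density leaves a point of M/A without bad elements. There the caps [h1] hold and the affine
    count determines the lines inside A. *)
Lemma star_config y0 Y Q B0 B1 m : closed_class y0 Q -> unbounded Q ->
  (forall Q', closed_class y0 Q' -> unbounded Q' -> has_apex Q' Y) ->
  (forall T r e0 C S, pointed (T := T) r e0 y0.+1 C S -> ~~ dense r e0 B0 C S) ->
  (forall T r e0 C S, Q T r e0 C S /\ (exists e, apex r e0 Y.+1 C S e) -> ~~ dense r e0 B1 C S) ->
  0 < y0 -> 1 < Y ->
  exists (T : finType) (r : rankfun T) e0 C L,
  let A := cl r (ext (e0 |: C) L) in
  [/\ no_long_line r l, is_flat r C, size L = m, r A = r C + m.+1 &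
  forall Z Z2, is_flat r Z -> is_flat r Z2 -> C \subset Z -> Z \subset Z2 -> Z2 \subset A ->
    r Z2 = (r Z).+2 -> (e0 \notin Z2 -> nP r Z Z2 = Y.+1) /\
    (e0 \notin Z -> e0 \in Z2 -> nP r Z Z2 = y0.+1)].
Proof.
move=> cQ hu hY hB0 hB1 y00 Y1.
(* M is the sparsity constant of one bad set and N bounds the number of flats between C and A, so N
   * N bounds the pairs. *)
pose M := maxn B0 B1 * q.*2.-1 ^ m.+1.
pose N := 2 ^ (l.+1 ^ m.+1).
have [T [r [e0 [C [S [L [hch sL hd hst]]]]]]] := chain_stable m (N * N * M) cQ hu hY.
exists T, r, e0, (cl r C), L.
have [U e0C rk [e0L rk']] := chain_rank cQ hch; have [hQ ha av] := hch.
have [_ _ _ hpt] := (cQ.1 _ _ _ _ _ hQ).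
have eA : cl r (ext (e0 |: cl r C) L) = cl r (ext (e0 |: C) L).
  apply: eq_cl; apply: ext_subcl; apply: subU1cl; first exact: subxx.
  by rewrite (subset_trans (sub_cl r C)) // sub_cl.
rewrite eA; set A := cl r (ext (e0 |: C) L) => /=.
have Af : is_flat r A by apply: flat_cl.
have rA : r A = r C + m.+1 by rewrite rf_cl rk sL.
have sCA : C \subset A.
  rewrite (subset_trans _ (sub_cl _ _)) // (subset_trans _ (sub_ext _ _)) //; exact: subsetUr.
have e0A : e0 \in A.
  by apply: mem_cl; apply: (subsetP (sub_ext _ L)); rewrite setU11.
pose FL := [set F : {set T} | [&& is_flat r F, cl r C \subset F & F \subset A]].
have cFL : #|FL| <= N.
  apply: leq_trans (flats_card r _ _) _; rewrite leq_exp2l //; apply: nP_bound => //.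
  by rewrite rf_cl -rA (setUidPl _) // flat_sub.
pose V := [set ZG : {set T} * {set T} | [&& ZG.1 \in FL, ZG.2 \in FL, ZG.1 \subset ZG.2 & r ZG.2 == (r ZG.1).+1]].
have cV : #|V| <= N * N.
  apply: leq_trans (_ : #|setX FL FL| <= _); last by rewrite cardsX leq_mul.
  by apply: subset_leq_card; apply/subsetP=> -[Z G]; rewrite !inE /= => /and4P[-> ->].
pose W := \bigcup_(ZG in V) bad r e0 y0 Y S ZG.1 ZG.2.
have spW : sp q (N * N * M) (cork r A) (nP r A W).
  apply: (sp_mono (B := #|V| * M) _ (nP_bigcup r A V _)); first by rewrite leq_mul2r cV orbT.
  apply: sp_sum.
  move=> [Z G]; rewrite !inE /= => /and4P[/and3P[fZ sCZ sZA] /and3P[fG sCG sGA] sZG /eqP rG].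
  rewrite /M -sL; apply: (bad_sparse cQ hch hB0 hB1) => //; by rewrite -(flat_sub _ fZ).
have {hd} : ~~ (pts r A S \subset pts r A W).
  apply: contra hd => /subset_leq_card h; rewrite /sp -ext_U1 -nP_cl -cork_cl -/A.
  by apply: leq_trans spW; rewrite leq_mul2l [X in _ || X]h orbT.
case/subsetPn=> F /ptsP[f [fS fA] ->] fW.
pose P := S :&: cl r (f |: A).
have PA p : p \in P -> p \notin A by case/setIP=> /av.
have Pcl p : p \in P -> cl r (p |: A) = cl r (f |: A).
  by move=> pP; apply: cl_exchange; [case/setIP: pP | rewrite notin_flat // PA].
have Pl p p' : p \in P -> p' \in P -> p' \in cl r (p |: A).
  by move=> pP /setIP[_]; rewrite (Pcl p).
have h1 Z u p : is_flat r Z -> cl r C \subset Z -> Z \subset A -> u \in A -> u \notin Z -> p \in P ->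
    nP r Z (P :&: cl r (p |: (u |: Z))) <= mult e0 y0 Y Z (cl r (u |: Z)).
  move=> fZ sCZ sZA uA uZ pP; set G := cl r (u |: Z).
  have sGA : G \subset A by apply: flat_U1.
  have inV : (Z, G) \in V.
    by rewrite !inE /= fZ sCZ sZA flat_cl sGA subset_clU1 (subset_trans sCZ) ?subset_clU1 //= rf_cl rf_notin_cl ?notin_flat.
  rewrite leqNgt; apply: contra fW => lt; rewrite -(Pcl p pP); apply: mem_pts; last first.
    by rewrite notin_flat // PA.
  apply/bigcupP; exists (Z, G) => //; have [pS _] := setIP pP; rewrite inE pS /=.
  apply: leq_trans lt _; apply: nPS; apply/subsetP=> g /setIP[gP gp].
  have [gS _] := setIP gP; rewrite in_setI gS in_setD (contra _ (PA g gP)) /=; last exact: (subsetP sGA).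
  by rewrite clU1_cl.
have sPS : P \subset S by apply: subsetIl.
have satP (D : {set T}) p : D \subset A -> p \in P -> S :&: cos r D p \subset P.
  move=> sDA pP; apply: setIS; apply: subset_trans (subsetDl _ _) _.
  by rewrite -(Pcl p pP); apply/clS/setUS.
have h2 : wt r (cl r C) e0 y0 Y A <= nP r (cl r C) P.
  rewrite /wt e0A rf_cl rA addKn /= nP_cl.
  have hY2 := chain_lower ha sPS PA (fun p => satP _ p (sub_cl _ _)).
  have hy2 : y0 * nP r (e0 |: C) P <= nP r C P.
    rewrite -[X in _ <= X]nPD; apply: leq_trans (nP_ge_mul (y := y0) (subset_clU1 _ _ _) _) _.
      move=> g gP _; apply: leq_trans (hpt g (subsetP sPS _ gP)) _; apply: nPS.
      by rewrite subsetI subsetIr andbT satP // subUset sub1set e0A.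
    rewrite nPD; exact: nPS (subsetDl _ _).
  apply: leq_trans hy2; rewrite leq_mul2l; apply/orP; right; apply: leq_trans hY2.
  rewrite sL leq_pmulr // (@nP_gt0 _ _ _ _ f) // ?inE ?fS ?mem_clU1 //.
  exact: av.
have h3 p p' : p \in P -> p' \in P -> p' \notin cl r (p |: cl r C) ->
    exists2 u, u \in A /\ u \notin cl r C & u \in cl r (p' |: (p |: cl r C)).
  move=> pP p'P; rewrite clU1_cl => p'C.
  have [pS _] := setIP pP; have := hst p pS.
  rewrite (setUCA [set e0]) ext_U1 -[cl r (p |: ext _ _)]clU1_cl => hp.
  have [u hu1 hu2] := stable_meet Af sCA (PA p pP) hp (Pl _ _ pP p'P) p'C.
  by exists u => //; apply: subsetP hu2; apply/clS/setUS/setUS/sub_cl.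
have sCA' : cl r C \subset A by rewrite flat_sub.
split=> //; try exact: flat_cl; first by rewrite rf_cl.
move=> Z Z2 fZ fZ2 sCZ sZ sZA rZ2; split=> [e0Z2|e0Z e0Z2].
  exact: (line_card (flat_cl _ _) Af sCA' e0C PA Pl h1 h2 h3 y00 Y1).
exact: (line_card_apex (flat_cl _ _) Af sCA' e0C PA Pl h1 h2 h3 y00 Y1).
Qed.

Lemma nP_notin T (r : rankfun T) (C A : {set T}) p : is_flat r C -> is_flat r A -> C \subset A ->
  p \notin A -> nP r C A <= nP r (p |: C) A.
Proof.
move=> Cf Af sCA pA; pose h G := cl r (G :|: (p |: C)).
have hE a : h (cl r (a |: C)) = cl r (a |: (p |: C)).
  by rewrite /h clU_cl -setUA (setUidPr (subsetUr _ _)).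
have inj : {in pts r C A &, injective h}.
  move=> F1 F2 /ptsP[a [aA aC] ->] /ptsP[b [bA bC] ->]; rewrite !hE => eab.
  symmetry; apply: cl_exchange => //; apply: (cl_meet Af (flat_cl _ _) _ pA bA).
    exact: flat_U1.
  by rewrite clU1_cl setUCA eab mem_clU1.
rewrite /Closure.nP -(card_in_imset inj); apply: subset_leq_card.
apply/subsetP=> _ /imsetP[_ /ptsP[a [aA aC] ->] ->]; rewrite hE; apply: mem_pts => //.
by apply: contra aC => h'; apply: mem_cl; apply: (cl_meet Af Cf sCA pA aA).
Qed.

(** The span of e1, ..., e4 avoids e0 and is a projective 3-space of order Y <= l, so Y = q. As
    lines through e0 are longer than the line N = e1 e2, some line v w with v on e0 e1 and w on e0
    e2 misses N, hence also the plane Pi of e1, e2, e3. Contracting v w makes Pi a line with more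
    than q^2 points. *)
Lemma apex_contra T (r : rankfun T) e0 (C : {set T}) L y0 Y :
  let A := cl r (ext (e0 |: C) L) in
  no_long_line r l -> is_flat r C -> size L = 4 -> r A = r C + 5 ->
  (forall Z Z2, is_flat r Z -> is_flat r Z2 -> C \subset Z -> Z \subset Z2 -> Z2 \subset A ->
    r Z2 = (r Z).+2 -> (e0 \notin Z2 -> nP r Z Z2 = Y.+1) /\
    (e0 \notin Z -> e0 \in Z2 -> nP r Z Z2 = y0.+1)) ->
  q <= Y -> q < y0 -> False.
Proof.
case: L => [|e4 [|e3 [|e2 [|e1 [|e5 L]]]]] A U Cf //= _ rA hA qY qy.
have Af : is_flat r A by apply: flat_cl.
have ind (e : T) (X : {set T}) n k : r X <= n -> n < k -> r (e |: X) = k -> r X = n /\ e \notin cl r X.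
  move=> h1 h2 h3; have h4 := rfU1 r e X; split; first by move: h1 h2 h3 h4; clear; lia.
  by apply/negP=> /rf_in_cl h; move: h h1 h2 h3; clear; lia.
have rU X e n : r X <= n -> r (e |: X) <= n.+1 by move=> h; apply: leq_trans (rfU1 r _ _) _.
have mA x : x \in e4 |: (e3 |: (e2 |: (e1 |: (e0 |: C)))) -> x \in A by apply: mem_cl.
have e0A : e0 \in A by apply: mA; rewrite !inE eqxx !orbT.
have e1A : e1 \in A by apply: mA; rewrite !inE eqxx !orbT.
have e2A : e2 \in A by apply: mA; rewrite !inE eqxx !orbT.
have e3A : e3 \in A by apply: mA; rewrite !inE eqxx !orbT.
have e4A : e4 \in A by apply: mA; rewrite setU11.
have sCA : C \subset A by rewrite /A /= (subset_trans _ (sub_cl _ _)) // !setUA subsetUr.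
rewrite /A rf_cl /= in rA.
have r0 : r C <= r C by [].
have [r5 e0n] : r (e4 |: (e3 |: (e2 |: (e1 |: C)))) = r C + 4 /\
    e0 \notin cl r (e4 |: (e3 |: (e2 |: (e1 |: C)))).
  apply: (@ind _ _ (r C + 4) (r C + 5)); first by rewrite !addnS addn0; do 4!apply: (rU).
    by clear; lia.
  by rewrite -rA !(setUCA [set e0]).
have [r3 e4n] : r (e3 |: (e2 |: (e1 |: C))) = r C + 3 /\ e4 \notin cl r (e3 |: (e2 |: (e1 |: C))).
  apply: (@ind _ _ (r C + 3) (r C + 4)) => //; last by clear; lia.
  by rewrite !addnS addn0; do 3!apply: (rU).
have [r2 e3n] : r (e2 |: (e1 |: C)) = r C + 2 /\ e3 \notin cl r (e2 |: (e1 |: C)).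
  apply: (@ind _ _ (r C + 2) (r C + 3)) => //; last by clear; lia.
  by rewrite !addnS addn0; do 2!apply: (rU).
have [r1 e2n] : r (e1 |: C) = r C + 1 /\ e2 \notin cl r (e1 |: C).
  apply: (@ind _ _ (r C + 1) (r C + 2)) => //; last by clear; lia.
  by rewrite addn1; apply: (rU).
pose A4 := cl r (e4 |: (e3 |: (e2 |: (e1 |: C)))).
have sA4 : A4 \subset A by rewrite flat_sub // !subUset !sub1set e4A e3A e2A e1A.
have pA4 : proj r C A4 Y.
  split=> //; first exact: flat_cl.
    by rewrite (subset_trans _ (sub_cl _ _)) // !setUA subsetUr.
  move=> Z1 Z2 f1 f2 s1 s12 s2 r12.
  have [h _] := hA Z1 Z2 f1 f2 s1 s12 (subset_trans s2 sA4) r12; apply: h.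
  by apply: contra e0n; apply: (subsetP s2).
pose N := cl r (e2 |: (e1 |: C)).
have sN4 : N \subset A4 by apply: clS; apply: subset_trans (subsetUr _ _) (subsetUr _ _).
have sCN : C \subset N by rewrite (subset_trans _ (sub_cl _ _)) // setUA subsetUr.
have e0N : e0 \notin N by apply: contra e0n; apply: (subsetP sN4).
have nN : nP r C N = Y.+1.
  by have [_ _ _ h] := pA4; apply: h => //; rewrite ?flat_cl // rf_cl r2 addn2.
have Yl : Y <= l.
  by rewrite -ltnS -nN; apply: nP_line => //; rewrite (setUidPl sCN) rf_cl r2 addn2.
have Yq : Y = q.
  apply/eqP; rewrite eqn_leq qY andbT; apply: hmax => //.
  apply: (proj_prime_power pA4); last exact: leq_trans q_gt1 qY.
  by rewrite rf_cl.
have e0C : e0 \notin C by apply: contra e0N; apply: (subsetP sCN).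
have [sub3 sub2] : e3 |: (e2 |: (e1 |: C)) \subset e4 |: (e3 |: (e2 |: (e1 |: C))) /\
   e2 |: (e1 |: C) \subset e3 |: (e2 |: (e1 |: C)) by split; apply: subsetUr.
pose Pi := cl r (e3 |: (e2 |: (e1 |: C))).
have sNPi : N \subset Pi by apply: clS.
have sPi4 : Pi \subset A4 by apply: clS.
have e0Pi : e0 \notin Pi by apply: contra e0n; apply: (subsetP sPi4).
have sCPi := subset_trans sCN sNPi.
have Pif : is_flat r Pi by apply: flat_cl.
have Nf : is_flat r N by apply: flat_cl.
pose M1 := cl r (e1 |: (e0 |: C)); pose M2 := cl r (e2 |: (e0 |: C)).
have e0C' : e0 \notin cl r C by rewrite notin_flat.
have nM e : e \in A -> e \notin cl r (e0 |: C) -> nP r C (cl r (e |: (e0 |: C))) = y0.+1.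
  move=> eA eC; have [||||||_ h] := hA C (cl r (e |: (e0 |: C))) => //; rewrite ?flat_cl //.
  - by rewrite (subset_trans _ (sub_cl _ _)) // setUA subsetUr.
  - by rewrite flat_sub // !subUset !sub1set eA e0A.
  - by rewrite rf_cl notin_cl2.
  - by apply: h => //; apply: mem_cl; rewrite !inE eqxx orbT.
have e1n : e1 \notin cl r (e0 |: C).
  apply: notin_clU1; first by rewrite clE; apply/eqP=> h; move: r1; rewrite h; clear; lia.
  apply: contra e0N; apply/subsetP/sub_clU1.
have e20 : e2 \notin cl r (e1 |: (e0 |: C)).
  by rewrite setUCA; apply: notin_clU1.
have e2n' : e2 \notin cl r (e0 |: C) by apply: contra e20; apply/subsetP/sub_clU1.
(* The line e0 e2 has y0 + 1 >= 4 points. *)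
have [w [wM w0 w2]] : exists w, [/\ w \in M2, w \notin cl r (e0 |: C) & w \notin cl r (e2 |: C)].
  have h1 := nP_step r C e0 M2; have h2 := nP_step r C e2 (M2 :\: cl r (e0 |: C)).
  have := nM _ e2A e2n'; rewrite -/M2 => h3.
  have /card_gt0P[F /ptsP[w [+ _] _]] : 0 < nP r C (M2 :\: cl r (e0 |: C) :\: cl r (e2 |: C)).
    by move: h1 h2 h3 qy q_gt1; clear; lia.
  by move=> /setDP[/setDP[? ?] ?]; exists w.
have we0 : e0 \in cl r (w |: (e2 |: C)) by apply: exchange; rewrite // setUCA.
have we2 : e2 \in cl r (w |: (e0 |: C)) by apply: exchange.
have wPi : w \notin Pi.
  apply: contra e0Pi => wPi; apply: subsetP we0; rewrite flat_sub // !subUset !sub1set wPi sCPi andbT.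
  by apply: mem_cl; rewrite !inE eqxx orbT.
have wN : w \notin N by apply: contra wPi; apply: (subsetP sNPi).
have wM1 : w \notin M1.
  apply: contra e20 => wM1; apply: subsetP we2; rewrite cl_sub subUset sub1set wM1.
  exact: subset_clU1.
have M1f : is_flat r M1 by apply: flat_cl.
have sCM1 : C \subset M1 by rewrite (subset_trans _ (sub_cl _ _)) // setUA subsetUr.
(* Seen from w, the line M1 keeps its y0 + 1 points, more than the q + 1 points of N, so some v on
   M1 is not collinear with w and a point of N. *)
have [v [vM vC vt]] : exists v, [/\ v \in M1, v \notin C &
    forall t, t \in N -> t \in cl r (v |: (w |: C)) -> t \in C].
  apply: NNPP => none; suff : nP r C M1 <= nP r C N by rewrite nN nM // Yq; move: qy; clear; lia.
  apply: leq_trans (nP_notin Cf M1f sCM1 wM1) _.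
  apply: leq_trans (_ : nP r (w |: C) N <= _); last by apply: nP_contract; apply: subset_clU1.
  apply: subset_leq_card; apply/subsetP=> F /ptsP[v [vM vw] ->].
  have vC : v \notin C by apply: contra vw => h; apply: mem_cl; rewrite inE h orbT.
  have [t [tN tv tC]] : exists t, [/\ t \in N, t \in cl r (v |: (w |: C)) & t \notin C].
    apply: NNPP => h; apply: none; exists v; split=> // t tN tv.
    by apply: contraT => tC; case: h; exists t.
  have tw : t \notin cl r (w |: C).
    by apply: contra tC => h; apply: (cl_meet Nf Cf sCN wN).
  by rewrite -(cl_exchange tv tw); apply: mem_pts.
have vw : v \notin cl r (w |: C) by apply: contra vC => h; apply: (cl_meet M1f Cf sCM1 wM1).
have wC : w \notin cl r C by apply: contra w0; apply/subsetP/sub_clU1.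
have sD : v |: (w |: C) \subset cl r (e0 |: N).
  have ->: cl r (e0 |: N) = cl r (e0 |: (e2 |: (e1 |: C))) by rewrite clU1_cl.
  rewrite !subUset !sub1set; apply/and3P; split.
  - by apply: subsetP vM; apply: clS; apply/subsetP=> x; rewrite !inE => /or3P[]->; rewrite ?orbT.
  - by apply: subsetP wM; apply: clS; apply/subsetP=> x; rewrite !inE => /or3P[]->; rewrite ?orbT.
  - by rewrite (subset_trans _ (sub_cl _ _)) // !setUA subsetUr.
have rD : r (v |: (w |: C)) = r C + 2 by rewrite notin_cl2 // addn2.
have rDP : r ((v |: (w |: C)) :|: Pi) = (r (v |: (w |: C))).+2.
  rewrite rD; apply/eqP; rewrite eqn_leq; apply/andP; split.
    apply: leq_trans (_ : r (cl r (e0 |: Pi)) <= _).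
      apply: rfS; rewrite subUset subset_clU1 andbT (subset_trans sD) //.
      by apply/clS/setUS.
    by rewrite rf_cl; apply: leq_trans (rfU1 r _ _) _; rewrite rf_cl r3; clear; lia.
  apply: leq_trans (_ : r (w |: Pi) <= _).
    by rewrite (rf_notin_cl (x := w)) ?(flatE Pif) // /Pi (rf_cl r) r3; clear; lia.
  by apply: rfS; apply: setSU; rewrite setUCA subsetUl.
have hZ t : t \in Pi -> t \in cl r (v |: (w |: C)) -> t \in C.
  move=> tPi tD; apply: vt (tD); apply: (cl_meet Pif Nf sNPi e0Pi tPi).
  by move: tD; apply/subsetP; rewrite cl_sub.
have pPi : proj r C Pi Y by apply: (proj_sub pA4).
have sCD : C \subset v |: (w |: C) by rewrite setUA subsetUr.
have := plane_from_point pPi _ sCD rDP hZ; rewrite rf_cl r3 addn3 => /(_ erefl).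
have := @nP_line T r l (v |: (w |: C)) Pi U; rewrite setUC rDP leqnn => /(_ isT).
by rewrite Yq; move: l_lt_qq; clear; lia.
Qed.

(** Otherwise pointed configurations of order q + 1 are unbounded. Orders never exceed l, so there
    is a largest y0 > q for which they are, and then a largest apex order Y shared by all closed
    unbounded classes of order y0. Maximality of y0 and Y yields the constants B0 and B1 of
    [star_config]. *)
Lemma long_lines_sparse : exists B, forall T (r : rankfun T) C e0, no_long_line r l ->
  e0 \notin cl r C -> sp q B (cork r (e0 |: C))
    (nP r (e0 |: C) [set f | (f \notin cl r (e0 |: C)) && (q < nP r C (cos r (e0 |: C) f))]).
Proof.
apply: NNPP => hn.
pose PQ y : class := fun T r e0 C S => pointed r e0 y C S.
have hq1 : unbounded (PQ q.+1).
  move=> B; apply: NNPP => h; apply: hn; exists B => T r C e0 U e0C.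
  apply: contraT => hd; case: h; set S := [set f | _] in hd.
  have memS f : (f \in S) = (f \notin cl r (e0 |: C)) && (q < nP r C (cos r (e0 |: C) f)) by rewrite inE.
  exists T, r, e0, C, S; split=> //; split=> // f; rewrite memS => /andP[] // fC hf.
  apply: leq_trans (hf) _; apply: nPS; rewrite subsetI subxx andbT.
  by apply/subsetP=> g gf; rewrite memS (cos_sub gf) hf andbT; have /setDP[] := gf.
have hl : ~ unbounded (PQ (q.+1 + l)).
  move=> /(_ 0)[T [r [e0 [C [S [[U e0C h1 h2] hd]]]]]]; have [f fS fC] := dense_ex hd.
  by have := leq_trans (h2 f fS) (nP_cos S C e0 f l_gt0 U); clear; lia.
have [m [_ hm hmin]] := @least_nat (fun n => ~ unbounded (PQ (q.+1 + n))) l hl.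
case: m hm hmin => [|m] hm hmin; first by rewrite addn0 in hm.
have {hmin} := hmin m (ltnSn _) => /NNPP hy0; rewrite addnS in hm.
set y0 := q.+1 + m in hm hy0; have qy : q < y0 by rewrite leq_addr.
have cP : closed_class y0 (PQ y0) by split=> // T r e0 C S C2 S2; apply: pointed_submember.
have hlQ : exists Q, [/\ closed_class y0 Q, unbounded Q & ~ has_apex Q l.+1].
  exists (PQ y0); split=> // /(_ (2 + 2 * l * 0))[T [r [e0 [C [S [[[U e0C h1 h2] [e [eC he]]] hd]]]]]].
  have [f /setDP[fS fe] _] := dense_ex (dense_U1 U eC hd).
  by have := leq_trans (he f fS fe) (nP_cos S (e0 |: C) e f l_gt0 U); rewrite ltnn.
have [Y [_ [Q [cQ uQ nQ]] hmin]] := @least_nat (fun Y => exists Q,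
  [/\ closed_class y0 Q, unbounded Q & ~ has_apex Q Y.+1]) l hlQ.
have qY : q <= Y.
  by rewrite leqNgt; apply/negP=> lt; apply: nQ; apply: has_apex_le lt (has_apex_q cQ uQ).
have hY Q' : closed_class y0 Q' -> unbounded Q' -> has_apex Q' Y.
  move=> c1 u1; have [Y' eY] : exists Y', Y = Y'.+1 by exists Y.-1; move: q_gt1 qY; clear; lia.
  rewrite eY in hmin *; apply: NNPP => h; apply: (hmin Y') => //; by exists Q'.
have [B0 hB0] := not_unbounded hm; have [B1 hB1] := not_unbounded nQ.
have y00 : 0 < y0 by move: qy; clear; lia.
have Y1 := leq_trans q_gt1 qY.
have [T [r [e0 [C [L [U Cf sL rA hA]]]]]] := star_config 4 cQ uQ hY hB0 hB1 y00 Y1.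
exact: (apex_contra U Cf sL rA hA qY qy).
Qed.
End Star.

(** * Density and connectivity *)

Module Density.

(** * Restriction to Y, with the elements outside Y turned into loops *)

Section Restriction.
Variables (T : finType) (r : rankfun T) (Y : {set T}).
Implicit Types (A B C D F X Z S : {set T}) (x : T).

Lemma rst0 : r (set0 :&: Y) = 0. Proof. by rewrite set0I rf0. Qed.
Lemma rstS A B : A \subset B -> r (A :&: Y) <= r (B :&: Y).
Proof. by move=> s; apply/rfS/setSI. Qed.
Lemma rstU1 x A : r ((x |: A) :&: Y) <= (r (A :&: Y)).+1.
Proof.
apply: leq_trans (rfU1 r x (A :&: Y)); apply: rfS; rewrite setIUl.
by apply: setSU; apply: subsetIl.
Qed.
Lemma rstUI A B : r ((A :|: B) :&: Y) + r (A :&: B :&: Y) <= r (A :&: Y) + r (B :&: Y).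
Proof. by have := rfUI r (A :&: Y) (B :&: Y); rewrite -setIUl -setIIl. Qed.

Definition rst := RankFun rst0 rstS rstU1 rstUI.

Lemma rstE X : rst X = r (X :&: Y). Proof. by []. Qed.

Lemma rst_in X : X \subset Y -> rst X = r X.
Proof. by move=> s; rewrite rstE (setIidPl s). Qed.

Lemma rst_T : rst setT = r Y. Proof. by rewrite rstE setTI. Qed.

Lemma cl_rst C : C \subset Y -> cl rst C = cl r C :|: ~: Y.
Proof.
move=> s; apply/setP=> x; rewrite clE !rstE inE in_setC.
have [xY|xY] := boolP (x \in Y); rewrite ?orbF ?orbT.
  by rewrite !(setIidPl _) ?clE // subUset sub1set xY.
rewrite (_ : (x |: C) :&: Y = C :&: Y) ?eqxx //; apply/setP=> z; rewrite !inE.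
by case: eqVneq => // ->; rewrite (negPf xY) !andbF.
Qed.

Lemma rst_no_long_line l : no_long_line r l -> no_long_line rst l.
Proof.
move=> U C S hS h2; have [|S1] := leqP #|S| 1; first by move/leq_trans; apply.
have sSY x : x \in S -> x \in Y.
  move=> xS; have [y yS yx] : exists2 y, y \in S & y != x.
    have : 0 < #|S :\ x| by rewrite (cardsD1 x) xS in S1.
    by case/card_gt0P=> y; rewrite !inE => /andP[yx yS]; exists y.
  apply: contraT => xY; have := h2 y x yS xS yx; rewrite !rstE.
  rewrite (_ : (y |: (x |: C)) :&: Y = (y |: C) :&: Y); last first.
    apply/setP=> z; rewrite !inE; have [->|] := eqVneq z x; rewrite ?(negPf xY) ?andbF //=.
  by have := rstU1 y C; rewrite /= => h3 h4; move: h3; rewrite h4; clear; lia.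
have sS : S \subset Y by apply/subsetP.
apply: (U (C :&: Y)).
  by apply: leq_trans hS; rewrite rstE setIUl (setIidPl sS).
move=> x y xS yS nxy; rewrite -(rstE C) -(h2 x y xS yS nxy) rstE; congr (r _).
by apply/setP=> z; rewrite !inE; case: eqVneq => [->|_] /=; [rewrite sSY | case: eqVneq => [->|_] /=; [rewrite sSY|]].
Qed.

Lemma nP_rst C X : C \subset Y -> nP rst C X = nP r C (X :&: Y).
Proof.
move=> s; have hc x : x \in Y -> cl rst (x |: C) = cl r (x |: C) :|: ~: Y.
  by move=> xY; apply: cl_rst; rewrite subUset sub1set xY.
have memc x : x \in Y -> (x \in cl rst C) = (x \in cl r C).
  by move=> xY; rewrite cl_rst // in_setU in_setC xY orbF.
have inj : {in pts r C (X :&: Y) &, injective (fun F => F :|: ~: Y)}.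
  move=> F1 F2 /ptsP[a [/setIP[aX aY] aC] ->] /ptsP[b [/setIP[bX bY] bC] ->] e.
  have : a \in cl r (b |: C) :|: ~: Y by rewrite -e inE mem_clU1.
  by rewrite in_setU in_setC aY orbF => h; apply: cl_exchange.
rewrite /nP -(card_in_imset inj); apply: eq_card => F; apply/ptsP/imsetP.
  move=> [x [xX xC] ->].
  have xY : x \in Y by apply: contraT => xY; case/negP: xC; rewrite cl_rst // in_setU in_setC xY orbT.
  by exists (cl r (x |: C)); rewrite ?hc //; apply: mem_pts; rewrite ?inE ?xX // -memc.
move=> [_ /ptsP[x [/setIP[xX xY] xC] ->] ->]; exists x; rewrite ?hc //.
by rewrite memc.
Qed.

End Restriction.

(** * Growth of the normalised number of points *)

Section DensityTheory.
Variables l q B : nat.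
Hypotheses (q_gt1 : 1 < q) (q_le_l : q <= l).
Hypothesis hB : forall T (r : rankfun T) C e0, no_long_line r l ->
  e0 \notin cl r C -> sp q B (cork r (e0 |: C))
    (nP r (e0 |: C) [set f | (f \notin cl r (e0 |: C)) && (q < nP r C (cos r (e0 |: C) f))]).

Let l_gt0 : 0 < l. Proof. by move: q_gt1 q_le_l; clear; lia. Qed.

(** The constant that [sp_step] makes of B, large enough for the second term of [PHI] to absorb the
    error in [PHI_step]. *)
Definition beta := 2 + 2 * l * B.
(* PHI / (2q)^cork is nondecreasing under contraction and equal to beta for the empty matroid. *)
Definition PHI T (r : rankfun T) C := 2 ^ cork r C * nP r C setT + beta * q.*2.-1 ^ cork r C.

Lemma PHI_cl T (r : rankfun T) C : PHI r (cl r C) = PHI r C.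
Proof. by rewrite /PHI cork_cl nP_cl. Qed.

Section Fixed.
Variables (T : finType) (r : rankfun T).
Hypothesis U : no_long_line r l.
Implicit Types (A C D F X Y Z S : {set T}) (e f g u x : T).

(** A short line through e carries at most q further points and a long one at most l, and long ones
    are sparse by [hB]. As 2q exceeds 2q - 1 by one, the second term of [PHI] has beta (2q - 1)^k to
    spare, which pays for them. *)
Lemma PHI_step C e : e \notin cl r C -> PHI r C <= q.*2 * PHI r (e |: C).
Proof.
move=> eC; have hb := hB U eC; move: hb; set Lg := [set f | _] => hb.
have hn : nP r C setT <= 1 + (q * nP r (e |: C) setT + l * nP r (e |: C) Lg).
  apply: leq_trans (nP_step r C e setT) _; rewrite add1n ltnS.
  apply: leq_trans (nP_splitD r C _ Lg) _; apply: leq_add.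
    have -> : (setT :\: cl r (e |: C)) :\: Lg = (setT :\: Lg) :\: cl r (e |: C) by rewrite !setDDl setUC.
    apply: leq_trans (nP_le_mul (y := q) (subset_clU1 _ _ _) _) _.
      move=> f /setDP[_]; rewrite inE => fL fe; move: fL; rewrite fe /= -leqNgt => fL.
      by apply: leq_trans fL; apply: nPS; apply: subsetIr.
    by rewrite leq_mul2l nPS ?subsetT ?orbT.
  have -> : (setT :\: cl r (e |: C)) :&: Lg = Lg :\: cl r (e |: C).
    by apply/setP=> x; rewrite in_setI !in_setD in_setT andbT.
  by apply: nP_le_mul; [apply: subset_clU1 | move=> f _ _; apply: nP_cos].
move: hb hn; rewrite /PHI (cork_U1 eC) /sp !expnS /beta.
have h2 : 2 ^ cork r (e |: C) <= q.*2.-1 ^ cork r (e |: C).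
  by case: (cork _ _) => // k; rewrite leq_exp2r //; move: q_gt1; clear; lia.
have [x hx] : exists x : nat, q = x.+1 by exists q.-1; move: q_gt1; clear; lia.
have -> : q.*2.-1 = x.*2.+1 by rewrite hx; clear; lia.
have {}h2 : 2 ^ cork r (e |: C) <= x.*2.+1 ^ cork r (e |: C).
  by move: h2; rewrite hx (_ : x.+1.*2.-1 = x.*2.+1) //; clear; lia.
rewrite hx; move: (2 ^ _) (x.*2.+1 ^ _) (nP r (e |: C) Lg) (nP r (e |: C) setT) (nP r C setT) h2 => a b K1 K2 K3 h2 h3 h4.
have h5 : 2 * a * K3 <= 2 * a * (1 + (x.+1 * K2 + l * K1)) by rewrite leq_mul2l h4 orbT.
have h6 : l * (a * K1) <= l * (B * b) by rewrite leq_mul2l h3 orbT.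
apply: leq_trans (_ : 2 * a * (1 + (x.+1 * K2 + l * K1)) + (2 + 2 * l * B) * (x.*2.+1 * b) <= _).
  by rewrite leq_add2r.
have -> : 2 * a * (1 + (x.+1 * K2 + l * K1)) = 2 * a + 2 * x.+1 * (a * K2) + 2 * (l * (a * K1)) by clear; nia.
have -> : x.+1.*2 * (a * K2 + (2 + 2 * l * B) * b) =
  2 * b + 2 * x.+1 * (a * K2) + 2 * (l * (B * b)) + (2 + 2 * l * B) * (x.*2.+1 * b) by clear; nia.
by rewrite leq_add2r; apply: leq_add; [rewrite leq_add2r leq_mul2l h2 orbT | rewrite leq_mul2l h6 orbT].
Qed.

Lemma PHI_mono C D : C \subset cl r D ->
  PHI r C * q.*2 ^ cork r D <= PHI r D * q.*2 ^ cork r C.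
Proof.
have [n] := ubnP (r D - r C); elim: n C => // n IH C lt s.
have [le|] := leqP (r D) (r C).
  have e : cl r C = cl r D by apply: cl_eq_rank.
  by rewrite -(PHI_cl r C) -(cork_cl r C) e PHI_cl cork_cl.
move=> /ltn_rank_ex[e eD eC].
have := IH (e |: C); rewrite rf_notin_cl // => {}IH.
have {}IH : PHI r (e |: C) * q.*2 ^ cork r D <= PHI r D * q.*2 ^ cork r (e |: C).
  apply: IH; last by rewrite subUset sub1set mem_cl.
  have : r C < r D by rewrite ltnNge; apply: contra eC => le; rewrite (cl_eq_rank s le) mem_cl.
  by move: lt; clear; lia.
rewrite (cork_U1 eC) expnS; apply: leq_trans (_ : q.*2 * PHI r (e |: C) * q.*2 ^ cork r D <= _).
  by rewrite leq_mul2r PHI_step ?orbT.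
by rewrite -mulnA [X in _ <= X]mulnCA leq_mul2l IH orbT.
Qed.

Lemma PHI_le C : PHI r C <= beta * q.*2 ^ cork r C.
Proof.
have := @PHI_mono C setT; rewrite (subset_trans (subsetT _) (sub_cl _ _)) => /(_ isT).
by rewrite {2}/PHI /cork subnn nP0 ?sub_cl // !expn0 muln0 !muln1.
Qed.

Lemma nP_le_beta C : nP r C setT <= beta * q ^ cork r C.
Proof.
have := PHI_le C; rewrite /PHI -mul2n expnMn => h.
have : 2 ^ cork r C * nP r C setT <= 2 ^ cork r C * (beta * q ^ cork r C).
  by apply: leq_trans (leq_addr _ _) (leq_trans h _); rewrite mulnCA.
by rewrite leq_pmul2l ?expn_gt0.
Qed.

End Fixed.

(** The bound is applied to the restriction to Y and C, so that the exponent is the rank of Y over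
    C. *)
Lemma nP_le_rank T (r : rankfun T) (C Y : {set T}) : no_long_line r l ->
  nP r C Y <= beta * q ^ (r (Y :|: C) - r C).
Proof.
move=> U; pose Y' := Y :|: C; have sC : C \subset Y' by apply: subsetUr.
have U' := rst_no_long_line (Y := Y') U.
have := nP_le_beta U' C; rewrite nP_rst // setTI /cork rst_T rst_in //; apply: leq_trans.
by apply: nPS; apply: subsetUl.
Qed.

(** Density at least q^(-d) in the normalisation of [PHI]; by [dn_mono] it survives every
    contraction. *)
Definition dn d T (r : rankfun T) C := q.*2 ^ cork r C <= q ^ d * PHI r C.

Lemma dn_mono d T (r : rankfun T) (C D : {set T}) : no_long_line r l -> C \subset cl r D ->
  dn d r C -> dn d r D.
Proof.
rewrite /dn => U s h; have h1 := PHI_mono U s.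
have p0 : 0 < q.*2 ^ cork r C by rewrite expn_gt0; move: q_gt1; clear; lia.
rewrite -(leq_pmul2l p0); apply: leq_trans (_ : q ^ d * PHI r C * q.*2 ^ cork r D <= _).
  by rewrite leq_mul2r h orbT.
by rewrite -mulnA [X in _ <= X]mulnCA leq_mul2l [X in _ || (_ <= X)]mulnC h1 orbT.
Qed.

Lemma geom_gap a : exists N, forall k, N <= k -> a * q.*2.-1 ^ k <= q.*2 ^ k.
Proof.
have ber k : q.*2.-1 ^ k.+1 + k.+1 * q.*2.-1 ^ k <= q.*2 ^ k.+1.
  have -> : q.*2 = q.*2.-1.+1 by move: q_gt1; clear; lia.
  move: (q.*2.-1) => x /=; elim: k => [|k IH]; first by rewrite !expn1 expn0; clear; lia.
  rewrite [x.+1 ^ k.+2]expnS; apply: leq_trans (_ : x.+1 * (x ^ k.+1 + k.+1 * x ^ k) <= _); last by rewrite leq_mul2l IH orbT.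
  by rewrite !expnS; move: (x ^ k) => z; clear; nia.
exists (a * q.*2.-1).+1 => -[|k] // hk; apply: leq_trans (ber k); rewrite expnS mulnA.
apply: leq_trans (leq_addl _ _); rewrite leq_mul2r; apply/orP; right; move: hk; clear; lia.
Qed.

Lemma dn_nP d : exists N, forall T (r : rankfun T) C, dn d r C -> N <= cork r C ->
  q ^ cork r C <= 2 * q ^ d * nP r C setT.
Proof.
have [N hN] := geom_gap (2 * q ^ d * beta); exists N => T r C; rewrite /dn /PHI => h /hN {}hN.
have : 2 ^ cork r C * q ^ cork r C <= 2 ^ cork r C * (2 * q ^ d * nP r C setT).
  rewrite -expnMn mul2n; move: h hN; move: (q.*2 ^ _) (q.*2.-1 ^ _) (2 ^ cork _ _) (q ^ d) (nP _ _ _) beta.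
  move=> a b c x y z; nia.
by rewrite leq_pmul2l ?expn_gt0.
Qed.

(** The two sides, of ranks a and b over C, have at most beta (q^a + q^b) points together, while a
    dense contraction has q^cork up to a constant, so one side has nearly full rank. Low
    connectivity bounds the rank of the other, which is X, as X has at most about half the rank. *)
Lemma dichotomy d t : exists N, forall T (r : rankfun T) C X, no_long_line r l -> dn d r C ->
  N <= cork r C -> r (X :|: C) + r (~: X :|: C) <= r setT + r C + t ->
  2 * r (X :|: C) <= (r setT + r C).+1 -> r (X :|: C) <= r C + (t + 2 + d + beta).
Proof.
have [N1 hN1] := dn_nP d; exists (N1 + 2 * (2 + d + beta) + 2) => T r C X U hd hk h1 h2.
have {}hN1 := hN1 T r C hd; have {hN1} hq := hN1 (leq_trans (leq_trans (leq_addr _ _) (leq_addr _ _)) hk).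
have rC : r C <= r setT by apply/rfS/subsetT.
have rX : r C <= r (X :|: C) by apply/rfS/subsetUr.
have rY : r C <= r (~: X :|: C) by apply/rfS/subsetUr.
pose a := r (X :|: C) - r C; pose b := r (~: X :|: C) - r C.
have hn : nP r C setT <= beta * q ^ a + beta * q ^ b.
  rewrite -(setUCr X); apply: leq_trans (nPU _ _ _ _) _.
  by apply: leq_add; apply: nP_le_rank.
have q0 : 0 < q by apply: ltnW.
have hb : beta <= q ^ beta by apply/ltnW/ltn_expl.
have : q ^ cork r C <= q ^ (2 + d + beta + maxn a b).
  apply: leq_trans hq _; apply: leq_trans (_ : 2 * q ^ d * (q ^ beta * (2 * q ^ maxn a b)) <= _).
    rewrite leq_mul2l; apply/orP; right; apply: leq_trans hn _; rewrite -mulnDr; apply: leq_mul => //.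
    by rewrite mul2n -addnn leq_add // leq_exp2l // ?leq_maxl ?leq_maxr.
  rewrite (_ : 2 * q ^ d * _ = 2 * 2 * (q ^ d * (q ^ beta * q ^ maxn a b))); last by clear; nia.
  move: (maxn a b) (beta) => m b0; rewrite -!addnA !expnD; apply: leq_mul => //; by rewrite expnS expn1; apply: leq_mul.
rewrite leq_exp2l // => hm; move: hm hk h1 h2 rC rX rY; rewrite /a /b /cork.
move: beta (r _) (r _) (r _) (r _) => b0 x y z w; clear; lia.
Qed.

(* Every X containing J with connectivity less than t spans more than half of M/C. *)
Definition Linked t T (r : rankfun T) (J C : {set T}) := forall X : {set T}, J \subset X ->
  r (X :|: C) + r (~: X :|: C) < r setT + r C + t -> r setT + r C < 2 * r (X :|: C).

(* The sets of minimal connectivity and small rank containing J are closed under union; X0 is the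
   largest one. *)
Lemma Linked_step d t : exists N, forall T (r : rankfun T) J C, no_long_line r l -> dn d r C ->
  N <= cork r C -> Linked t r J C -> exists2 X0 : {set T}, r (X0 :|: C) <= r C + (t + 2 + d + beta) &
    forall e, e \notin cl r (X0 :|: C) -> Linked t r J (e |: C).
Proof.
have [N1 hN1] := dichotomy d t; pose R := t + 2 + d + beta.
exists (N1 + 4 * R) => T r J C U hd hk hL.
have kR : 4 * R <= cork r C := leq_trans (leq_addl _ _) hk.
have {hN1} dich X := hN1 T r C X U hd (leq_trans (leq_addr _ _) hk).
have rC : r C <= r setT by apply/rfS/subsetT.
have {}kR : r C + 4 * R <= r setT by move: kR rC; rewrite /cork; clear; lia.
pose Fam (X : {set T}) := [&& J \subset X, r (X :|: C) + r (~: X :|: C) <= r setT + r C + t & r (X :|: C) <= r C + R].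
have FamU X1 X2 : Fam X1 -> Fam X2 -> Fam (X1 :|: X2).
  move=> /and3P[J1 a1 b1] /and3P[J2 a2 b2].
  have JI : J \subset X1 :&: X2 by rewrite subsetI J1.
  have s1 := rfUI r (X1 :|: C) (X2 :|: C); have s2 := rfUI r (~: X1 :|: C) (~: X2 :|: C).
  rewrite setUACA setUid -setUIl in s1; rewrite setUACA setUid -setUIl -setCI -setCU in s2.
  have lI : r setT + r C + t <= r (X1 :&: X2 :|: C) + r (~: (X1 :&: X2) :|: C).
    rewrite leqNgt; apply/negP=> /(hL _ JI).
    have : r (X1 :&: X2 :|: C) <= r (X1 :|: C) by apply/rfS/setSU/subsetIl.
    by move: b1 kR; clear; lia.
  have rI : r C <= r (X1 :&: X2 :|: C) by apply/rfS/subsetUr.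
  have hU : r (X1 :|: X2 :|: C) + r (~: (X1 :|: X2) :|: C) <= r setT + r C + t.
    by move: s1 s2 lI a1 a2; clear; lia.
  apply/and3P; split=> //; first by rewrite (subset_trans J1) // subsetUl.
  apply: dich => //; by move: s1 b1 b2 kR rI; clear; lia.
have [X0 h0 hmx] : exists2 X0, r (X0 :|: C) <= r C + R & forall X, Fam X -> X \subset X0.
  have [/existsP[X1 F1]|/existsPn none] := boolP [exists X, Fam X]; last first.
    by exists set0; [rewrite set0U leq_addr | move=> X FX; have := none X; rewrite FX].
  have [X0 /maxsetP[F0 mx] _] := maxset_exists F1.
  exists X0; first by case/and3P: F0.
  by move=> X FX; rewrite -(mx (X0 :|: X)) ?subsetUr ?subsetUl // FamU.
exists X0 => // e eX0 X JX h1; rewrite ltnNge; apply/negP=> h2; case/negP: eX0.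
have eC : e \in cl r C \/ r (e |: C) = (r C).+1.
  by have [?|/rf_notin_cl ?] := boolP (e \in cl r C); [left | right].
case: eC => [eC|re]; first by apply: subsetP eC; apply/clS/subsetUr.
have eX : X :|: (e |: C) = (e |: X) :|: C by rewrite setUCA setUA.
have sY : r (~: (e |: X) :|: C) <= r (~: X :|: (e |: C)).
  by apply: rfS; apply: setUSS; [rewrite setCS subsetUr | apply: subsetUr].
rewrite eX re in h1 h2.
suff : e |: X \subset X0 by rewrite subUset sub1set => /andP[h _]; apply: mem_cl; rewrite inE h.
apply: hmx; have a1 : r (e |: X :|: C) + r (~: (e |: X) :|: C) <= r setT + r C + t.
  by move: h1 sY; clear; lia.
apply/and3P; split=> //; first by rewrite (subset_trans JX) // subsetUr.
by apply: dich => //; move: h2; clear; lia.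
Qed.
End DensityTheory.

(** * Tutte's linking theorem *)

Section Linking.
Variables (T : finType) (r : rankfun T).
Implicit Types (C D E G P X Y : {set T}).

(* Every element outside G and P can be deleted or, if it is not spanned by P, contracted:
   two separations witnessing the failure of both would uncross. *)
Lemma linking t E G P C : G :|: P \subset E ->
  (forall X Y, G \subset X -> P \subset Y -> X :|: Y = E ->
     r (E :|: C) + r C + t <= r (X :|: C) + r (Y :|: C)) ->
  exists D, [/\ C \subset D, r (P :|: D) + r C = r D + r (P :|: C) &
    r (G :|: P :|: D) + r D + t <= r (G :|: D) + r (P :|: D)].
Proof.
have [n] := ubnP #|E :\: (G :|: P)|; elim: n E C => // n IH E C lt sGP h.
have [sE|/subsetPn[e eE eGP]] := boolP (E \subset G :|: P).
  have eE : E = G :|: P by apply/eqP; rewrite eqEsubset sE.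
  by exists C; split; [exact: subxx | exact: addnC | have := h G P; rewrite eE; apply].
have sGP' : G :|: P \subset E :\ e by rewrite subsetD1 sGP.
have lt' : #|(E :\ e) :\: (G :|: P)| < n.
  move: lt; rewrite (cardsD1 e) inE eE eGP add1n ltnS; apply: leq_trans.
  by rewrite ltnS; apply: subset_leq_card; apply/subsetP=> x; rewrite !inE => /and3P[-> -> ->].
have [eG eP] : e \notin G /\ e \notin P by move: eGP; rewrite inE negb_or => /andP[].
have rE : r (E :\ e :|: C) <= r (E :|: C) by apply/rfS/setSU/subD1set.
have [hdel|ndel] := classic (forall X Y, G \subset X -> P \subset Y -> X :|: Y = E :\ e ->
     r (E :\ e :|: C) + r C + t <= r (X :|: C) + r (Y :|: C)).
  exact: (IH (E :\ e)).
have [X1 [Y1 [GX1 PY1 e1 h1]]] : exists X Y, [/\ G \subset X, P \subset Y, X :|: Y = E :\ e &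
     r (X :|: C) + r (Y :|: C) < r (E :\ e :|: C) + r C + t].
  apply: NNPP => none; apply: ndel => X Y GX PY eXY; rewrite leqNgt; apply/negP=> lt1.
  by apply: none; exists X, Y.
have [eX1 eY1] : e \notin X1 /\ e \notin Y1.
  by split; apply/negP=> h2; have := setD11 e E; rewrite -e1 inE h2 ?orbT.
have cov X Y : X :|: Y = E :\ e -> X :|: (e |: Y) = E.
  by move=> eXY; rewrite setUCA eXY setD1K.
have [ePC|ePC] := boolP (e \in cl r (P :|: C)).
  have := h X1 (e |: Y1) GX1; rewrite (subset_trans PY1) ?subsetUr // cov // => /(_ isT erefl).
  rewrite -setUA rf_in_cl; last by apply: subsetP ePC; apply/clS/setSU.
  by move: h1 rE; clear; lia.
have eC : e \notin cl r C by apply: contra ePC; apply/subsetP/clS/subsetUr.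
have re := rf_notin_cl eC.
have [|D [sD hP hGP]] := IH (E :\ e) (e |: C) lt' sGP'; last first.
  exists D; split=> //; first by rewrite (subset_trans _ sD) // subsetUr.
  move: hP; rewrite [P :|: (e |: C)]setUCA (rf_notin_cl ePC) re; clear; lia.
move=> X2 Y2 GX2 PY2 e2; rewrite leqNgt; apply/negP=> h2.
have eE' : E :\ e :|: (e |: C) = E :|: C by rewrite setUCA setUA setD1K.
rewrite eE' re (setUCA X2) (setUCA Y2) !setUA -!setUA in h2.
have [eX2 eY2] : e \notin X2 /\ e \notin Y2.
  by split; apply/negP=> h3; have := setD11 e E; rewrite -e2 inE h3 ?orbT.
have s1 := rfUI r (X1 :|: C) (e |: X2 :|: C); have s2 := rfUI r (Y1 :|: C) (e |: Y2 :|: C).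
rewrite setUACA setUid -setUIl in s1; rewrite setUACA setUid -setUIl in s2.
have i1 : X1 :&: (e |: X2) = X1 :&: X2.
  by apply/setP=> x; rewrite !inE; case: eqVneq => // ->; rewrite (negPf eX1).
have i2 : Y1 :&: (e |: Y2) = Y1 :&: Y2.
  by apply/setP=> x; rewrite !inE; case: eqVneq => // ->; rewrite (negPf eY1).
rewrite i1 in s1; rewrite i2 in s2.
have memE x : x != e -> (x \in E) = (x \in X1) || (x \in Y1).
  by move=> xe; have := congr1 (fun A : {set T} => x \in A) e1; rewrite !inE xe.
have memE2 x : x != e -> (x \in E) = (x \in X2) || (x \in Y2).
  by move=> xe; have := congr1 (fun A : {set T} => x \in A) e2; rewrite !inE xe.
have k1 := h (X1 :&: X2) (Y1 :|: (e |: Y2)).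
have k2 := h (X1 :|: (e |: X2)) (Y1 :&: Y2).
have {}k1 : r (E :|: C) + r C + t <= r (X1 :&: X2 :|: C) + r (Y1 :|: (e |: Y2) :|: C).
  apply: k1; first by rewrite subsetI GX1.
    by rewrite (subset_trans PY1) // subsetUl.
  apply/setP=> x; rewrite !inE; have [->|xe] := eqVneq x e; first by rewrite /= !orbT eE.
  by have := memE x xe; have := memE2 x xe; case: (x \in X1) (x \in X2) (x \in Y1) (x \in Y2) (x \in E) => [] [] [] [] [].
have {}k2 : r (E :|: C) + r C + t <= r (X1 :|: (e |: X2) :|: C) + r (Y1 :&: Y2 :|: C).
  apply: k2; first by rewrite (subset_trans GX1) // subsetUl.
    by rewrite subsetI PY1.
  apply/setP=> x; rewrite !inE; have [->|xe] := eqVneq x e; first by rewrite /= !orbT eE.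
  by have := memE x xe; have := memE2 x xe; case: (x \in X1) (x \in X2) (x \in Y1) (x \in Y2) (x \in E) => [] [] [] [] [].
have h2' : r (e |: X2 :|: C) + r (e |: Y2 :|: C) <= r (E :|: C) + r C + t.
  by rewrite -!setUA; move: h2; clear; lia.
by move: h1 h2' s1 s2 k1 k2 rE; clear; lia.
Qed.
End Linking.
End Density.
Import Density.

(** * Dense contractions contain projective geometries *)

Section ProjectiveContraction.
Variables l q B : nat.
Hypotheses (q_gt1 : 1 < q) (q_le_l : q <= l) (l_lt_qq : l < q * q).
Hypothesis hB : forall T (r : rankfun T) C e0, no_long_line r l ->
  e0 \notin cl r C -> sp q B (cork r (e0 |: C))
    (nP r (e0 |: C) [set f | (f \notin cl r (e0 |: C)) && (q < nP r C (cos r (e0 |: C) f))]).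
Notation PHI := (PHI l q B).
Notation dn := (dn l q B).
Notation beta := (beta l B).

Let l_gt0 : 0 < l. Proof. by move: q_gt1 q_le_l; clear; lia. Qed.

(* L survives the contraction of any element outside a set of bounded rank. *)
Definition escapes N0 R d T (r : rankfun T) (L : {set T} -> Prop) := forall C, L C -> dn d r C ->
  N0 <= cork r C -> exists2 X0 : {set T}, r (X0 :|: C) <= r C + R &
    forall e, e \notin cl r (X0 :|: C) -> L (e |: C).

Section Fixed.
Variables (N0 R d n : nat) (T : finType) (r : rankfun T) (L : {set T} -> Prop).
Hypotheses (U : no_long_line r l) (hL : escapes N0 R d r L) (n_gt0 : 0 < n).
Implicit Types (A C D E F X Y Z G : {set T}) (e f g u x : T).

Lemma rf_leT C : r C <= r setT. Proof. exact/rfS/subsetT. Qed.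

Lemma escape_indep m C : L C -> dn d r C -> N0 + R + m <= cork r C ->
  exists I, [/\ size I = m, L (ext C I) & r (ext C I) = r C + m].
Proof.
elim: m => [|m IH] LC hd le; first by exists [::]; rewrite addn0.
have [|I [sI LI rI]] := IH LC hd; first by move: le; clear; lia.
have hdI : dn d r (ext C I).
  by apply: dn_mono hd => //; rewrite (subset_trans (sub_ext C I)) // sub_cl.
have cI : N0 + R < cork r (ext C I).
  by move: le; rewrite /cork rI; clear; lia.
have [|X0 h0 h1] := hL LI hdI; first by move: cI; clear; lia.
have [|e _ eX] := @ltn_rank_ex T r (X0 :|: ext C I) setT.
  by apply: leq_ltn_trans h0 _; move: cI; rewrite /cork; clear; lia.
exists (e :: I); split; rewrite /= ?sI //; first exact: h1.
by rewrite rf_notin_cl ?rI ?addnS //; apply: contra eX; apply/subsetP/clS/subsetUr.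
Qed.

(** As in [chain_stable_step], the number of points of the flat spanned by I is at most (l + 1)^n
    and rises with each destabilising contraction. Only elements outside E are contracted: there L
    survives and I stays independent. *)
Lemma stabilise s I C : size I = n -> L C -> L (ext C I) -> r (ext C I) = r C + n -> dn d r C ->
  l.+1 ^ n - nP r C (cl r (ext C I)) <= s -> N0 + n + s <= cork r C ->
  exists C1 E, [/\ C \subset cl r C1, L (ext C1 I) /\ L C1, r (ext C1 I) = r C1 + n & cork r C <= cork r C1 + s]
   /\ [/\ is_flat r E, ext C1 I \subset E, r E <= r C1 + n + 2 * R &
    forall f, f \notin E -> nP r (f |: C1) (cl r (f |: cl r (ext C1 I))) <= nP r C1 (cl r (ext C1 I))].
Proof.
move=> sI; elim: s C => [|s IH] C LC LI rI hd hs hk;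
  (have [|X0 h0 h0'] := hL LC hd; first by move: hk; clear; lia);
  (have hdI : dn d r (ext C I) by apply: dn_mono hd => //; rewrite (subset_trans (sub_ext C I)) // sub_cl);
  (have [|X1 h1 h1'] := hL LI hdI; first by move: hk; rewrite /cork rI; clear; lia);
  pose E := cl r (X1 :|: ext C I :|: X0);
  (have rE : r E <= r C + n + 2 * R by
    have := rf_mod r X0 (subset_trans (sub_ext C I) (subsetUr X1 _)); rewrite rf_cl [C :|: X0]setUC;
    move: h0 h1; rewrite rI; clear; lia);
  (have sIE : ext C I \subset E by rewrite (subset_trans _ (sub_cl _ _)) // setUAC subsetUr);
  (have fE f : f \notin E -> [/\ f \notin cl r (ext C I), f \notin cl r C, L (f |: C) & L (f |: ext C I)] by
    move=> h; have h2 : f \notin cl r (ext C I) by [apply: contra h; apply/subsetP; rewrite flat_sub ?flat_cl];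
    split=> //; [apply: contra h2; apply/subsetP/clS/sub_ext |
      apply: h0'; apply: contra h; apply/subsetP/clS; rewrite subUset subsetUr /= (subset_trans (sub_ext C I)) // setUAC subsetUr |
      apply: h1'; apply: contra h; apply/subsetP/clS/subsetUl]);
  (have rf f : f \notin E -> r (ext (f |: C) I) = r (f |: C) + n by
    move=> /fE[h2 h3 _ _]; rewrite ext_U1 !rf_notin_cl // rI addSn).
- exists C, E; split; first by split; rewrite ?sub_cl ?addn0.
  split=> //; first exact: flat_cl.
  move=> f /rf rff; apply: leq_trans (_ : l.+1 ^ n <= _); last by move: hs; clear; lia.
  rewrite clU1_cl -ext_U1; apply: nP_bound => //.
  by rewrite (setUidPl _) ?rf_cl ?rff // (subset_trans (sub_ext _ I)) // sub_cl.
have [hst|hst] := classic (forall f, f \notin E -> nP r (f |: C) (cl r (f |: cl r (ext C I))) <= nP r C (cl r (ext C I))).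
  by exists C, E; split; split; rewrite ?sub_cl ?leq_addr ?flat_cl.
have [f [fnE lt]] : exists f, f \notin E /\ nP r C (cl r (ext C I)) < nP r (f |: C) (cl r (f |: cl r (ext C I))).
  apply: NNPP => none; apply: hst => f fnE; rewrite leqNgt; apply/negP=> lt; apply: none; by exists f.
have [f1 f2 f3 f4] := fE _ fnE.
have cf : cork r C = (cork r (f |: C)).+1 by apply: cork_U1.
have [||||||C1 [E1 [[k1 k2 k3 k4] k5]]] := IH (f |: C).
- by [].
- by rewrite ext_U1.
- exact: rf.
- by apply: dn_mono hd => //; apply: subset_clU1.
- by rewrite ext_U1 -clU1_cl; move: hs lt; clear; lia.
- by move: hk; rewrite cf; clear; lia.
exists C1, E1; split=> //; split=> //; last by rewrite cf; move: k4; clear; lia.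
by rewrite (subset_trans _ (_ : f |: C \subset _)) // subsetUr.
Qed.

Definition longs Z G := [set p | (p \notin G) && (q < nP r Z (cl r (p |: G) :\: G))].

Lemma longs_sparse Z G : is_flat r Z -> is_flat r G -> Z \subset G -> r G = (r Z).+1 ->
  sp q B (cork r G) (nP r G (longs Z G)).
Proof.
move=> fZ fG sZG rG; have [|u uG uZ] := @ltn_rank_ex T r Z G; first by rewrite rG.
have uG' : cl r (u |: Z) = G.
  apply: (flat_eq (r := r)); rewrite ?flat_cl //; first exact: flat_U1.
  by rewrite rf_cl rf_notin_cl // rG.
have := hB U uZ; rewrite -cork_cl -nP_cl uG'; congr (is_true (sp _ _ _ (nP _ _ _))).
by apply/setP=> p; rewrite !inE /cos uG' -uG' clU1_cl.
Qed.

(** The affine count with both orders equal to q. The apex is f itself, which lies in no flat of A,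
    so every line inside A gets q + 1 points. *)
Lemma generic_proj C A f : is_flat r A -> C \subset A -> r A = r C + n -> f \notin A ->
  (forall p, p \in cl r (f |: A) -> p \notin A -> nP r (p |: C) (cl r (p |: A)) <= nP r C A) ->
  (forall Z G p, is_flat r Z -> is_flat r G -> C \subset Z -> Z \subset G -> G \subset A ->
     r G = (r Z).+1 -> p \in cl r (f |: A) -> p \notin A -> p \notin longs Z G) ->
  q ^ n <= nP r C (cos r A f) -> proj r (cl r C) A q.
Proof.
move=> Af sCA rA fA hst hlg hq; pose P := cos r A f.
have sCA' : cl r C \subset A by rewrite flat_sub.
have PP p : p \in P -> p \in cl r (f |: A) /\ p \notin A by case/setDP; rewrite (flatE Af).
have PA p : p \in P -> p \notin A by case/PP.
have Pcl p : p \in P -> cl r (p |: A) = cl r (f |: A).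
  by move=> /PP[h1 h2]; apply: cl_exchange; rewrite ?notin_flat.
have Pl p p' : p \in P -> p' \in P -> p' \in cl r (p |: A).
  by move=> pP /PP[h _]; rewrite (Pcl p).
have fC : f \notin cl r C by apply: contra fA; apply: (subsetP sCA').
have h1 Z u p : is_flat r Z -> cl r C \subset Z -> Z \subset A -> u \in A -> u \notin Z -> p \in P ->
    nP r Z (P :&: cl r (p |: (u |: Z))) <= mult f q q Z (cl r (u |: Z)).
  move=> fZ sCZ sZA uA uZ pP; rewrite /mult if_same; have [p1 p2] := PP _ pP.
  have sGA : cl r (u |: Z) \subset A by apply: flat_U1.
  have := hlg Z (cl r (u |: Z)) p fZ (flat_cl _ _) _ (subset_clU1 _ _ _) sGA _ p1 p2.
  rewrite (subset_trans (sub_cl r C)) // rf_cl rf_notin_cl ?notin_flat // inE => /(_ isT erefl).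
  have pG : p \notin cl r (u |: Z) by apply: contra p2; apply: (subsetP sGA).
  rewrite pG /= -leqNgt; apply: leq_trans; apply: nPS; apply/subsetP=> g /setIP[gP gp].
  rewrite in_setD clU1_cl gp andbT; apply: contra (PA g gP); exact: (subsetP sGA).
have h2 : wt r (cl r C) f q q A <= nP r (cl r C) P.
  by rewrite /wt (negPf fA) rf_cl rA addKn nP_cl.
have h3 p p' : p \in P -> p' \in P -> p' \notin cl r (p |: cl r C) ->
    exists2 u, u \in A /\ u \notin cl r C & u \in cl r (p' |: (p |: cl r C)).
  move=> pP p'P; rewrite clU1_cl => p'C; have [p1 p2] := PP _ pP.
  have [u hu1 hu2] := stable_meet Af sCA p2 (hst p p1 p2) (Pl _ _ pP p'P) p'C.
  by exists u => //; apply: subsetP hu2; apply/clS/setUS/setUS/sub_cl.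
split=> //; first exact: flat_cl.
move=> Z1 Z2 f1 f2 s1 s12 s2 r2.
apply: (line_card (flat_cl _ _) Af sCA' fC PA Pl h1 h2 h3 (ltnW q_gt1) q_gt1) => //.
by apply: contra fA; apply: (subsetP s2).
Qed.

(* If no generic line-coset is full, the contraction by A is denser than M/C. *)
Lemma proj_or_dense C A E : is_flat r A -> C \subset A -> r A = r C + n ->
  is_flat r E -> A \subset E -> r E <= r A + 2 * R ->
  (forall f, f \notin E -> nP r (f |: C) (cl r (f |: A)) <= nP r C A) ->
  proj r (cl r C) A q \/ exists2 w, sp q ((2 ^ l.+1 ^ n) ^ 2 * (B * q.*2.-1 ^ n)) (cork r A) w &
    nP r C setT <= (q ^ n).-1 * nP r A setT + (l.+1 ^ n + l.+1 ^ n.+1 * (l.+1 ^ (2 * R) + w)).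
Proof.
move=> Af sCA rA Ef sAE rE hst; set N := 2 ^ l.+1 ^ n.
pose FL := [set F : {set T} | [&& is_flat r F, C \subset F & F \subset A]].
have cFL : #|FL| <= N.
  apply: leq_trans (flats_card r _ _) _; rewrite leq_exp2l //; apply: nP_bound => //.
  by rewrite (setUidPl sCA) rA.
pose V := [set ZG : {set T} * {set T} | [&& ZG.1 \in FL, ZG.2 \in FL, ZG.1 \subset ZG.2 & r ZG.2 == (r ZG.1).+1]].
have cV : #|V| <= N ^ 2.
  apply: leq_trans (_ : #|setX FL FL| <= _); last by rewrite cardsX leq_mul.
  by apply: subset_leq_card; apply/subsetP=> -[Z G]; rewrite !inE /= => /and4P[-> ->].
pose W := \bigcup_(ZG in V) longs ZG.1 ZG.2.
have spW : sp q (N ^ 2 * (B * q.*2.-1 ^ n)) (cork r A) (nP r A W).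
  apply: (sp_mono (B := #|V| * (B * q.*2.-1 ^ n)) _ (nP_bigcup r A V _)); first by rewrite leq_mul2r cV orbT.
  apply: sp_sum => -[Z G]; rewrite !inE /= => /and4P[/and3P[fZ sCZ sZA] /and3P[fG sCG sGA] sZG /eqP rG].
  apply: (sp_mono (leqnn _) (K := nP r G (longs Z G))).
    by apply: nP_contract; rewrite (subset_trans sGA) // sub_cl.
  apply: (@sp_drop _ _ _ (r A - r G)) => //.
    by have := rfS r sCG; rewrite rA; clear; lia.
  rewrite (_ : cork r A + _ = cork r G); first exact: longs_sparse.
  by have := rfS r sGA; have := rf_leT A; rewrite /cork; clear; lia.
have inE' f p : f \notin E -> p \in cl r (f |: A) -> p \notin A -> p \notin E.
  move=> fE pf pA; apply: contra fE => pE; have : f \in cl r (p |: A).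
    by apply: exchange; rewrite ?notin_flat.
  by apply/subsetP/flat_U1.
have [hp|nproj] := classic (proj r (cl r C) A q); [by left | right].
exists (nP r A W) => //.
(* A coset off E and without long lines that had q^n points would make A projective by
   [generic_proj]. *)
have few F : F \in pts r A setT -> F \notin pts r A E -> F \notin pts r A W ->
    nP r C (setT :&: (F :\: cl r A)) <= (q ^ n).-1.
  move=> /ptsP[f [_ fA] ->] fE fW; rewrite setTI -ltnS prednK ?expn_gt0 ?(ltnW q_gt1) //.
  have fE' : f \notin E by apply: contra fE => h; apply: mem_pts.
  rewrite ltnNge; apply/negP=> hq; apply: nproj; rewrite notin_flat // in fA.
  apply: (generic_proj Af sCA rA fA) hq; first by move=> p p1 p2; apply: hst; apply: inE' p1 p2.
  move=> Z G p fZ fG sCZ sZG sGA rG p1 p2; apply: contra fW => pl.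
  have -> : cl r (f |: A) = cl r (p |: A) by symmetry; apply: cl_exchange; rewrite ?notin_flat.
  apply: mem_pts; rewrite ?notin_flat //; apply/bigcupP; exists (Z, G) => //.
  by rewrite !inE /= fZ fG sCZ sGA sZG rG eqxx (subset_trans sZG sGA) (subset_trans sCZ sZG).
have all F : F \in pts r A setT -> nP r C (setT :&: (F :\: cl r A)) <= l.+1 ^ n.+1.
  move=> /ptsP[f [_ fA] ->]; apply: nP_bound => //; rewrite addnS -rA.
  apply: leq_trans (_ : r (cl r (f |: A)) <= _); last by rewrite rf_cl rfU1.
  apply: rfS; rewrite setTI subUset subsetDl (subset_trans sCA) //; exact: subset_clU1.
apply: leq_trans (nP_splitD r C setT (cl r A)) _; rewrite nP_partition ?(subset_trans sCA) ?sub_cl //.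
rewrite addnCA [X in X <= _]addnC; apply: leq_add.
  apply: nP_bound => //; rewrite setTI (flatE Af) (setUidPl sCA) rA //.
pose K1 := l.+1 ^ n.+1.
apply: leq_trans (_ : \sum_(F in pts r A setT) ((q ^ n).-1 + K1 * ((F \in pts r A E) + (F \in pts r A W))) <= _).
  apply: leq_sum => F hF; have := all F hF; have := few F hF.
  case: (F \in pts r A E) => /=; first by move=> _ h; apply: leq_trans h _; rewrite /K1; move: (l.+1 ^ n.+1) => y; case: (_ \in _); clear; nia.
  case: (F \in pts r A W) => /= h h2; first by rewrite add0n muln1; apply: leq_trans h2 (leq_addl _ _).
  by rewrite addn0 muln0 addn0; apply: h.
rewrite big_split /= sum_nat_const mulnC -/(nP r A setT) leq_add2l -big_distrr /= leq_mul2l.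
apply/orP; right; rewrite big_split /=.
have cnt X : \sum_(F in pts r A setT) (F \in pts r A X : nat) <= nP r A X.
  rewrite /nP -sum1_card big_mkcond [X in _ <= X]big_mkcond /=.
  by apply: leq_sum => F _; case: (F \in pts r A setT) => //=; case: (F \in pts r A X).
apply: leq_add => //; apply: leq_trans (cnt E) _; apply: nP_bound => //.
by rewrite (setUidPl sAE).
Qed.

(** With g = q^n, missing one of g points in each coset multiplies the normalised count by g / (g -
    1). The gap hypothesis makes all errors cost one unit of j, and (j - 1) g / (g - 1) >= j + 1
    because j >= 2g. *)
Lemma PHI_grow C A (w j M K1 K2 D : nat) : cork r C = cork r A + n -> 2 * q ^ n <= j ->
  sp q D (cork r A) w -> nP r C setT <= (q ^ n).-1 * nP r A setT + (K1 + K2 * w) ->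
  M * (K1 + K2 * (2 ^ n * D) + beta) * q.*2.-1 ^ cork r C <= q.*2 ^ cork r C ->
  j * q.*2 ^ cork r C <= M * PHI r C -> j.+1 * q.*2 ^ cork r A <= M * PHI r A.
Proof.
move=> ck hj hw hn hgap hPC.
have g1 : 1 < q ^ n by rewrite -(exp1n n) ltn_exp2r.
have x1 : 1 < q.*2.-1 by move: q_gt1; clear; lia.
have hz : 2 ^ (cork r A + n) <= q.*2.-1 ^ (cork r A + n).
  by case: (_ + n) => // k; rewrite leq_exp2r //.
have hxz : q.*2.-1 ^ cork r A <= q.*2.-1 ^ (cork r A + n) by rewrite leq_exp2l // leq_addr.
have ea : q.*2 ^ (cork r A + n) = q.*2 ^ cork r A * (q ^ n * 2 ^ n).
  by rewrite expnD -[X in _ * X ^ n]muln2 expnMn.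
have hp : 2 ^ cork r A * nP r A setT <= PHI r A by rewrite /Density.PHI leq_addr.
move: hPC hgap; rewrite {1}/Density.PHI ck ea => hPC hgap.
rewrite expnD in hz.
have h0 : 0 < 2 ^ n by rewrite expn_gt0.
have {}hPC : j * (q.*2 ^ cork r A * (q ^ n * 2 ^ n)) <=
   M * (2 ^ n * ((q ^ n).-1 * PHI r A)) + q.*2 ^ cork r A * (q ^ n * 2 ^ n).
  apply: leq_trans hPC _; apply: leq_trans (leq_add (leqnn _) hgap).
  rewrite -mulnA -mulnDr leq_mul2l; apply/orP; right; rewrite expnD.
  move: hz hxz hw hn hp; rewrite /sp; move: (2 ^ cork r A) (2 ^ n) (q.*2.-1 ^ _) (q.*2.-1 ^ _) => c h y z.
  move: (nP r C setT) (nP r A setT) ((q ^ n).-1) (PHI r A) (beta) => nC nA g p b hz hxz hw hn hp.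
  apply: leq_trans (_ : c * h * (g * nA + (K1 + K2 * w)) + b * z <= _).
    by rewrite leq_add2r leq_mul2l hn orbT.
  have -> : c * h * (g * nA + (K1 + K2 * w)) = h * (g * (c * nA)) + ((c * h) * K1 + K2 * (h * (c * w))) by clear; nia.
  have -> : (K1 + K2 * (h * D) + b) * z = z * K1 + K2 * (h * (D * z)) + b * z by clear; nia.
  rewrite [X in _ <= X]addnA leq_add2r; apply: leq_add; first by rewrite !leq_mul2l hp !orbT.
  apply: leq_add; first by rewrite leq_mul2r hz orbT.
  rewrite !leq_mul2l (leq_trans hw) ?orbT // leq_mul2l hxz orbT //.
move: hPC g1 hj h0; move: (2 ^ n) (q ^ n) (q.*2 ^ _) (PHI r A) => h g a p hPC g1 hj h0.
have {}hPC : j * (a * g) <= M * (g.-1 * p) + a * g.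
  rewrite -(leq_pmul2l h0); move: hPC; move: (g.-1) => gg; clear.
  have -> : h * (j * (a * g)) = j * (a * (g * h)) by nia.
  by have -> : h * (M * (gg * p) + a * g) = M * (h * (gg * p)) + a * (g * h) by nia.
case: g g1 hj hPC => [|[|g]] //= _ hj hPC.
suff : g.+1 * (j.+1 * a) <= g.+1 * (M * p) by rewrite leq_pmul2l.
have [i ei] : exists i, j = 2 * g.+2 + i by exists (j - 2 * g.+2); move: hj; clear; lia.
move: hPC; rewrite ei; clear; nia.
Qed.
End Fixed.

(** The index j measures density in units of 1 / M; M is chosen so that density q^(-d) gives j = 2
    q^n. Each failure to find a geometry raises j by [PHI_grow], and [PHI_le] keeps it below M
    beta. *)
Lemma proj_contraction_index N0 R d n j : 0 < n -> 2 * q ^ n <= j -> exists N,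
  forall T (r : rankfun T) (L : {set T} -> Prop) C, no_long_line r l -> escapes N0 R d r L ->
  L C -> N <= cork r C -> j * q.*2 ^ cork r C <= 2 * q ^ (n + d) * PHI r C ->
  exists C' A, [/\ C \subset cl r C', L C', proj r (cl r C') A q & r A = r C' + n].
Proof.
move=> n0; set M := 2 * q ^ (n + d).
have [s] := ubnP ((M * beta).+1 - j); elim: s j => // s IH j lts hj.
have q0 : 0 < q by apply: ltnW.
have [jb|jb] := ltnP (M * beta) j.
  exists 0 => T r L C U _ _ _ h; have := leq_trans h (leq_mul (leqnn M) (PHI_le q_gt1 q_le_l hB U C)).
  by rewrite mulnA leq_pmul2r ?expn_gt0 ?double_gt0 ?q0 // leqNgt jb.
have [||N1 hN1] := IH j.+1; [by move: lts jb; clear; lia | by move: hj; clear; lia |].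
pose K := l.+1 ^ n; pose K1 := l.+1 ^ n + l.+1 ^ n.+1 * l.+1 ^ (2 * R).
pose D := (2 ^ l.+1 ^ n) ^ 2 * (B * q.*2.-1 ^ n).
have [N2 hN2] := geom_gap q_gt1 (M * (K1 + l.+1 ^ n.+1 * (2 ^ n * D) + beta)).
exists (N1 + N2 + N0 + R + n + n + K) => T r L C U hL LC hk hPC.
have hd : dn d r C.
  rewrite /Density.dn; have : 2 * q ^ n * q.*2 ^ cork r C <= 2 * q ^ n * (q ^ d * PHI r C).
    apply: leq_trans (leq_trans _ hPC) _; first by rewrite leq_mul2r hj orbT.
    by rewrite /M expnD !mulnA.
  by rewrite leq_pmul2l // muln_gt0 expn_gt0 q0.
have [|I [sI LI rI]] := escape_indep (m := n) U hL LC hd; first by move: hk; clear; lia.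
have [||C1 [E [[sC [LI1 L1] rI1 ck] [Ef sE rE hst]]]] := stabilise (s := K) U hL sI LC LI rI hd.
- exact: leq_subr.
- by move: hk; clear; lia.
pose A := cl r (ext C1 I).
have Af : is_flat r A by apply: flat_cl.
have sCA : C1 \subset A by rewrite (subset_trans (sub_ext C1 I)) // sub_cl.
have rA : r A = r C1 + n by rewrite rf_cl.
have sAE : A \subset E by rewrite flat_sub.
have rE' : r E <= r A + 2 * R by rewrite rA.
have [hp|[w hw hn]] := proj_or_dense U Af sCA rA Ef sAE rE' hst; first by exists C1, A.
have ckA : cork r C1 = cork r A + n.
  by have := rf_leT r A; rewrite /cork rA; clear; lia.
have hPC1 : j * q.*2 ^ cork r C1 <= M * PHI r C1.
  have h1 := PHI_mono q_gt1 q_le_l hB U sC.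
  have p0 : 0 < q.*2 ^ cork r C by rewrite expn_gt0 double_gt0 q0.
  rewrite -(leq_pmul2l p0); apply: leq_trans (_ : M * PHI r C * q.*2 ^ cork r C1 <= _).
    by rewrite mulnCA mulnA leq_mul2r hPC orbT.
  by rewrite -mulnA [X in _ <= X]mulnCA leq_mul2l [X in _ || (_ <= X)]mulnC h1 orbT.
have hPA : j.+1 * q.*2 ^ cork r A <= M * PHI r A.
  apply: (@PHI_grow n T r n0 C1 A w j M K1 (l.+1 ^ n.+1) D) => //.
    apply: leq_trans hn _; rewrite leq_add2l /K1 mulnDr addnA //.
  by apply: hN2; move: hk ck; clear; lia.
have [||C' [A' [k1 k2 k3 k4]]] := hN1 T r L (ext C1 I) U hL LI1.
- by rewrite -cork_cl -/A; move: ckA ck hk; clear; lia.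
- by rewrite -cork_cl -PHI_cl.
exists C', A'; split=> //; rewrite (subset_trans sC) // cl_sub (subset_trans (sub_ext C1 I)) //.
Qed.

Lemma proj_contraction N0 R d n : 0 < n -> exists N,
  forall T (r : rankfun T) (L : {set T} -> Prop) C, no_long_line r l -> escapes N0 R d r L ->
  L C -> dn d r C -> N <= cork r C ->
  exists C' A, [/\ C \subset cl r C', L C', proj r (cl r C') A q & r A = r C' + n].
Proof.
move=> n0; have [N hN] := @proj_contraction_index N0 R d n (2 * q ^ n) n0 (leqnn _).
exists N => T r L C U hL LC hd hk; apply: hN hL LC hk _ => //.
by rewrite expnD mulnA -[X in _ <= X]mulnA leq_mul2l [X in _ || X]hd orbT.
Qed.

(** While the corank exceeds n + R, some element lies outside the span of A and of the set where L
    may be lost. It is skew to A, so contracting it preserves L and, by [proj_contract], the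
    geometry. *)
Lemma proj_descend N0 R d n T (r : rankfun T) (L : {set T} -> Prop) C A : no_long_line r l ->
  escapes N0 R d r L -> N0 <= n -> 3 <= n -> L C -> dn d r C -> proj r (cl r C) A q -> r A = r C + n ->
  exists C' A' : {set T}, [/\ C \subset C', L C', proj r (cl r C') A' q, r A' = r C' + n & cork r C' <= n + R].
Proof.
move=> U hL N0n n3; have [m] := ubnP (cork r C); elim: m C A => // m IH C A lt LC hd pA rA.
have [le|gt] := leqP (cork r C) (n + R); first by exists C, A.
have [Cf Af sCA _] := pA.
have [|X0 h0 h1] := hL C LC hd; first by move: gt N0n; clear; lia.
have sCA' : C \subset A by rewrite (subset_trans (sub_cl r C)).
have [|e _ eX] := @ltn_rank_ex T r (A :|: X0) setT.
  have := rf_mod r X0 sCA'; rewrite [C :|: X0]setUC; move: h0 gt; rewrite /cork rA; clear; lia.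
have eA : e \notin A by apply: contra eX => h; apply: mem_cl; rewrite inE h.
have eA' : e \notin cl r A by rewrite notin_flat.
have eC : e \notin cl r C by apply: contra eA; apply: (subsetP sCA).
have LeC : L (e |: C).
  by apply: h1; apply: contra eX; apply/subsetP/clS; rewrite setUC setSU.
have pA' : proj r (cl r (e |: C)) (cl r (e |: A)) q.
  have := @proj_contract T r l (cl r C) A (e |: cl r C) q U l_lt_qq pA.
  rewrite clU1_cl -setUA (setUidPr sCA) !rf_cl; apply.
  - by rewrite rA leq_add2l.
  - exact: subsetUr.
  - by rewrite (rf_notin_cl eA') -(rf_cl r (e |: cl r C)) clU1_cl rf_cl rf_notin_cl //; clear; lia.
have [|||||C' [A2 [k1 k2 k3 k4 k5]]] := IH (e |: C) (cl r (e |: A)).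
- by move: lt; rewrite (cork_U1 eC); clear; lia.
- exact: LeC.
- by apply: dn_mono hd => //; apply: subset_clU1.
- exact: pA'.
- by rewrite rf_cl !rf_notin_cl // rA addSn.
exists C', A2; split=> //; by rewrite (subset_trans _ k1) // subsetUr.
Qed.
End ProjectiveContraction.

(** * The induction *)

Section Gbin.
Variable q : nat.
Hypothesis q_gt1 : 1 < q.
Notation gbin := (gbin q).

Lemma gbin0 n : gbin n 0 = 1. Proof. by case: n. Qed.

Lemma gbin_leS n m : gbin n m <= gbin n.+1 m.
Proof.
case: m => [|m]; first by rewrite !gbin0.
rewrite gbinS; apply: leq_trans (leq_addl _ _).
by rewrite leq_pmull // expn_gt0 (ltnW q_gt1).
Qed.

Lemma gbin_le n n' m : n <= n' -> gbin n m <= gbin n' m.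
Proof.
move=> /subnK <-; elim: (n' - n) => // i IH; apply: leq_trans IH _; exact: gbin_leS.
Qed.

Lemma gbin_powS n m : q ^ m * gbin n m <= gbin n.+1 m.
Proof. by case: m => [|m]; rewrite ?gbin0 // gbinS leq_addl. Qed.

Lemma gbin_pow n m : m <= n -> q ^ (m * (n - m)) <= gbin n m.
Proof.
elim: n m => [|n IH] [|m] //= le.
have [e|lt] := eqVneq m n.
  rewrite e subnn muln0 expn0; apply: leq_trans (leq_addr _ _).
  by apply: leq_trans (IH n _); rewrite ?expn_gt0 ?(ltnW q_gt1).
have {}lt : m < n by rewrite ltn_neqAle lt.
apply: leq_trans (leq_addl _ _); apply: leq_trans (leq_mul (leqnn _) (IH m.+1 lt)).
rewrite -expnD leq_exp2l // -mulnS; by rewrite leq_mul2l; move: lt; clear; lia.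
Qed.

Lemma gbin_small n m : n < m -> gbin n m = 0.
Proof.
elim: n m => [|n IH] [|m] //= lt; rewrite IH // IH ?muln0 //; exact: ltnW.
Qed.

(** The other q-Pascal rule; compared with the defining one it gives the ratio of consecutive
    coefficients used in [gbin_ratio]. *)
Lemma gbinS' n m : m <= n -> gbin n.+1 m.+1 = q ^ (n - m) * gbin n m + gbin n m.+1.
Proof.
elim: n m => [|n IH] [|m] le //.
- by rewrite gbinS subnn expn0 /= muln0.
- by rewrite gbinS [in LHS](IH 0) // [gbin n.+1 1]gbinS !gbin0 !subn0 expn1 expnS; clear; nia.
rewrite gbinS [in LHS](IH m) //; have [->|ne] := eqVneq m n.
  rewrite subnn (@gbin_small n n.+1) // (gbin_small (ltnSn n.+1)) !muln0.
  by rewrite [gbin n.+1 n.+1]gbinS (@gbin_small n n.+1) // subnn; clear; lia.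
have lt : m < n by rewrite ltn_neqAle ne.
rewrite [in LHS](IH m.+1) // [gbin n.+1 m.+2]gbinS [gbin n.+1 m.+1]gbinS subSS.
have -> : q ^ (n - m) = q ^ (n - m.+1) * q by rewrite -expnSr; congr (_ ^ _); move: lt; clear; lia.
rewrite !expnS; move: (q ^ (n - m.+1)) (q ^ m) (gbin n m) (gbin n m.+1) (gbin n m.+2) => a b x y z.
by clear; nia.
Qed.

Lemma gbin_ratio c m : exists N, forall n, N <= n -> c * gbin n m <= gbin n m.+1.
Proof.
exists (m + (c * q ^ m.+1).+1) => n hn.
have le : m <= n by apply: leq_trans hn; apply: leq_addr.
have h : (c * q ^ m.+1).+1 <= q ^ (n - m).
  by apply: leq_trans (_ : n - m <= _); [move: hn; clear; lia | apply/ltnW/ltn_expl].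
have := gbinS' le; rewrite gbinS.
have p0 : 0 < q ^ m.+1 by rewrite expn_gt0 (ltnW q_gt1).
move=> e; rewrite -(leq_pmul2l p0).
move: h e; move: (q ^ m.+1) (q ^ (n - m)) (gbin n m) (gbin n m.+1) => a b x y h e.
have : (c * a).+1 * x <= b * x by rewrite leq_mul2r h orbT.
by rewrite mulSn mulnA [a * c]mulnC; move: e; clear; lia.
Qed.

Lemma gbin_sum c m : exists N, forall n, N <= n -> c * \sum_(j < m) gbin n j <= gbin n m.
Proof.
elim: m => [|m [N IH]]; first by exists 0 => n _; rewrite big_ord0 muln0.
have [N' hN'] := gbin_ratio c.+1 m; exists (N + N') => n hn; rewrite big_ord_recr /= mulnDr.
apply: leq_trans (hN' n _); last by apply: leq_trans hn; apply: leq_addl.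
by rewrite mulSn leq_add2r; apply: IH; apply: leq_trans hn; apply: leq_addr.
Qed.

End Gbin.

(** Lets any constant factor be absorbed into some (3/2)^s. *)
Lemma pow32 c : exists s, 2 ^ s * c <= 3 ^ s.
Proof.
have h s : 2 ^ s * (s + 2) <= 2 * 3 ^ s.
  elim: s => // s IH; rewrite !expnS; move: IH; move: (2 ^ s) (3 ^ s) => a b; clear; nia.
exists (2 * c); have := h (2 * c); move: (2 ^ _) (3 ^ _) => a b; clear; nia.
Qed.

(** * Flats across a separation *)

Section Split.
Variables (l : nat) (T : finType) (r : rankfun T) (C X : {set T}) (R : nat).
Hypotheses (l_gt0 : 0 < l) (U : no_long_line r l) (Cf : is_flat r C).
Hypothesis rX : r (X :|: C) <= r C + R.
Notation Y := (~: X :|: C).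
Notation r' := (rst r Y).
Notation C' := (cl r' C).

Let sCY : C \subset Y. Proof. exact: subsetUr. Qed.

Lemma rst_flat F : is_flat r F -> C \subset F ->
  [/\ is_flat r' (F :|: ~: Y), C' \subset F :|: ~: Y & r' (F :|: ~: Y) = r (F :&: Y)].
Proof.
move=> Ff sCF; have e : (F :|: ~: Y) :&: Y = F :&: Y.
  by rewrite setIUl [~: Y :&: Y]setIC setICr setU0.
split; last by rewrite rstE e.
- rewrite /is_flat eqEsubset sub_cl andbT; apply/subsetP=> x; rewrite clE !rstE e.
  rewrite in_setU in_setC; have [xY|] := boolP (x \in Y); rewrite ?orbT // orbF.
  rewrite setIUl (setIidPl (_ : [set x] \subset Y)) ?sub1set // e => h.
  have : x \in cl r (F :&: Y) by rewrite clE.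
  by apply/subsetP; rewrite flat_sub // subsetIl.
by rewrite cl_rst // (flatE Cf); apply: setSU.
Qed.

(** A flat whose trace on Y has full rank is the closure of that trace. Any other is determined by
    its trace on the span of X, for which there are boundedly many choices, and its trace on Y, a
    flat of smaller rank. *)
Lemma Wf_split m : Wf r C setT m <=
  Wf r' C' setT m + 2 ^ l.+1 ^ R * \sum_(j < m) Wf r' C' setT j.
Proof.
rewrite {1}/Wf; set W := [set F | _].
have WP F : F \in W -> [/\ is_flat r F, C \subset F & r F = r C + m].
  by rewrite inE => /and4P[? ? _ /eqP].
have rC' : r' C' = r C by rewrite rf_cl rst_in.
have rF F : F \in W -> r C <= r (F :&: Y) /\ r (F :&: Y) <= r C + m.
  move=> /WP[Ff sCF rF]; split; first by apply: rfS; rewrite subsetI sCF.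
  by rewrite -rF; apply/rfS/subsetIl.
pose V := [set F : {set T} | r (F :&: Y) == r C + m].
rewrite -(cardsID V W); apply: leq_add.
  have inj : {in W :&: V &, injective (fun F => F :|: ~: Y)}.
    have half F G : F \in W :&: V -> G \in W :&: V -> F :|: ~: Y = G :|: ~: Y -> F \subset G.
      move=> /setIP[/WP[Ff sCF rk] FV] /setIP[/WP[Gf _ _] _] e.
      have eF : cl r (F :&: Y) = F.
        rewrite -[RHS](flatE Ff); apply: cl_eq_rank; first by rewrite (flatE Ff) subsetIl.
        by move: FV; rewrite inE rk => /eqP ->.
      rewrite -eF flat_sub //; apply/subsetP=> x /setIP[xF xY].
      by have : x \in G :|: ~: Y; [rewrite -e inE xF | rewrite in_setU in_setC xY orbF].
    by move=> F G FW GW e; apply/eqP; rewrite eqEsubset (half F G) // (half G F).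
  rewrite -(card_in_imset inj) /Wf; apply: subset_leq_card; apply/subsetP=> _ /imsetP[F /setIP[FW FV] ->].
  have [Ff sCF rk] := WP F FW; have [k1 k2 k3] := rst_flat Ff sCF.
  by rewrite inE k1 k2 subsetT k3 rC'; move: FV; rewrite inE.
pose FX := [set F : {set T} | [&& is_flat r F, C \subset F & F \subset cl r (X :|: C)]].
pose FY := [set F : {set T} | [&& is_flat r' F, C' \subset F & r' F < r C + m]].
have cX : #|FX| <= 2 ^ l.+1 ^ R.
  apply: leq_trans (flats_card r _ _) _; rewrite leq_exp2l //; apply: nP_bound => //.
  by rewrite (setUidPl _) ?rf_cl // (subset_trans (subsetUr X C)) // sub_cl.
have cY : #|FY| <= \sum_(j < m) Wf r' C' setT j.
  have sub : FY \subset \bigcup_(j in [set: 'I_m]) [set F : {set T} | [&& is_flat r' F, C' \subset F, F \subset setT & r' F == r' C' + j]].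
    apply/subsetP=> F; rewrite inE => /and3P[Ff sF lt].
    have le := rfS r' sF; rewrite rC' in le.
    have jm : r' F - r C < m by move: lt le; clear; lia.
    apply/bigcupP; exists (Ordinal jm); first by rewrite inE.
    by rewrite inE Ff sF subsetT rC'; apply/eqP; symmetry; apply: subnKC le.
  apply: leq_trans (subset_leq_card sub) _; apply: leq_trans (card_bigcup_le _ _) _.
  by rewrite big_mkcond /= leq_sum // => j _; rewrite inE.
have inj : {in W :\: V &, injective (fun F => (F :&: cl r (X :|: C), F :|: ~: Y))}.
  have half F G : F \in W -> F :&: cl r (X :|: C) = G :&: cl r (X :|: C) -> F :|: ~: Y = G :|: ~: Y -> F \subset G.
    move=> /WP[_ sCF _] e1 e2; apply/subsetP=> x xF.
    have [xX|xX] := boolP (x \in X).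
      have : x \in F :&: cl r (X :|: C) by rewrite inE xF mem_cl // inE xX.
      by rewrite e1 => /setIP[].
    have : x \in F :|: ~: Y by rewrite inE xF.
    by rewrite e2 in_setU in_setC in_setU in_setC xX orbF.
  by move=> F G /setDP[FW _] /setDP[GW _] [e1 e2]; apply/eqP; rewrite eqEsubset (half F G) // (half G F).
rewrite -(card_in_imset inj); apply: leq_trans (leq_mul cX cY); rewrite -cardsX.
apply: subset_leq_card; apply/subsetP=> _ /imsetP[F /setDP[FW FV] ->].
have [Ff sCF rk] := WP F FW; have [k1 k2 k3] := rst_flat Ff sCF.
have [_ le] := rF F FW; rewrite inE /= !inE k1 k2 k3 subsetIr subsetI sCF.
rewrite (subset_trans (subsetUr X C)) ?sub_cl // flatI ?flat_cl //= ltn_neqAle le andbT.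
by move: FV; rewrite inE.
Qed.
End Split.

(** * Descent on the factor (3/2)^s *)

Section MainInduction.
Variables l q B : nat.
Hypotheses (q_gt1 : 1 < q) (q_le_l : q <= l) (l_lt_qq : l < q * q).
Hypothesis hB : forall T (r : rankfun T) C e0, no_long_line r l ->
  e0 \notin cl r C -> sp q B (cork r (e0 |: C))
    (nP r (e0 |: C) [set f | (f \notin cl r (e0 |: C)) && (q < nP r C (cos r (e0 |: C) f))]).
Notation PHI := (PHI l q B).
Notation dn := (dn l q B).
Notation beta := (beta l B).

Let l_gt0 : 0 < l. Proof. by move: q_gt1 q_le_l; clear; lia. Qed.

(** As G is skew to D, sending H to cl (D :|: H) embeds the hyperplanes of G avoiding e into those
    of a projective interval, where [hypers_card] counts them. *)
Lemma hypers_skew T (r : rankfun T) (C D G : {set T}) e k : is_flat r C -> is_flat r G -> C \subset G ->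
  C \subset D -> is_flat r D -> r (D :|: G) + r C = r D + r G -> e \in G -> e \notin C -> r G = r C + k.+1 ->
  proj r D (cl r (D :|: G)) q -> #|hypers r C G e| <= q ^ k.
Proof.
move=> Cf Gf sCG sCD Df sk eG eC rG pG.
have HP H : H \in hypers r C G e -> [/\ is_flat r H, C \subset H, H \subset G, r G = (r H).+1 & e \notin H].
  by rewrite inE => /and5P[? ? ? /eqP ? ?].
have inj : {in hypers r C G e &, injective (fun H => cl r (D :|: H))}.
  have half H1 H2 : H1 \in hypers r C G e -> H2 \in hypers r C G e -> cl r (D :|: H1) = cl r (D :|: H2) -> H1 \subset H2.
    move=> /HP[_ _ s1 _ _] /HP[f2 c2 s2 _ _] e12; apply/subsetP=> x x1.
    apply: (skew_meet sCD c2 s2 f2 sk); first exact: (subsetP s1).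
    by rewrite -e12; apply: mem_cl; rewrite inE x1 orbT.
  by move=> H1 H2 h1 h2 e12; apply/eqP; rewrite eqEsubset (half H1 H2) // (half H2 H1).
have eD : e \notin D.
  apply: contra eC => h; apply: (skew_meet sCD (subxx C) sCG Cf sk eG).
  by apply: mem_cl; rewrite inE h.
rewrite -(card_in_imset inj).
apply: leq_trans (_ : #|hypers r D (cl r (D :|: G)) e| <= _); last first.
  apply: (hypers_card pG) => //; first by apply: mem_cl; rewrite inE eG orbT.
  by rewrite rf_cl; move: sk rG; clear; lia.
apply: subset_leq_card; apply/subsetP=> _ /imsetP[H /HP[Hf sCH sHG rH eH] ->].
have skH := skew_sub sCD sCH sHG sk.
rewrite inE flat_cl (subset_trans (subsetUl D H) (sub_cl _ _)) (clS _ (setUS _ sHG)) !rf_cl /=.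
apply/andP; split.
  by apply/eqP; move: sk skH rH; clear; lia.
by apply: contra eH; apply: (skew_meet sCD sCH sHG Hf sk eG).
Qed.

(** The condition on X makes G linked, and linkedness is carried along down to a geometry A2 of rank
    n in a contraction of rank at most n + R. Then [linking] contracts to some D that is skew to A2.
    The connectivity k + 1 is the whole rank of G over C, so G is skew to D too and lies in the span
    of A2 and D. *)
Lemma good_flats k d : exists N R, forall T (r : rankfun T) (C G : {set T}) e, no_long_line r l -> is_flat r C ->
  dn d r C -> N <= cork r C -> (forall X, r (X :|: C) <= r C + R -> r (~: X :|: C) = r setT) ->
  is_flat r G -> C \subset G -> e \in G -> e \notin C -> r G = r C + k.+1 ->
  #|hypers r C G e| <= q ^ k.
Proof.
pose t := k.+1; pose R := t + 2 + d + beta.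
have [N1 hN1] := dichotomy q_gt1 q_le_l hB d t.
have [N0 hN0] := Linked_step q_gt1 q_le_l hB d t.
pose n := 3 + N0 + R + 2 * t.
have [|N2 hN2] := proj_contraction q_gt1 q_le_l hB N0 R d (n := n); first by rewrite /n.
exists (N1 + N2), R => T r C G e U Cf hd hk conn Gf sCG eG eC rG.
have LC : Linked t r G C.
  move=> X sGX h; rewrite ltnNge; apply/negP=> h2.
  have h3 : r (X :|: C) <= r C + R.
    apply: hN1 => //; [by move: hk; clear; lia | by move: h; clear; lia | by move: h2; clear; lia].
  have h4 := conn X h3.
  have : r G <= r (X :|: C) by apply: rfS; rewrite (subset_trans sGX) // subsetUl.
  by move: h; rewrite h4 rG /t; clear; lia.
have hesc : escapes l q B N0 R d r (Linked t r G) by move=> D LD hdD kD; apply: hN0.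
have [|C1 [A1 [sC1 L1 pA1 rA1]]] := hN2 T r _ C U hesc LC hd; first by move: hk; clear; lia.
have hd1 : dn d r C1 by apply: dn_mono hd.
have [||C2 [A2 [sC2 L2 pA2 rA2 ck2]]] := proj_descend q_gt1 q_le_l l_lt_qq hB U hesc _ _ L1 hd1 pA1 rA1.
- by rewrite /n; clear; lia.
- by rewrite /n; clear; lia.
have [C2f A2f sC2A2 _] := pA2.
have sC2A2' : C2 \subset A2 by rewrite (subset_trans (sub_cl r C2)).
have [||D [sD hP hGP]] := @linking T r t setT G A2 C2; first exact: subsetT.
  move=> X Y sGX sAY eXY; rewrite setTU leqNgt; apply/negP=> h.
  have sXY : ~: X \subset Y.
    by apply/subsetP=> x; rewrite inE => xX; have := in_setT x; rewrite -eXY inE (negPf xX).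
  have h2 : r (~: X :|: C2) <= r (Y :|: C2) by apply/rfS/setSU.
  have h3 : r A2 <= r (Y :|: C2) by apply: rfS; rewrite (subset_trans sAY) // subsetUl.
  have := L2 X sGX; move: ck2 h h2 h3 (rf_leT r C2); rewrite rA2 /cork /n /t; clear; lia.
have sC : C \subset cl r D.
  by rewrite (subset_trans sC1) // cl_sub (subset_trans sC2) // (subset_trans sD) // sub_cl.
rewrite (setUidPl sC2A2') in hP.
have rGD : r (G :|: D) + r C <= r G + r D.
  have := rf_mod r D sCG; have -> : r (C :|: D) = r D by rewrite setUC rf_subcl.
  by [].
have le1 : r (A2 :|: D) <= r (G :|: A2 :|: D) by rewrite -setUA; apply/rfS/subsetUr.
have sk : r (G :|: D) + r C = r D + r G by move: rGD hGP le1; rewrite rG /t; clear; lia.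
have rGA : r (G :|: A2 :|: D) <= r (A2 :|: D) by move: rGD hGP; rewrite rG /t; clear; lia.
have sG : G \subset cl r (A2 :|: D).
  have -> : cl r (A2 :|: D) = cl r (G :|: A2 :|: D).
    by apply: cl_eq_rank => //; rewrite (subset_trans _ (sub_cl _ _)) // -setUA subsetUr.
  by rewrite (subset_trans _ (sub_cl _ _)) // -setUA subsetUl.
have sC2D : cl r C2 \subset cl r D by apply: clS.
have pD : proj r (cl r D) (cl r (A2 :|: D)) q.
  have := @proj_contract T r l (cl r C2) A2 (cl r D) q U l_lt_qq pA2.
  rewrite cl_idem clU_cl rfU_cl !rf_cl [D :|: A2]setUC; apply=> //.
  by rewrite rA2 leq_add2l /n.
apply: (@hypers_skew T r C (cl r D) G e k) => //; rewrite ?flat_cl //.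
  by rewrite rfU_cl rf_cl setUC.
apply: (proj_sub pD); rewrite ?flat_cl // clU_cl; first by apply/clS/subsetUl.
by rewrite cl_sub subUset sG andbT (subset_trans _ (sub_cl _ _)) // subsetUr.
Qed.

Definition bounded_flats c c' m := exists N, forall T (r : rankfun T) C, no_long_line r l ->
  is_flat r C -> N <= cork r C -> c * Wf r C setT m <= c' * gbin q (cork r C) m.

(** Many flats force many points: [gbin_pow] bounds the count below by q^(m (cork - m)) and [Wf_pow]
    bounds it above by the m-th power of the number of points. *)
Lemma Wf_dn m T (r : rankfun T) C : is_flat r C -> 0 < m -> m <= cork r C ->
  gbin q (cork r C) m <= Wf r C setT m -> dn m r C.
Proof.
move=> Cf m0 hm h; rewrite /Density.dn.
have : q ^ (cork r C - m) <= nP r C setT.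
  rewrite -(leq_exp2r _ _ m0) -expnM mulnC; apply: leq_trans (gbin_pow q_gt1 hm) _.
  apply: leq_trans h _; apply: Wf_pow => //; by rewrite /is_flat eqEsubset subsetT sub_cl.
move=> h2; rewrite -mul2n expnMn; apply: leq_trans (_ : q ^ m * (2 ^ cork r C * nP r C setT) <= _).
  have -> : q ^ cork r C = q ^ m * q ^ (cork r C - m) by rewrite -expnD subnKC.
  by rewrite mulnCA !leq_mul2l h2 !orbT.
by rewrite leq_mul2l /Density.PHI leq_addr orbT.
Qed.

(** The crude bound (beta q^cork)^m exceeds the coefficient by a constant factor only, which [pow32]
    absorbs. *)
Lemma bounded_flats_top m : exists s, bounded_flats (2 ^ s) (3 ^ s) m.
Proof.
have [s hs] := pow32 (beta ^ m * q ^ (m * m)); exists s, m => T r C U Cf hm.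
have q0 : 0 < q by apply: ltnW.
have hT : is_flat r setT by rewrite /is_flat eqEsubset subsetT sub_cl.
have h1 : Wf r C setT m <= beta ^ m * q ^ (m * m) * gbin q (cork r C) m.
  apply: leq_trans (Wf_pow m Cf hT) _.
  apply: leq_trans (_ : (beta * q ^ cork r C) ^ m <= _).
    by case: (m) => // m'; rewrite leq_exp2r // (nP_le_beta q_gt1 q_le_l hB U).
  rewrite expnMn -mulnA leq_mul2l; apply/orP; right.
  apply: leq_trans (leq_mul (leqnn _) (gbin_pow q_gt1 hm)).
  by rewrite -expnM -expnD leq_exp2l // mulnC -mulnDr subnKC.
apply: leq_trans (leq_mul (leqnn _) h1) _; rewrite mulnA leq_mul2r hs orbT //.
Qed.

(* If X is small and its complement does not span, then the restriction to the complement has a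
   ratio larger by a factor 3/2. *)
Lemma bounded_flats_connected m s R : (forall j, j < m.+1 -> bounded_flats 1 1 j) ->
  bounded_flats (2 ^ s.+1) (3 ^ s.+1) m.+1 ->
  exists N, forall T (r : rankfun T) (C X : {set T}), no_long_line r l -> is_flat r C -> N <= cork r C ->
    3 ^ s * gbin q (cork r C) m.+1 < 2 ^ s * Wf r C setT m.+1 ->
    r (X :|: C) <= r C + R -> r (~: X :|: C) = r setT.
Proof.
move=> IH [N1 hN1].
have [N2 hN2] : exists N, forall j, j < m.+1 -> forall T (r : rankfun T) C, no_long_line r l ->
  is_flat r C -> N <= cork r C -> Wf r C setT j <= gbin q (cork r C) j.
  elim: m.+1 IH => [|i IHi] IH; first by exists 0.
  have [N3 hN3] := IHi (fun j h => IH j (ltnW h)); have [N4 hN4] := IH i (ltnSn _).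
  exists (N3 + N4) => j; rewrite ltnS leq_eqVlt => /orP[/eqP ->|ji] T r C U Cf hk.
    have := hN4 T r C U Cf; rewrite !mul1n; apply; apply: leq_trans hk; exact: leq_addl.
  by apply: hN3 => //; apply: leq_trans hk; apply: leq_addr.
(* Makes the flats lost in [Wf_split] at most half the coefficient of the restriction. Since that
   coefficient at least doubles with the rank, a ratio c >= 1 becomes at least 2c - 1/2 >= 3c/2. *)
have [N3 hN3] := gbin_sum q_gt1 (2 * 2 ^ l.+1 ^ R) m.+1.
exists (N1 + N2 + N3 + R) => T r C X U Cf hk hlt hX.
apply/eqP; rewrite eqn_leq rf_leT /= leqNgt; apply/negP=> hY.
have hsp := Wf_split l_gt0 U Cf hX m.+1.
set r' := rst r _ in hsp; set C' := cl r' C in hsp.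
have U' : no_long_line r' l by apply: rst_no_long_line.
have C'f : is_flat r' C' by apply: flat_cl.
have ck : cork r' C' = r (~: X :|: C) - r C by rewrite cork_cl /cork rst_T rst_in // subsetUr.
have hsub := rfUI r (X :|: C) (~: X :|: C).
have hc : r C <= r ((X :|: C) :&: (~: X :|: C)) by apply: rfS; rewrite subsetI !subsetUr.
have hT : (X :|: C) :|: (~: X :|: C) = setT by rewrite setUACA setUCr setTU.
rewrite hT in hsub.
have rYC : r C <= r (~: X :|: C) by apply/rfS/subsetUr.
have [k1 k2] : cork r' C' < cork r C /\ cork r C <= cork r' C' + R.
  by rewrite ck; move: hX hY hsub hc rYC (rf_leT r C); rewrite /cork; clear; lia.
have kk : N1 + N2 + N3 <= cork r' C' by move: hk k2; clear; lia.
have [ka [kb kc]] : N1 <= cork r' C' /\ N2 <= cork r' C' /\ N3 <= cork r' C' by move: kk; clear; lia.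
have h1 := hN1 T r' C' U' C'f ka.
have h2 : \sum_(j < m.+1) Wf r' C' setT j <= \sum_(j < m.+1) gbin q (cork r' C') j.
  by apply: leq_sum => j _; apply: hN2.
have h3 := hN3 _ kc.
have h4 : q ^ m.+1 * gbin q (cork r' C') m.+1 <= gbin q (cork r C) m.+1.
  apply: leq_trans (gbin_powS q _ _) _; exact: gbin_le.
have h5 : 2 <= q ^ m.+1 by rewrite expnS; apply: leq_trans q_gt1 _; rewrite leq_pmulr // expn_gt0 (ltnW q_gt1).
have h6 : 2 ^ s <= 3 ^ s by case: (s) => // s'; rewrite leq_exp2r.
move: hlt hsp h1 h2 h3 h4 h5 h6; rewrite (expnS 2) (expnS 3).
move: (Wf r C setT m.+1) (Wf r' C' setT m.+1) (\sum_(j < m.+1) Wf r' C' setT j) (\sum_(j < m.+1) gbin q (cork r' C') j) => W W' S S'.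
move: (gbin q (cork r C) m.+1) (gbin q (cork r' C') m.+1) (2 ^ s) (3 ^ s) (q ^ m.+1) (2 ^ l.+1 ^ R) => g g' a b Q K.
move=> h0 h7 h1 h2 h3 h4 h5 h6; move: h0; rewrite ltnNge => /negP; apply.
have i1 : K * S <= K * S' by rewrite leq_mul2l h2 orbT.
have i2 : a * (2 * W) <= a * (2 * W' + g').
  by rewrite leq_mul2l; apply/orP; right; move: h7 i1 h3; clear; lia.
have i3 : a * g' <= b * g' by rewrite leq_mul2r h6 orbT.
have i4 : b * (2 * g') <= b * g.
  by rewrite leq_mul2l; apply/orP; right; apply: leq_trans h4; rewrite leq_mul2r h5 orbT.
by move: i2 i3 i4 h1; clear; nia.
Qed.

(** A contraction with ratio above (3/2)^s is dense by [Wf_dn] and well connected by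
    [bounded_flats_connected], so [good_flats] gives flats the recursion that [gbin] satisfies. The
    excess thus persists down to a projective geometry, against [Wf_proj]. *)
Lemma bounded_flats_step m s : (forall j, j < m.+1 -> bounded_flats 1 1 j) ->
  bounded_flats (2 ^ s.+1) (3 ^ s.+1) m.+1 -> bounded_flats (2 ^ s) (3 ^ s) m.+1.
Proof.
move=> IH hs; have [N1 [R hgood]] := good_flats m.+1 m.+1.
have [N2 hconn] := bounded_flats_connected R IH hs.
have [N3 hN3] := IH m (ltnSn _).
pose Na := N1 + N2 + N3 + m.+1; pose n := Na + 3.
have [|N4 hproj] := proj_contraction q_gt1 q_le_l hB 0 0 m.+1 (n := n); first by rewrite /n addn3.
exists (Na + N4) => T r C U Cf hk; rewrite leqNgt; apply/negP=> hV.
pose V D := 3 ^ s * gbin q (cork r D) m.+1 < 2 ^ s * Wf r D setT m.+1.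
have h23 : 2 ^ s <= 3 ^ s by case: (s) => // s'; rewrite leq_exp2r.
have Vgt D : V D -> gbin q (cork r D) m.+1 < Wf r D setT m.+1.
  rewrite /V !ltnNge; apply: contra => le; apply: leq_mul => //.
have Vdn D : V D -> is_flat r D -> Na <= cork r D -> dn m.+1 r D.
  move=> /Vgt/ltnW h fD hD; apply: Wf_dn => //; move: hD; rewrite /Na; clear; lia.
have hT : is_flat r setT by rewrite /is_flat eqEsubset subsetT sub_cl.
have Vstep D e : V D -> is_flat r D -> e \notin D -> Na <= cork r (e |: D) -> V (cl r (e |: D)).
  move=> VD fD eD hD; have eD' : e \notin cl r D by rewrite notin_flat.
  have hD' : Na <= cork r D by rewrite (cork_U1 eD'); move: hD; clear; lia.
  have [k1 [k2 k3]] : N1 <= cork r D /\ N2 <= cork r D /\ N3 <= cork r (cl r (e |: D)).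
    by rewrite cork_cl; move: hD hD'; rewrite /Na; clear; lia.
  have hrec : Wf r D setT m.+1 <= Wf r (cl r (e |: D)) setT m + q ^ m.+1 * Wf r (cl r (e |: D)) setT m.+1.
    apply: Wf_rec => //; rewrite ?subsetT ?in_setT // => G fG sG _ rG.
    apply: (hgood T r D G e U fD (Vdn _ VD fD hD') k1) => //.
    - by move=> X; apply: hconn.
    - by apply: subset_trans sG; apply: subset_clU1.
    - by apply: (subsetP sG); apply: mem_clU1.
  have := hN3 T r _ U (flat_cl r (e |: D)) k3; rewrite !mul1n.
  move: VD hrec; rewrite /V !cork_cl (cork_U1 eD') gbinS.
  move: (Wf r D setT m.+1) (Wf r (cl r (e |: D)) setT m) (Wf r (cl r (e |: D)) setT m.+1) => W W0 W1.
  move: (gbin q _ m) (gbin q _ m.+1) (2 ^ s) (3 ^ s) h23 (q ^ m.+1) => g0 g1 a b hab Q h1 h2 h3.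
  rewrite ltnNge; apply/negP=> h4; move: h1; rewrite ltnNge => /negP; apply.
  apply: leq_trans (leq_mul (leqnn a) h2) _; rewrite !mulnDr; apply: leq_add; first exact: leq_mul.
  by rewrite mulnCA [X in _ <= X]mulnCA leq_mul2l h4 orbT.
have Vall D E : V D -> is_flat r D -> is_flat r E -> D \subset E -> Na <= cork r E -> V E.
  have [i] := ubnP (r E - r D); elim: i D => // i IHi D lt VD fD fE sDE hE.
  have [le|/ltn_rank_ex[e eE eD]] := leqP (r E) (r D); first by rewrite -(flat_eq fD fE sDE le).
  have sE : cl r (e |: D) \subset E by apply: flat_U1.
  have rD : r (cl r (e |: D)) = (r D).+1 by rewrite rf_cl rf_notin_cl.
  have le := rfS r sE.
  apply: (IHi (cl r (e |: D))) => //; rewrite ?flat_cl //; first by move: lt le; rewrite rD; clear; lia.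
  apply: Vstep => //; first by rewrite -(notin_flat e fD).
  by rewrite -cork_cl; apply: leq_trans hE _; rewrite /cork leq_sub2l.
(* Nothing has to be kept linked here, so R = 0 and [proj_descend] ends at corank n, where A2 is
   everything. *)
have hesc : escapes l q B 0 0 m.+1 r (fun=> True).
  by move=> D _ _ _; exists set0 => //; rewrite set0U addn0.
have hd : dn m.+1 r C by apply: Vdn => //; apply: leq_trans hk; apply: leq_addr.
have [|C1 [A1 [sC1 _ pA1 rA1]]] := hproj T r _ C U hesc I hd; first by apply: leq_trans hk; apply: leq_addl.
have hd1 : dn m.+1 r C1 by apply: dn_mono hd.
have [||C2 [A2 [sC2 _ pA2 rA2 ck2]]] := proj_descend q_gt1 q_le_l l_lt_qq hB U hesc _ _ I hd1 pA1 rA1.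
- by [].
- by rewrite /n addn3.
have [C2f A2f _ _] := pA2; have leA := rf_leT r A2.
have eA2 : A2 = setT.
  by apply: (flat_eq A2f hT (subsetT _)); move: ck2 leA; rewrite rA2 /cork; clear; lia.
have ckn : cork r (cl r C2) = n by rewrite cork_cl; move: ck2 leA; rewrite rA2 /cork; clear; lia.
have sCC2 : C \subset cl r C2 by rewrite (subset_trans sC1) // clS.
have := Vgt _ (Vall C (cl r C2) hV Cf C2f sCC2 _); rewrite ckn => /(_ (leq_addr _ _)).
by rewrite ltnNge (Wf_proj (n := n) m.+1 _ _) // -?eA2 // rf_cl.
Qed.

Lemma bounded_flats_all m : bounded_flats 1 1 m.
Proof.
have [i] := ubnP m; elim: i m => // i IHi [|m] lt.
  by exists 0 => T r C U Cf _; rewrite !mul1n gbin0; apply: Wf0.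
(* The exponent s descends to 0, where both factors are 1. *)
have [s] := bounded_flats_top m.+1; elim: s => // s IHs /bounded_flats_step h; apply: IHs; apply: h.
by move=> j hj; apply: IHi; apply: leq_trans hj lt.
Qed.
End MainInduction.

(** * Matroids *)

Section MatroidRank.
Variables (T : finType) (M : matroid T).
Implicit Types (A B C D F I J K X : {set T}).

Lemma card_le_rk I X : indep M I -> I \subset X -> #|I| <= rk M X.
Proof.
by move=> iI sI; rewrite /rk; apply: (leq_bigmax_cond (F := fun I : {set T} => #|I|)); rewrite iI.
Qed.

Lemma rk_extend I X : indep M I -> I \subset X ->
  exists J, [/\ I \subset J, J \subset X, indep M J & #|J| = rk M X].
Proof.
move=> iI sI; have [|J /maxsetP[/andP[iJ sJ] mJ] sIJ] :=
  @maxset_exists T (fun J => indep M J && (J \subset X)) I; first by rewrite iI.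
exists J; split=> //; apply/eqP; rewrite eqn_leq card_le_rk //= leqNgt; apply/negP=> lt.
have [K /andP[iK sK] eK] : {K : {set T} | indep M K && (K \subset X) & rk M X = #|K|}.
  by apply: eq_bigmax_cond; apply/card_gt0P; exists set0; rewrite unfold_in /= indep0 sub0set.
rewrite eK in lt; have [x /setDP[xK xJ] ix] := indep_aug iJ iK lt.
have := mJ (x |: J); rewrite ix subUset sub1set (subsetP sK) // sJ subsetUr => /(_ isT isT) e.
by move: xJ; rewrite -e setU11.
Qed.

Lemma rk_set0 : rk M set0 = 0.
Proof.
have [J [_ + _ <-]] := rk_extend (indep0 M) (sub0set set0).
by rewrite subset0 => /eqP ->; rewrite cards0.
Qed.

Lemma rkS A B : A \subset B -> rk M A <= rk M B.
Proof.
move=> s; have [J [_ sJ iJ <-]] := rk_extend (indep0 M) (sub0set A).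
exact: card_le_rk iJ (subset_trans sJ s).
Qed.

Lemma rkU1 x A : rk M (x |: A) <= (rk M A).+1.
Proof.
have [J [_ sJ iJ <-]] := rk_extend (indep0 M) (sub0set (x |: A)).
have : #|J :\ x| <= rk M A.
  apply: card_le_rk; first by apply: indep_sub iJ; apply: subD1set.
  by rewrite subDset.
by have := cardsD1 x J; case: (x \in J); lia.
Qed.

Lemma rkUI A B : rk M (A :|: B) + rk M (A :&: B) <= rk M A + rk M B.
Proof.
have [I [_ sI iI <-]] := rk_extend (indep0 M) (sub0set (A :&: B)).
have [|J [sIJ sJ iJ <-]] := @rk_extend I (A :|: B) iI.
  by rewrite (subset_trans sI) // (subset_trans (subsetIl _ _)) // subsetUl.
have hA : #|J :&: A| <= rk M A by apply: card_le_rk (subsetIr _ _); apply: indep_sub iJ; apply: subsetIl.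
have hB : #|J :&: B| <= rk M B by apply: card_le_rk (subsetIr _ _); apply: indep_sub iJ; apply: subsetIl.
have hI : #|I| <= #|(J :&: A) :&: (J :&: B)|.
  by apply: subset_leq_card; rewrite -setIIr subsetI sIJ.
have := cardsUI (J :&: A) (J :&: B); rewrite -setIUr (setIidPl sJ); lia.
Qed.

Definition mrf := RankFun rk_set0 rkS rkU1 rkUI.

Lemma rk_ground X : rk M (X :&: ground M) = rk M X.
Proof.
apply/eqP; rewrite eqn_leq rkS ?subsetIl //=.
have [J [_ sJ iJ <-]] := rk_extend (indep0 M) (sub0set X).
by apply: card_le_rk => //; rewrite subsetI sJ (indep_ground iJ).
Qed.

Lemma rk_notin x X : x \notin ground M -> rk M (x |: X) = rk M X.
Proof.
move=> xM; rewrite -rk_ground -[RHS]rk_ground; congr (rk M _); apply/setP=> z; rewrite !inE.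
by case: eqVneq => // ->; rewrite (negPf xM) !andbF.
Qed.

(** Closing a flat in [T] only adds loops outside the ground set, and intersecting with the ground
    set recovers it. *)
Lemma num_flats_le k : num_flats M k <= Wf mrf (cl mrf set0) setT k.
Proof.
have inj : {in [set F | flat M F & rk M F == k] &, injective (cl mrf)}.
  have clF F : F \in [set F | flat M F & rk M F == k] -> F = cl mrf F :&: ground M.
    rewrite inE => /andP[/eqP fF _]; apply/setP=> x; rewrite -[in LHS]fF !inE clE /= andbC.
    by [].
  by move=> F G /clF eF /clF eG e; rewrite eF eG e.
rewrite /num_flats -(card_in_imset inj); apply: subset_leq_card; apply/subsetP=> _ /imsetP[F + ->].
by rewrite !inE => /andP[_ /eqP rF]; rewrite flat_cl clS ?sub0set // subsetT !rf_cl /= rk_set0 rF eqxx.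
Qed.

Lemma mbasis_rk C I : mbasis M C I -> #|I| = rk M C.
Proof.
case/maxsetP=> /andP[iI sI] mI; have [J [sIJ sJ iJ <-]] := rk_extend iI sI.
by rewrite (mI J) // iJ.
Qed.

Lemma line_indep C x y I : mbasis M C I -> x \notin C -> y \notin C ->
  rk M (x |: (y |: C)) = (rk M C).+2 -> indep M (x |: (y |: I)).
Proof.
move=> bI xC yC rxy; have /maxsetP[/andP[iI sI] mI] := bI.
have [|J [sIJ sJ iJ cJ]] := @rk_extend I (x |: (y |: C)) iI.
  by rewrite (subset_trans sI) // setUA subsetUr.
have eI : J :&: C = I.
  apply: mI; last by rewrite subsetI sIJ.
  by rewrite subsetIr (indep_sub (subsetIl _ _) iJ).
have sJ' : J \subset x |: (y |: I).
  apply/subsetP=> z zJ; have := subsetP sJ _ zJ; rewrite !inE -eI inE zJ.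
  by case: (z == x); case: (z == y).
suff -> : x |: (y |: I) = J by [].
symmetry; apply/eqP; rewrite eqEcard sJ' cJ rxy -(mbasis_rk bI).
rewrite !cardsU1; case: (x \notin _); case: (y \notin _); clear; lia.
Qed.

Lemma pair_cover (S I : {set T}) : 1 < #|S| -> I \subset S -> #|I| <= 2 ->
  exists x y, [/\ x \in S, y \in S, x != y & I \subset [set x; y]].
Proof.
move=> S2 sI cI.
have [x xS hx] : exists2 x, x \in S & #|I :\ x| <= 1.
  have [I0|[x xI]] := set_0Vmem I.
    have /card_gt0P[x xS] : 0 < #|S| by apply: ltnW.
    by exists x => //; rewrite I0 set0D cards0.
  exists x; first exact: (subsetP sI).
  by move: cI; rewrite (cardsD1 x) xI.
have [y [yS yx sy]] : exists y, [/\ y \in S, y != x & I :\ x \subset [set y]].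
  have [I0|[y]] := set_0Vmem (I :\ x).
    have /card_gt0P[y] : 0 < #|S :\ x| by move: S2; rewrite (cardsD1 x) xS.
    by rewrite !inE => /andP[yx yS]; exists y; rewrite I0 sub0set.
  move=> yI; have := yI; rewrite !inE => /andP[yx yI']; exists y; split=> //; first exact: (subsetP sI).
  by have /card_le1P/(_ y yI) h := hx; apply/subsetP=> z; rewrite h !inE.
exists x, y; split=> //; first by rewrite eq_sym.
by rewrite -subDset.
Qed.

Lemma subset_card_ex (S : {set T}) n : n <= #|S| -> exists2 S' : {set T}, S' \subset S & #|S'| = n.
Proof.
move=> le; exists [set x in take n (enum S)].
  by apply/subsetP=> x; rewrite inE => /mem_take; rewrite mem_enum.
rewrite cardsE; have /card_uniqP -> := take_uniq n (enum_uniq (mem S)).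
by rewrite size_takel // -cardE.
Qed.

(** A long line S over C gives the minor by contracting C and deleting all but S. *)
Lemma matroid_no_long_line l : ~ has_minor M (uniform 2 (l + 2)) -> no_long_line mrf l.
Proof.
move=> hM C S0 hS0 h0; rewrite leqNgt; apply/negP=> gt; apply: hM.
have [S sS cS] : exists2 S : {set T}, S \subset S0 & #|S| = l + 2.
  by apply: subset_card_ex; rewrite addn2.
have hS : rk M (S :|: C) <= (rk M C).+2 by apply: leq_trans hS0; apply/rkS/setSU.
have h2 : {in S &, forall x y, x != y -> rk M (x |: (y |: C)) = (rk M C).+2}.
  by move=> x y xS yS; apply: h0; apply: (subsetP sS).
have S2 : 1 < #|S| by rewrite cS addn2.
have notin x : x \in S -> x \in ground M /\ x \notin C.
  move=> xS; have /card_gt0P[y] : 0 < #|S :\ x| by move: S2; rewrite (cardsD1 x) xS.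
  rewrite !inE => /andP[yx yS]; have h := h2 y x yS xS yx; split; apply: contraT => hx.
    by have := rkU1 y C; move: h; rewrite setUCA rk_notin // => ->; rewrite ltnn.
  rewrite negbK in hx; have := rkU1 y C; move: h; rewrite setUCA (setUidPr (_ : [set x] \subset y |: C)).
    by move=> ->; rewrite ltnn.
  by rewrite sub1set inE hx orbT.
(* A minor is formed inside the ground set; cutting C down to it leaves the rank unchanged. *)
pose G := ground M; pose C0 := C :&: G; pose D := G :\: (C0 :|: S).
have rC0 : rk M C0 = rk M C by apply: rk_ground.
have sSG : S \subset G by apply/subsetP=> x /notin[].
have SC0 x : x \in S -> x \notin C0 by move/notin=> [_ xC]; rewrite inE (negPf xC).
have gN : ground (delete (contract M C0) D) = S.
  apply/setP=> x; rewrite /= !inE; have [xS|xS] := boolP (x \in S).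
    by have [xG xC] := notin _ xS; rewrite orbT xG (negPf xC).
  by rewrite orbF /G; case: (x \in ground M); case: (x \in C).
have disj (I J : {set T}) : I \subset S -> J \subset C0 -> #|I :|: J| = #|I| + #|J|.
  move=> sI sJ; apply/eqP; rewrite (leq_card_setU I J) disjoint_subset.
  by apply/subsetP=> x /(subsetP sI)/SC0; apply: contra => /(subsetP sJ).
have iN (I : {set T}) : I \subset S -> indep (delete (contract M C0) D) I = (#|I| <= 2).
  move=> sI; rewrite /= /delete_indep /contract_indep /=.
  have sIC : I \subset G :\: C0.
    by apply/subsetP=> x /(subsetP sI) xS; rewrite inE SC0 // (subsetP sSG).
  have sID : I \subset G :\: C0 :\: D.
    by rewrite -[G :\: C0 :\: D]/(ground (delete (contract M C0) D)) gN.
  rewrite /contract_indep -/G sIC sID andbT /=; apply/existsP/idP.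
    move=> [J /andP[bJ iJ]]; have /maxsetP[/andP[_ sJ] _] := bJ.
    have : #|I :|: J| <= rk M (S :|: C).
      apply: card_le_rk => //; apply: setUSS => //; apply: subset_trans sJ _; exact: subsetIl.
    by rewrite disj // (mbasis_rk bJ) rC0; move: hS; lia.
  move=> cI; have [x [y [xS yS nxy sxy]]] := pair_cover S2 sI cI.
  have [J bJ] := mbasis_exists M C0; exists J; rewrite bJ /=.
  have iJ : indep M (x |: (y |: J)).
    apply: (line_indep bJ); rewrite ?SC0 // rC0 -(h2 x y) // -rk_ground -[RHS]rk_ground; congr (rk M _).
    by apply/setP=> z; rewrite !inE -/G; case: (z \in G); rewrite ?andbT ?andbF.
  by apply: indep_sub iJ; rewrite setUA setSU.
exists C0, D; split; first exact: subsetIr.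
- exact: subsetDl.
- rewrite disjoint_subset; apply/subsetP=> x xC; rewrite !inE.
  by move: xC; rewrite inE => /andP[-> ->].
set N := delete _ _ in gN iN *.
have eN : #|{: {x : T | x \in ground N}}| = #|{: {y : 'I_(l + 2) | y \in ground (uniform 2 (l + 2))}}|.
  rewrite !card_sig; transitivity (l + 2).
    by rewrite -cS -gN; apply: eq_card => x; rewrite inE.
  by rewrite -[LHS]card_ord; apply: eq_card => x; rewrite !inE.
(* Independence depends on cardinality alone on both sides, so any bijection is an isomorphism. *)
pose f x := enum_val (cast_ord eN (enum_rank x)).
have bf : bijective f.
  exists (fun y => enum_val (cast_ord (esym eN) (enum_rank y))) => z; rewrite /f enum_valK ?cast_ordK ?cast_ordKV enum_rankK //.
exists f => // X; rewrite iN; last by rewrite -gN; apply/subsetP=> _ /imsetP[z _ ->]; apply: (valP z).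
by rewrite /= /unif_indep !card_imset //; first [exact: val_inj | exact: bij_inj bf].
Qed.

End MatroidRank.

Import GRing.Theory.

Lemma gbin_qbinom q n k : 1 < q -> ((gbin q n k)%:R = qbinom q n k :> rat)%R.
Proof.
move=> q1; pose Nn n k := (\prod_(i < k) (q%:R ^+ (n - i) - 1) : rat)%R.
have NS m j : Nn m j.+1 = (Nn m j * (q%:R ^+ (m - j) - 1))%R by rewrite /Nn big_ord_recr.
have NS' m j : Nn m.+1 j.+1 = ((q%:R ^+ m.+1 - 1) * Nn m j)%R by rewrite /Nn big_ord_recl subn0.
(* The factor of index i = m is q^0 - 1 = 0, matching the vanishing of [gbin] there. *)
have N0 m j : m < j -> Nn m j = 0%R.
  move=> lt; rewrite /Nn (bigD1 (Ordinal lt)) //= subnn expr0 subrr mul0r //.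
have qn0 j : ((q%:R ^+ j.+1 - 1 : rat) != 0)%R.
  by rewrite subr_eq0 -natrX Num.Theory.pnatr_eq1 gtn_eqF // -(exp1n j.+1) ltn_exp2r.
have D0 j : (Nn j j != 0)%R.
  by apply/prodf_neq0 => i _; have := ltn_ord i; rewrite -subn_gt0; case: (j - i) => // a _; apply: qn0.
have -> : qbinom q n k = (Nn n k / Nn k k)%R by [].
elim: n k => [|n IH] [|k].
- by rewrite /Nn !big_ord0 divr1.
- by rewrite N0 // mul0r.
- by rewrite gbin0 /Nn !big_ord0 divr1.
rewrite gbinS natrD natrM natrX !IH !NS' NS.
have [le|lt] := leqP k n; last by rewrite (N0 n k) // !(mulr0, mul0r) addr0.
have -> : (q%:R ^+ n.+1 = q%:R ^+ k.+1 * q%:R ^+ (n - k) :> rat)%R by rewrite -exprD addSn subnKC.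
move: (qn0 k) (D0 k); move: (Nn n k) (Nn k k) (q%:R ^+ k.+1)%R (q%:R ^+ (n - k))%R => a b c d h1 h2.
by field; rewrite h1 h2.
Qed.

Theorem theorem1p2 (l k q : nat) (hl : 2 <= l)
    (hq : prime_power q) (hql : q <= l)
    (hmax : forall q' : nat, prime_power q' -> q' <= l -> q' <= q) :
  exists r0 : nat,
    forall r : nat, r0 <= r ->
    forall (T : finType) (M : matroid T),
      mrank M = r ->
      ~ has_minor M (uniform 2 (l + 2)) ->
      ((num_flats M k)%:R <= qbinom q r k)%R.
Proof.
have q1 : 1 < q.
  have [p [e [pp e0 ->]]] := hq; by rewrite -(exp1n e) ltn_exp2r // prime_gt1.
(* With 2^t <= l < 2^(t+1) and t > 0, the prime power 2^t is at most q, so l < 2 * 2^t <= q * q. *)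
have lqq : l < q * q.
  have /andP[h1 h2] := trunc_log_bounds (isT : 1 < 2) (ltnW hl).
  have h3 : 2 ^ trunc_log 2 l <= q.
    apply: hmax => //; exists 2, (trunc_log 2 l); split=> //.
    by rewrite lt0n; apply: contraTneq h2 => ->; rewrite -leqNgt.
  rewrite expnS in h2; apply: leq_trans h2 _; exact: leq_mul.
have [B hB] := long_lines_sparse q1 hql lqq hmax.
have [N hN] := bounded_flats_all q1 hql lqq hB k; exists N => r hr T M rM hM.
have U := matroid_no_long_line hM.
have ck : cork (mrf M) (cl (mrf M) set0) = r.
  by rewrite /cork rf_cl /= rk_set0 subn0 -rM /mrank -[LHS]rk_ground setTI.
have := hN T (mrf M) _ U (flat_cl (mrf M) set0); rewrite ck !mul1n => /(_ hr) h.
rewrite -gbin_qbinom // Num.Theory.ler_nat; exact: leq_trans (num_flats_le M k) h.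
Qed.
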